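(* Let $\widehat\omega_T$ be a relatively open subset of $[0,T]\times\mathcal O$ satisfying $\tilde\omega_T\Subset\widehat\omega_T$, and let $\tilde\psi,\psi,\theta,\varphi,\xi$ be the weight functions defined in the context. For all $m\ge1$, there exist constants $C_0>0$, $s_0\ge1$ and $\lambda_0\ge1$ such that for all smooth functions $z$ on $\overline{\mathcal O_T}$ satisfying $z=0$ on $\Gamma_T$, for all $s\ge s_0$, $\lambda\ge\lambda_0$, we have $$\begin{aligned} &\int_{\mathcal O}|\nabla z(0)|^2e^{-2s\varphi(0)}+s^2\lambda^3e^{2\lambda(6m+1)}\int_{\mathcal O}|z(0)|^2e^{-2s\varphi(0)}+s\lambda^2\iint_{\mathcal O_T}\xi|\nabla z|^2e^{-2s\varphi}+s^3\lambda^4\iint_{\mathcal O_T}\xi^3|z|^2e^{-2s\varphi}\\ &\qquad\le C_0\iint_{\mathcal O_T}|(-\overline\sigma\partial_t-\nu\Delta)z|^2e^{-2s\varphi}+C_0s^3\lambda^4\iint_{\widehat\omega_T}\xi^3|z|^2e^{-2s\varphi}. \end{aligned}$$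
   Context: $\Omega\subset\mathcal O\subset\mathbb R^2$ are smooth bounded domains, $\partial\mathcal O$ of class $C^2$, $T>0$, $\nu>0$, $\overline\sigma\in C^2([0,T]\times\overline{\mathcal O})$ with $\inf_{[0,T]\times\overline{\mathcal O}}\overline\sigma>0$. $\mathcal O_T=(0,T)\times\mathcal O$, $\Gamma_T=(0,T)\times\partial\mathcal O$. $\tilde\omega_T$ is an open subset of $[0,T]\times(\mathcal O\setminus\overline\Omega)$. The symbol $A\Subset B$ means that there is a compact set $K$ with $A\subset K\subset B$. Weights. $\tilde\psi\in C^2(\overline{\mathcal O_T})$ satisfies: $\tilde\psi\in[0,1]$ on $\overline{\mathcal O_T}$; $\partial_{\mathbf n}\tilde\psi\le0$ on $\Gamma_T$; for every $t\in[0,T]$, $\tilde\psi(t,\cdot)$ is constant on $\partial\mathcal O$ and $\inf_{\mathcal O}\tilde\psi(t,\cdot)=\tilde\psi(t)|_{\partial\mathcal O}$; and there is $\alpha>0$ with $\inf_{\mathcal O_T\setminus\tilde\omega_T}|\nabla\tilde\psi|\ge\alpha$. For $m\ge1$, $\psi=\tilde\psi+6m$. Fix $T_0>0$, $0<T_1\le1/4$ with $T_0+2T_1<T$. For $\mu\ge2$, $\theta=\theta_{m,\mu}\in C^2([0,T))$ satisfies $\theta(t)=1+(1-t/T_0)^\mu$ on $[0,T_0]$, $\theta=1$ on $[T_0,T-2T_1]$, $\theta$ is increasing on $[T-2T_1,T-T_1]$, $\theta(t)=(T-t)^{-m}$ on $[T-T_1,T)$ (the values on $[T-2T_1,T)$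 being chosen independently of $\mu$). For $s,\lambda\ge1$ one takes $\mu=s\lambda^2e^{\lambda(6m-4)}$ and $$\varphi(t,x)=\theta(t)\big(\lambda e^{6\lambda(m+1)}-e^{\lambda\psi(t,x)}\big),\qquad \xi(t,x)=\theta(t)e^{\lambda\psi(t,x)}.$$ *)

(* Defs.v *)
From HB Require Import structures.
From mathcomp Require Import all_boot all_order all_algebra.
From mathcomp Require Import all_classical all_reals all_analysis.

Set Implicit Arguments.
Unset Strict Implicit.
Unset Printing Implicit Defensive.

Import Order.TTheory GRing.Theory Num.Theory.
Import numFieldNormedType.Exports.

Local Open Scope classical_set_scope.
Local Open Scope ring_scope.

(* The plane is R * R and space-time is R * (R * R), points being written
   (t, x) with x = (x1, x2); the library norm on products is the max norm, so
   Euclidean lengths are written out. *)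

(* f is of class C^k in the open set U, and f and its derivatives of order
   <= k extend continuously to A, where U `<=` A `<=` closure U.  Directional
   derivatives along all v are the linear combinations of the partial ones;
   g is the extension of 'D_v f and is determined on A because U is dense
   there.  With A = closure U this is C^k of the closed set. *)
Fixpoint class_C {R : realType} {V : normedModType R} (k : nat) (U A : set V)
    (f : V -> R) : Prop :=
  {within A, continuous f} /\
  match k with
  | 0%N => True
  | k'.+1 => forall v : V,
      (forall x, U x -> derivable f x v) /\
      exists g : V -> R,
        (forall x, U x -> g x = 'D_v f x) /\ class_C k' U A g
  end.

Definition smooth {R : realType} {V : normedModType R} (U A : set V)
    (f : V -> R) : Prop :=
  forall k, class_C k U A f.

Definition bdry {X : topologicalType} (A : set X) : set X :=
  closure A `\` interior A.

Definition rel_open {X : topologicalType} (Y A : set X) : Prop :=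
  exists2 V : set X, open V & A = Y `&` V.

Definition compactly_contained {X : topologicalType} (A B : set X) : Prop :=
  exists K : set X, [/\ compact K, A `<=` K & K `<=` B].

Definition bounded_domain {R : realType} (O : set (R * R)) : Prop :=
  [/\ open O, connected O, O !=set0 & bounded_set O].

(* In the coordinates (u, v) of the orthonormal frame (a, b), (-b, a), the set
   O is, near x0, the strict epigraph of a C^2 function gam. *)
Definition C2_chart {R : realType} (O : set (R * R)) (x0 : R * R)
    (a b : R) (gam : R -> R) : Prop :=
  [/\ a ^+ 2 + b ^+ 2 = 1,
      class_C 2 setT setT gam
    & \forall x \near x0,
        O x <-> gam (a * x.1 + b * x.2) < - b * x.1 + a * x.2].

Definition C2_boundary {R : realType} (O : set (R * R)) : Prop :=
  forall x0, bdry O x0 -> exists a b gam, C2_chart O x0 a b gam.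

(* The outward unit normal at x0 is the normalized gradient of
   gam(u(x)) - v(x). *)
Definition outward_normal {R : realType} (O : set (R * R)) (x0 n : R * R) :
    Prop :=
  exists a b gam, C2_chart O x0 a b gam /\
    let d := derive1 gam (a * x0.1 + b * x0.2) in
    let N := Num.sqrt (1 + d ^+ 2) in
    n = ((d * a + b) / N, (d * b - a) / N).

Section SpaceTime.
Variable R : realType.
Implicit Types (f : R * (R * R) -> R) (p : R * (R * R)).

Definition dt f p : R := 'D_((1, (0, 0)) : R * (R * R)) f p.
Definition dx1 f p : R := 'D_((0, (1, 0)) : R * (R * R)) f p.
Definition dx2 f p : R := 'D_((0, (0, 1)) : R * (R * R)) f p.

(* |grad f|^2 and the Laplacian are taken in the space variable only. *)
Definition grad2 f p : R := dx1 f p ^+ 2 + dx2 f p ^+ 2.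
Definition lapl f p : R := dx1 (dx1 f) p + dx2 (dx2 f) p.

(* grad f . n at a boundary point p of U, the gradient at p being the
   continuous extension of the gradient inside U. *)
Definition normal_deriv (U : set (R * (R * R))) f (n : R * R) p : R :=
  lim ((fun q => dx1 f q * n.1 + dx2 f q * n.2) @ within U (nbhs p)).

Definition cyl (T : R) (O : set (R * R)) : set (R * (R * R)) :=
  `]0, T[ `*` O.

Definition is_tpsi (T : R) (O : set (R * R)) (tomega : set (R * (R * R)))
    (alpha : R) (tpsi : R * (R * R) -> R) : Prop :=
  [/\ class_C 2 (cyl T O) (closure (cyl T O)) tpsi,
      (forall p, closure (cyl T O) p -> 0 <= tpsi p <= 1),
      (forall t x n, 0 < t < T -> bdry O x -> outward_normal O x n ->
         normal_deriv (cyl T O) tpsi n (t, x) <= 0),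
      (forall t, 0 <= t <= T ->
         (forall x y, bdry O x -> bdry O y -> tpsi (t, x) = tpsi (t, y)) /\
         (forall y, bdry O y ->
            inf [set tpsi (t, x) | x in O] = tpsi (t, y)))
    & 0 < alpha /\
      alpha <= inf [set Num.sqrt (grad2 tpsi p) | p in cyl T O `\` tomega]].

Definition is_theta (T T0 T1 m mu : R) (theta : R -> R) : Prop :=
  [/\ class_C 2 `]0, T[ `[0, T[ theta,
      (forall t, 0 <= t <= T0 -> theta t = 1 + (1 - t / T0) `^ mu),
      (forall t, T0 <= t <= T - 2 * T1 -> theta t = 1),
      {in `[T - 2 * T1, T - T1] &, {homo theta : t u / t <= u}}
    & (forall t, T - T1 <= t < T -> theta t = (T - t) `^ (- m))].

(* Theta mu is the function theta_{m,mu}.  The value mu = 2 is left out: the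
   prescribed 1 + (1 - t / T0)^2 on [0, T0], followed by 1, is not C^2 at T0.
   The parameters mu_par m s lam used in the weights, for s, lam, m >= 1, are
   all > 2. *)
Definition is_theta_family (T T0 T1 m : R) (Theta : R -> R -> R) : Prop :=
  (forall mu, 2 < mu -> is_theta T T0 T1 m mu (Theta mu)) /\
  (forall mu mu' t, 2 < mu -> 2 < mu' -> T - 2 * T1 <= t < T ->
     Theta mu t = Theta mu' t).

Definition mu_par (m s lam : R) : R :=
  s * lam ^+ 2 * expR (lam * (6 * m - 4)).

Section Weights.
Variables (m s lam : R) (Theta : R -> R -> R) (tpsi : R * (R * R) -> R).

Definition psi p : R := tpsi p + 6 * m.

Definition phi p : R :=
  Theta (mu_par m s lam) p.1 *
    (lam * expR (6 * lam * (m + 1)) - expR (lam * psi p)).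

Definition xi p : R :=
  Theta (mu_par m s lam) p.1 * expR (lam * psi p).

End Weights.

End SpaceTime.

(* Lebesgue measure on the plane and on space-time. *)
Definition leb2 (R : realType) := (@lebesgue_measure R \x @lebesgue_measure R)%E.
Arguments leb2 : clear implicits.
HB.instance Definition _ (R : realType) := Measure.on (leb2 R).

(* The library does not infer that a product of sigma-finite measures is
   sigma-finite; this is needed for leb3 to be inferred to be a measure. *)
Lemma leb2_sigma_finite (R : realType) : sigma_finite setT (leb2 R).
Proof.
have /sigma_finiteP[F [TF ndF Foo]] := sigma_finiteT (@lebesgue_measure R).
exists (fun n => F n `*` F n).
  rewrite -setXTT TF predeqE => -[x y]; split; last first.
    by move=> [n _ []/= ? ?]; split; exists n.
  move=> [/= [n _ Fnx] [k _ Fky]]; exists (maxn n k) => //; split.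
  - by move: x Fnx; exact/subsetPset/ndF/leq_maxl.
  - by move: y Fky; exact/subsetPset/ndF/leq_maxr.
move=> k; have [mF Fk] := Foo k; split; first exact: measurableX.
by rewrite [X in (X < _)%E]product_measure1E// lte_mul_pinfty// ge0_fin_numE.
Qed.

HB.instance Definition _ (R : realType) :=
  Measure_isSigmaFinite.Build _ _ _ (leb2 R) (@leb2_sigma_finite R).

Definition leb3 (R : realType) := (@lebesgue_measure R \x leb2 R)%E.
Arguments leb3 : clear implicits.
HB.instance Definition _ (R : realType) := Measure.on (leb3 R).

(* Main.v *)
Require Import Defs.
From HB Require Import structures.
From mathcomp Require Import all_boot all_order all_algebra.
From mathcomp Require Import all_classical all_reals all_analysis.
From mathcomp Require Import ring lra measurable_realfun.

Set Implicit Arguments.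
Unset Strict Implicit.
Unset Printing Implicit Defensive.

Import Order.TTheory GRing.Theory Num.Theory.
Import numFieldNormedType.Exports.

Local Open Scope classical_set_scope.
Local Open Scope ring_scope.

(** The estimate is an energy identity for the conjugated function
w = e^{-s phi} z, in the manner of Fursikov and Imanuvilov.

Put W = s lam xi, so that the gradient of s phi is - W grad Psi, where Psi is the
space weight. The conjugate of - sg dt - nu Delta splits into a symmetric part
P1 = - nu Delta w + V w, with V = - nu W^2 |grad Psi|^2 - sg dt (s phi), a skew part
P2 = - sg dt w + 2 nu W grad Psi . grad w + 2 nu lam W |grad Psi|^2 w, and a term of
order zero. The cross product 2 P1 P2 is a divergence in space-time, plus quadratic
terms among which those of weight lam,
  lam W |grad w|^2 and lam W^3 w^2,
carry positive powers of |grad Psi| (flux_identity, potential_identity). Testing the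
equation in addition with lam W chi w, where chi is a cut-off that is at least 1
where grad Psi may vanish, makes these terms coercive everywhere, at the price of
the local term. All other terms lose a factor lam and are absorbed for lam large
(carleman_pointwise).

The constants must not depend on s and lam although theta does, through its
exponent mu. The positive part of theta' and theta'' are controlled by theta^2 and
theta^3 + mu^2, with a factor that does not depend on mu (theta_bounds), and
s mu^2 Lam <= W^3 by the choice of mu (weight_facts). The negative part of theta' is
of order mu, which W does not control, but it contributes to the coefficient of w^2
with the favourable sign. At t = 0 it is even an asset: theta'(0) = - mu / T0 makes V
positive and of order lam W^2, so the energy at t = 0 bounds the terms at t = 0 of
the left-hand side (initial_energy). At t = T the weight e^{-2 s phi} kills the
energy: the estimate is proved on (0, T') and T' tends to T (slab_estimate,
terminal_energy, carleman_limit).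

What remains is the flux through the lateral boundary. It is never written as an
integral over that boundary. The pointwise inequality is multiplied by a cut-off of
a function D that is positive in the cylinder and vanishes on the lateral boundary
(energy_estimate), so only a bound from above for the flux across the level sets of
D close to 0 is needed. Near the boundary D is Psi minus its boundary value
(layer_function); its gradient is grad Psi, and the scalar product of grad Psi with
the flux contains - 2 nu^2 W (grad Psi . grad w)^2, which has the right sign. Every
other term is O(D) (flux_strip). Indeed w and dt w vanish on the boundary, and Psi
decreases at a definite rate along - grad Psi while it stays above its boundary
value, so a point at height D lies at distance O(D) from the boundary
(descent, vanish_bound); the derivative of w orthogonal to grad Psi is O(sqrt D), as
a Taylor expansion over a length sqrt D shows (tangential_bound). *)

(** * Bounds by powers of a large constant *)

Section Bd.
Variables (R : realFieldType) (K : R).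
Hypothesis hK : 4 <= K.

(** Relative bounds with an explicit exponent: X is the monomial of reference, and
the constants lost along a computation are recorded as powers of the single
constant K, so that one power absorbs a whole polynomial error. *)
Definition bd (n : nat) (X x : R) : Prop := `|x| <= K ^+ n * X.

Let K1 : 1 <= K. Proof. by move: hK; lra. Qed.
Let K0 : 0 <= K. Proof. by move: hK; lra. Qed.

Lemma bd_ge0 n X x : bd n X x -> 0 <= X.
Proof.
move=> h; have h0 := le_trans (normr_ge0 x) h.
by rewrite pmulr_rge0 // in h0; rewrite exprn_gt0 // (lt_le_trans _ K1).
Qed.

Lemma bd_le n m X x : (n <= m)%N -> bd n X x -> bd m X x.
Proof.
move=> nm h; apply: (le_trans h); rewrite ler_wpM2r ?(bd_ge0 h) //.
by rewrite ler_weXn2l.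
Qed.

Lemma bdW n X Y x : bd n X x -> X <= Y -> bd n Y x.
Proof. by move=> h XY; apply: (le_trans h); rewrite ler_wpM2l ?exprn_ge0. Qed.

Lemma bdM n m X Y x y : bd n X x -> bd m Y y -> bd (n + m) (X * Y) (x * y).
Proof.
move=> hx hy; rewrite /bd normrM exprD mulrACA ler_pM //.
Qed.

Lemma bdM1 n m Y x y : bd n 1 x -> bd m Y y -> bd (n + m) Y (x * y).
Proof. by move=> hx hy; have := bdM hx hy; rewrite mul1r. Qed.

(** The exponent grows by one because 2 <= K. *)
Lemma bdD n m X x y : bd n X x -> bd m X y -> bd (maxn n m).+1 X (x + y).
Proof.
move=> hx hy; have X0 := bd_ge0 hx.
have h2 := bd_le (leq_maxr n m) hy.
rewrite /bd exprS; apply: (le_trans (ler_normD _ _)).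
have h3 := bd_le (leq_maxl n m) hx.
have A0 : 0 <= K ^+ maxn n m * X by rewrite mulr_ge0 ?exprn_ge0.
rewrite -mulrA; move: h2 h3 A0; rewrite /bd; set A := _ * X => h2 h3 A0.
have : 2 * A <= K * A by rewrite ler_wpM2r //; move: hK; lra.
by lra.
Qed.

Lemma bdN n X x : bd n X x -> bd n X (- x).
Proof. by rewrite /bd normrN. Qed.

Lemma bdK (x : R) : `|x| <= K -> bd 1 1 x.
Proof. by rewrite /bd expr1 mulr1. Qed.

Lemma bd0 (x X : R) : `|x| <= X -> bd 0 X x.
Proof. by rewrite /bd expr0 mul1r. Qed.

Lemma bd_lb n X x : bd n X x -> - (K ^+ n * X) <= x.
Proof. by move=> h; rewrite lerNl; apply: le_trans h; rewrite ler_normr lexx orbT. Qed.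

End Bd.

(** * The pointwise identity for the conjugated operator *)

(** Recursion on the shape of a polynomial. bdc bounds coefficients, for which the
monomial of reference is 1; bdu bounds an expression by the reference monomial of
its last factor. *)
Ltac bdc hK :=
  match goal with
  | |- bd _ _ _ (@GRing.add _ _ _) => apply: (bdD hK); bdc hK
  | |- bd _ _ _ (@GRing.opp _ _) => apply: bdN; bdc hK
  | |- bd _ _ _ (@GRing.mul _ _ _) => apply: bdM1; bdc hK
  | |- _ => eassumption
  end.
Ltac bdu hK :=
  match goal with
  | |- bd _ _ _ (@GRing.add _ _ _) => apply: (bdD hK); bdu hK
  | |- bd _ _ _ (@GRing.opp _ _) => apply: bdN; bdu hK
  | |- _ => first [eassumption | apply: bdM1; [bdc hK | bdu hK]]
  end.

Section Pointwise.
Variable R : realFieldType.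

(** One space derivative of the flux, written as the product rule produces it; px
and w' are the derivatives of Psi and w in that direction, px' and wx' those of px
and w'; in the other names an x marks a derivative in the same direction. *)
Definition flux1_div (nu lam W Wx sg sgx V Vx c cx px p1 p2 g gx p1x p2x
   w wt w1 w2 wx1 wx2 wtx px' w' wx' : R) : R :=
  2 * nu * (sgx * wt * w' + sg * wtx * w' + sg * wt * wx')
  - 4 * nu ^+ 2 * (Wx * w' * (p1 * w1 + p2 * w2) + W * wx' * (p1 * w1 + p2 * w2)
     + W * w' * (p1x * w1 + p1 * wx1 + p2x * w2 + p2 * wx2))
  + 2 * nu ^+ 2 * ((Wx * px + W * px') * (w1 ^+ 2 + w2 ^+ 2)
     + W * px * (2 * (w1 * wx1 + w2 * wx2)))
  - 4 * nu ^+ 2 * lam * ((Wx * g + W * gx) * (w * w') + W * g * (w' ^+ 2 + w * wx'))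
  + 2 * nu * ((Vx * W * px + V * Wx * px + V * W * px') * w ^+ 2
      + V * W * px * (2 * w * w'))
  - nu * lam * ((Wx * c + W * cx) * (w * w') + W * c * (w' ^+ 2 + w * wx')).

Definition energy_dt (nu lam W Wt sg sgt V Vt c ct w wt w1 w2 wt1 wt2 : R) : R :=
  nu * (sgt * (w1 ^+ 2 + w2 ^+ 2) + sg * (2 * (w1 * wt1 + w2 * wt2)))
  + (sgt * V + sg * Vt) * w ^+ 2 + sg * V * (2 * w * wt)
  + 2^-1 * lam * ((sgt * (W * c) + sg * (Wt * c + W * ct)) * w ^+ 2
        + sg * (W * c) * (2 * w * wt)).

Definition flux_div (nu lam W Wt sg sgt sg1 sg2 V Vt V1 V2 c ct c1 c2
   p1 p2 p11 p12 p22 g g1 g2 w wt w1 w2 w11 w12 w22 wt1 wt2 : R) : R :=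
  flux1_div nu lam W (lam * W * p1) sg sg1 V V1 c c1 p1 p1 p2 g g1 p11 p12
   w wt w1 w2 w11 w12 wt1 p11 w1 w11
  + flux1_div nu lam W (lam * W * p2) sg sg2 V V2 c c2 p2 p1 p2 g g2 p12 p22
   w wt w1 w2 w12 w22 wt2 p22 w2 w22
  - energy_dt nu lam W Wt sg sgt V Vt c ct w wt w1 w2 wt1 wt2.

(** The core of the estimate. P1 and P2 are the symmetric and skew parts of the
conjugated operator, so 2 P1 P2 is a divergence plus quadratic terms in w and its
gradient; the multiplier eta w adds the elliptic energy of w on the support of c,
where grad Psi may vanish. The terms of weight lam are the ones that will
dominate. *)
Lemma flux_identity (nu lam W Wt sg sgt sg1 sg2 V Vt V1 V2 c ct c1 c2
   p1 p2 p11 p12 p22 g1 g2 w wt w1 w2 w11 w12 w22 wt1 wt2 P1 P2 Rr : R) :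
  let g := p1 ^+ 2 + p2 ^+ 2 in
  let D := p1 * w1 + p2 * w2 in
  let S := w1 ^+ 2 + w2 ^+ 2 in
  let eta := lam * (W * c) in
  P1 = - nu * (w11 + w22) + V * w ->
  P2 = - sg * wt + 2 * nu * W * D + 2 * nu * lam * W * g * w ->
  (P1 + P2) ^+ 2 + eta * w * (P1 + P2 + Rr * w)
  - flux_div nu lam W Wt sg sgt sg1 sg2 V Vt V1 V2 c ct c1 c2
      p1 p2 p11 p12 p22 g g1 g2 w wt w1 w2 w11 w12 w22 wt1 wt2
  = P1 ^+ 2 + P2 ^+ 2 + nu * sgt * S - 2 * nu * wt * (sg1 * w1 + sg2 * w2)
  + 4 * nu ^+ 2 * lam * W * D ^+ 2
  + 4 * nu ^+ 2 * W * (p11 * w1 ^+ 2 + 2 * p12 * w1 * w2 + p22 * w2 ^+ 2)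
  + 2 * nu ^+ 2 * lam * W * g * S - 2 * nu ^+ 2 * W * (p11 + p22) * S
  + 4 * nu ^+ 2 * lam * w * ((lam * W * p1 * g + W * g1) * w1
                             + (lam * W * p2 * g + W * g2) * w2)
  + (sgt * V + sg * Vt - 2 * nu * (V1 * W * p1 + V2 * W * p2
        + V * (lam * W * g + W * (p11 + p22))) + 4 * nu * lam * W * g * V) * w ^+ 2
  + nu * eta * S + nu * w * lam * ((lam * W * p1 * c + W * c1) * w1
                             + (lam * W * p2 * c + W * c2) * w2)
  + eta * V * w ^+ 2 + 2^-1 * (sgt * eta + sg * lam * (Wt * c + W * ct)) * w ^+ 2
  + 2 * nu * eta * W * D * w + 2 * nu * eta * lam * W * g * w ^+ 2
  + eta * Rr * w ^+ 2.
Proof.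
rewrite /flux_div /flux1_div /energy_dt /= => -> ->.
by field; rewrite ?pnatr_eq0.
Qed.

(** The coefficient of w^2. Among the time derivatives of the weight, beta, which W
does not control, has the nonnegative coefficient 2 nu sg lam W g, while rho and T2
have a negative one, so that upper bounds for them are enough. *)
Lemma potential_identity (nu lam W beta tp rho T2 pt p1 p2 p11 p12 p22 pt1 pt2
    ptt sg sgt sg1 sg2 : R) :
  let g := p1 ^+ 2 + p2 ^+ 2 in
  let g1 := 2 * (p1 * p11 + p2 * p12) in
  let g2 := 2 * (p1 * p12 + p2 * p22) in
  let gt := 2 * (p1 * pt1 + p2 * pt2) in
  let Wt := rho + lam * pt * W in
  let Pt := tp - beta - pt * W in
  let Ptt := T2 - pt * rho - ptt * W - pt * Wt in
  let Pt1 := - (Wt * p1) - W * pt1 in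
  let Pt2 := - (Wt * p2) - W * pt2 in
  let V := - nu * W ^+ 2 * g - sg * Pt in
  let Vt := - (2 * nu * W * Wt * g) - nu * W ^+ 2 * gt - sgt * Pt - sg * Ptt in
  let V1 := - (2 * nu * W * (lam * W * p1) * g) - nu * W ^+ 2 * g1
             - sg1 * Pt - sg * Pt1 in
  let V2 := - (2 * nu * W * (lam * W * p2) * g) - nu * W ^+ 2 * g2
             - sg2 * Pt - sg * Pt2 in
  sgt * V + sg * Vt - 2 * nu * (V1 * W * p1 + V2 * W * p2
        + V * (lam * W * g + W * (p11 + p22))) + 4 * nu * lam * W * g * V
  = 2 * nu ^+ 2 * lam * W ^+ 3 * g ^+ 2 + 2 * nu * sg * lam * W * g * beta
   - 4 * nu * sg * g * (W * rho) - sg ^+ 2 * T2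
   + ((- (2 * nu * sg * g)) * (lam * W * tp) + sgt * V
      + (- (2 * nu * sg * g * pt)) * (lam * W * W)
      + (- (nu * sg * gt)) * (W * W) + (- (sg * sgt)) * Pt
      + (sg * sg * 2 * pt) * rho + (sg * sg * ptt) * W
      + (sg * sg * pt * pt) * (lam * W)
      + (2 * nu * nu * (g1 * p1 + g2 * p2)) * (W * W * W)
      + (2 * nu * (sg1 * p1 + sg2 * p2)) * (W * Pt)
      + (- (2 * nu * sg * (p1 * pt1 + p2 * pt2))) * (W * W)
      + (- (2 * nu * (p11 + p22))) * (W * V)).
Proof. by move=> g g1 g2 gt Wt Pt Ptt Pt1 Pt2 V Vt V1 V2; rewrite /V1 /V2 /Vt /V /Pt1 /Pt2 /Ptt /Pt /Wt /g1 /g2 /gt /g; ring. Qed.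

End Pointwise.

(** * The pointwise Carleman inequality *)

(** Here the target exponent is given, the one found by bdu being smaller. *)
Ltac bdn hK := (eapply bd_le; [exact hK| |bdu hK]); done.

Lemma normM_half (R : realFieldType) (x y : R) :
  `|x * y| <= 2^-1 * (x ^+ 2 + y ^+ 2).
Proof.
have := sqr_ge0 (x - y); have := sqr_ge0 (x + y) => h1 h2.
rewrite ler_norml; apply/andP; split; lra.
Qed.

(** The monomials that occur as errors are bounded by three references: Y for the
factors of w, Z = W Y for the coefficients of w^2, and U for the quadratic
expressions in w and grad w. The condition lam^2 <= W lets two extra factors lam be
paid by one factor W. *)
Section Units.
Variables (R : realFieldType) (K lam W beta : R).
Hypotheses (hK : 4 <= K) (lam1 : 1 <= lam) (lamW : lam ^+ 2 <= W)
  (beta0 : 0 <= beta).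
Let Y := W ^+ 2 + beta.
Let Z := W * Y.

Lemma units_ge :
  [/\ 1 <= W, lam <= W, lam * lam * W <= W ^+ 2, lam * W <= W ^+ 2
   & 0 <= Y /\ Y <= Z].
Proof.
have l0 : 0 <= lam by move: lam1; lra.
have lam2 : lam <= lam ^+ 2 by rewrite expr2 ler_peMl.
have W1 : 1 <= W by move: lam1 lamW; lra.
have lW : lam <= W by move: lamW; lra.
have W0 : 0 <= W by lra.
have Y0 : 0 <= Y by rewrite addr_ge0 ?exprn_ge0.
split => //.
- by rewrite expr2 ler_wpM2r // -expr2.
- by rewrite expr2 ler_wpM2r.
- by split => //; rewrite /Z ler_peMl.
Qed.

Section Gradient.
Variables (w w1 w2 : R).
Let S := w1 ^+ 2 + w2 ^+ 2.
Let U := W * S + W * Y * w ^+ 2.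

Lemma grad_units :
  [/\ bd K 0 U (W * (w1 * w1)) * bd K 0 U (w1 * w1),
   bd K 0 U (W * (w2 * w2)) * bd K 0 U (w2 * w2),
   bd K 0 U (W * (w1 * w2)) * bd K 0 U (w1 * w2),
   bd K 0 U S * bd K 0 U (W * S) &
   (bd K 0 U (lam * W * w * w1) * bd K 0 U (lam * W * w * w2)) *
   (bd K 0 U (lam * lam * W * w * w1) * bd K 0 U (lam * lam * W * w * w2))].
Proof.
have [W1 lW llW lWW [Y0 YZ]] := units_ge.
have W0 : 0 <= W by lra.
have l0 : 0 <= lam by move: lam1; lra.
have S0 : 0 <= S by rewrite addr_ge0 ?sqr_ge0.
have WSU : W * S <= U by rewrite lerDl; apply: mulr_ge0; [apply: mulr_ge0 | apply: sqr_ge0].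
have sU x : `|x| <= S -> bd K 0 U (W * x) * bd K 0 U x.
  move=> hx; have h : W * `|x| <= U by apply: le_trans WSU; rewrite ler_wpM2l.
  split; apply: bd0; first by rewrite normrM (ger0_norm W0).
  by apply: le_trans h; rewrite ler_peMl.
have mU m x : x ^+ 2 <= S -> 0 <= m -> m <= W ^+ 2 -> bd K 0 U (m * w * x).
  move=> xS m0 mW; apply: bd0.
  rewrite -mulrA normrM (ger0_norm m0).
  have h1 : m * `|w * x| <= W ^+ 2 * `|w * x| by apply: ler_wpM2r.
  apply: (le_trans h1).
  have h2 := normM_half (W * w) x.
  rewrite -mulrA normrM (ger0_norm W0) in h2.
  have h3 : W * (W * `|w * x|) <= W * (2^-1 * ((W * w) ^+ 2 + x ^+ 2)).
    by apply: ler_wpM2l.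
  have h4 : W * (x ^+ 2) <= W * S by apply: ler_wpM2l.
  have h5 : 0 <= W * beta * w ^+ 2.
    by apply: mulr_ge0; [apply: mulr_ge0 | apply: sqr_ge0].
  have h6 : 0 <= W * S by rewrite mulr_ge0.
  have h7 : 0 <= W * (W * w) ^+ 2 by apply: mulr_ge0 => //; apply: sqr_ge0.
  rewrite [W ^+ 2 * _](_ : _ = W * (W * `|w * x|)); last by ring.
  apply: (le_trans h3).
  have -> : U = W * S + W * (W * w) ^+ 2 + W * beta * w ^+ 2.
    by rewrite /U /Y; ring.
  have -> : W * (2^-1 * ((W * w) ^+ 2 + x ^+ 2))
      = 2^-1 * (W * (W * w) ^+ 2) + 2^-1 * (W * x ^+ 2) by ring.
  clear h1 h2 h3; move: h4 h5 h6 h7; move: (W * S) (W * x ^+ 2) (W * _ ^+ 2) (W * beta * _).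
  by move=> *; lra.
have w1S : w1 ^+ 2 <= S by rewrite lerDl sqr_ge0.
have w2S : w2 ^+ 2 <= S by rewrite lerDr sqr_ge0.
split.
- by apply: sU; rewrite ger0_norm -expr2 ?sqr_ge0.
- by apply: sU; rewrite ger0_norm -expr2 ?sqr_ge0.
- apply: sU; apply: le_trans (normM_half _ _) _; rewrite -/S; lra.
- by have [|? ?] := sU S; rewrite ?ger0_norm.
- by split; split; apply: mU => //; rewrite ?mulr_ge0.
Qed.

End Gradient.

Lemma zero_unitsM n x : bd K n Y x ->
  bd K n Z x * bd K n Z (W * x) * bd K n Z (lam * x).
Proof.
move=> h.
have [W1 lW llW lWW [Y0 YZ]] := units_ge.
have W0 : 0 <= W by lra.
have l0 : 0 <= lam by move: lam1; lra.
have K0 : 0 <= K by move: hK; lra.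
split; first split; first by apply: bdW YZ.
  by rewrite /bd normrM (ger0_norm W0) mulrCA ler_wpM2l.
rewrite /bd normrM (ger0_norm l0) mulrCA ler_pM //.
Qed.

Lemma zero_units :
  [/\ bd K 0 Y W * bd K 0 Y (W * W) * bd K 0 Y beta,
    bd K 0 Z W * bd K 0 Z (W * W) * bd K 0 Z (W * W * W),
    bd K 0 Z (lam * W) * bd K 0 Z (lam * W * W) &
    bd K 0 Z (lam * lam * W) * bd K 0 Z (lam * lam * W * W)].
Proof.
have [W1 lW llW lWW [Y0 YZ]] := units_ge.
have W0 : 0 <= W by lra.
have l0 : 0 <= lam by move: lam1; lra.
have W2Y : W ^+ 2 <= Y by rewrite lerDl.
have aY x : 0 <= x -> x <= W ^+ 2 -> bd K 0 Y x.
  by move=> x0 xW; apply: bd0; rewrite ger0_norm //; apply: le_trans W2Y.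
have aW : bd K 0 Y W by apply: aY => //; rewrite expr2 ler_peMl.
have aWW : bd K 0 Y (W * W) by apply: aY => //; rewrite mulr_ge0.
have alW : bd K 0 Y (lam * W) by apply: aY => //; rewrite mulr_ge0.
have allW : bd K 0 Y (lam * lam * W) by apply: aY => //; rewrite !mulr_ge0.
split.
- split; first by [].
  by apply: bd0; rewrite ger0_norm // lerDr sqr_ge0.
- split; last by rewrite -mulrA; apply: (zero_unitsM aWW).1.2.
  by split; [apply: (zero_unitsM aW).1.1 | apply: (zero_unitsM aW).1.2].
- by split; [apply: (zero_unitsM alW).1.1
            |rewrite [_ * W]mulrC; apply: (zero_unitsM alW).1.2].
- by split; [apply: (zero_unitsM allW).1.1
            |rewrite [_ * W]mulrC; apply: (zero_unitsM allW).1.2].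
Qed.

Lemma zero_units_time (tp rho : R) : 0 <= tp -> lam * tp <= K * W ^+ 2 ->
  - beta <= rho -> rho <= K * W ^+ 2 ->
  [/\ bd K 1 Y tp, bd K 1 Y rho, bd K 1 Z (lam * rho)
   & bd K 1 Z (lam * W * tp)].
Proof.
move=> tp0 lamtp rhoL rhoU.
have [W1 lW llW lWW [Y0 YZ]] := units_ge.
have W0 : 0 <= W by lra.
have l0 : 0 <= lam by move: lam1; lra.
have K1 : 1 <= K by move: hK; lra.
have K0 : 0 <= K by lra.
have W2Y : W ^+ 2 <= Y by rewrite lerDl.
have bY : beta <= Y by rewrite lerDr sqr_ge0.
have KWY : K * W ^+ 2 <= K * Y by rewrite ler_wpM2l.
have bKY : beta <= K * Y by apply: (le_trans bY); rewrite ler_peMl.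
have rhoY : bd K 1 Y rho.
  by rewrite /bd expr1 ler_norml; apply/andP; split; lra.
split => //.
- rewrite /bd expr1 ger0_norm //; apply: le_trans KWY; apply: le_trans lamtp.
  by rewrite ler_peMl.
- exact: (zero_unitsM rhoY).2.
- have -> : lam * W * tp = W * (lam * tp) by ring.
  rewrite /bd expr1 ger0_norm ?mulr_ge0 // /Z [K * _]mulrCA ler_wpM2l //.
  exact: le_trans KWY.
Qed.

End Units.

(** Either |grad Psi|^2 or the cut-off is bounded below, and each of the three
dominant coefficients sees at least one of them. The exponent 5 leaves room for the
negative term - 3 nu g c, since g <= 2 K^2. *)
Lemma carleman_coefs (R : realFieldType) (K k nu sg g c : R) :
  4 <= K -> 0 < k -> k <= 2^-1 -> k <= nu -> nu <= K -> k <= sg -> 0 <= c ->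
  0 <= g -> g <= 2 * K ^+ 2 -> k <= g \/ 1 <= c ->
  [/\ k ^+ 4 <= 2 * nu ^+ 2 * g + 2^-1 * nu * c,
      k ^+ 4 <= 2 * nu ^+ 2 * g ^+ 2 + (K ^+ 5 - 3 * nu * g) * c &
      k ^+ 4 <= 2 * nu * sg * g + c * sg].
Proof.
move=> hK k0 k2 knu nuK ksg c0 g0 gK gc.
have k1 : k <= 1 by lra.
have k4k3 : k ^+ 4 <= k ^+ 3 by rewrite exprS ler_piMl ?exprn_ge0 // ltW.
have k3k2 : k ^+ 3 <= k ^+ 2 by rewrite exprS ler_piMl ?exprn_ge0 // ltW.
have k2k : k ^+ 2 <= 2^-1 * k by rewrite expr2 ler_wpM2r // ltW.
have nu0 : 0 <= nu by lra.
have sg0 : 0 <= sg by lra.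
have nuk2 : k ^+ 2 <= nu ^+ 2 by rewrite lerXn2r ?nnegrE // ltW.
have nsk : k ^+ 2 <= nu * sg by rewrite expr2 ler_pM // ltW.
have KK : 1 <= K ^+ 5 - 3 * nu * g.
  have h1 : 3 * nu * g <= 3 * K * (2 * K ^+ 2).
    by apply: ler_pM => //; [lra | apply: ler_pM => //; lra].
  have K0 : 0 <= K by lra.
  have h2 : 16 * K ^+ 3 <= K ^+ 5.
    have : 4 * 4 <= K * K by apply: ler_pM.
    have -> : K ^+ 5 = K * K * K ^+ 3 by ring.
    by move=> h; apply: ler_wpM2r; [exact: exprn_ge0 | lra].
  have h3 : 1 <= K ^+ 3 by rewrite exprn_ege1 //; lra.
  have h4 : 3 * K * (2 * K ^+ 2) = 6 * K ^+ 3 by ring.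
  by lra.
have n2g : 0 <= nu ^+ 2 * g by rewrite mulr_ge0 ?sqr_ge0.
have n2g2 : 0 <= nu ^+ 2 * g ^+ 2 by rewrite mulr_ge0 ?sqr_ge0.
have nsg : 0 <= nu * sg * g by rewrite !mulr_ge0.
have nc : 0 <= nu * c by rewrite mulr_ge0.
have csg : 0 <= c * sg by rewrite mulr_ge0.
have Kc : c <= (K ^+ 5 - 3 * nu * g) * c by apply: ler_peMl.
case: gc => [kg|c1].
- have h1 : k ^+ 3 <= nu ^+ 2 * g by rewrite exprSr ler_pM ?exprn_ge0 // ltW.
  have h2 : k ^+ 4 <= nu ^+ 2 * g ^+ 2.
    have -> : k ^+ 4 = k ^+ 2 * k ^+ 2 by ring.
    by rewrite ler_pM ?sqr_ge0 // lerXn2r ?nnegrE // ltW.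
  have h3 : k ^+ 3 <= nu * sg * g by rewrite exprSr ler_pM ?exprn_ge0 // ltW.
  by split; lra.
- have h1 : k <= nu * c by rewrite -[k]mulr1 ler_pM // ltW.
  have h2 : k <= c * sg by rewrite -[k]mul1r ler_pM // ltW.
  by split; lra.
Qed.

(** After completing squares, the dominant terms are lam times the coefficients of
carleman_coefs, while every other term is a monomial without the factor lam to
spare: it is bounded by a fixed power of K. The term - 2 nu wt (grad sg . grad w) is
absorbed in the square of P2, which contains - sg wt. *)
Lemma carleman_pointwise (R : realFieldType) (K k : R) : 4 <= K -> 0 < k ->
  k <= 2^-1 -> k^-1 <= K -> exists N : nat,
  forall nu lam W beta tp rho T2 pt p1 p2 p11 p12 p22 pt1 pt2 ptt
    sg sgt sg1 sg2 c ct c1 c2 w wt w1 w2 w11 w12 w22 wt1 wt2 : R,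
  let g := p1 ^+ 2 + p2 ^+ 2 in
  let g1 := 2 * (p1 * p11 + p2 * p12) in
  let g2 := 2 * (p1 * p12 + p2 * p22) in
  let gt := 2 * (p1 * pt1 + p2 * pt2) in
  let Wt := rho + lam * pt * W in
  let Pt := tp - beta - pt * W in
  let Ptt := T2 - pt * rho - ptt * W - pt * Wt in
  let Pt1 := - (Wt * p1) - W * pt1 in
  let Pt2 := - (Wt * p2) - W * pt2 in
  let V : R := - nu * W ^+ 2 * g - sg * Pt in
  let Vt := - (2 * nu * W * Wt * g) - nu * W ^+ 2 * gt - sgt * Pt - sg * Ptt in
  let V1 := - (2 * nu * W * (lam * W * p1) * g) - nu * W ^+ 2 * g1
             - sg1 * Pt - sg * Pt1 in
  let V2 := - (2 * nu * W * (lam * W * p2) * g) - nu * W ^+ 2 * g2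
             - sg2 * Pt - sg * Pt2 in
  let q : R := - nu * (w11 + w22) + V * w
     + (- sg * wt + 2 * nu * W * (p1 * w1 + p2 * w2) + 2 * nu * lam * W * g * w)
     + (- nu * lam * W * g + nu * W * (p11 + p22)) * w in
  1 <= lam -> lam ^+ 2 <= W -> 0 <= beta -> 0 <= tp -> lam * tp <= K * W ^+ 2 ->
  - beta <= rho -> rho <= K * W ^+ 2 -> T2 <= K * W ^+ 3 ->
  `|nu| <= K -> `|pt| <= K -> `|p1| <= K -> `|p2| <= K -> `|p11| <= K ->
  `|p12| <= K -> `|p22| <= K -> `|pt1| <= K -> `|pt2| <= K -> `|ptt| <= K ->
  `|sg| <= K -> `|sgt| <= K -> `|sg1| <= K -> `|sg2| <= K ->
  `|c| <= K -> `|ct| <= K -> `|c1| <= K -> `|c2| <= K ->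
  k <= nu -> k <= sg -> 0 <= c -> (k <= g \/ 1 <= c) ->
  (lam * k ^+ 4 - K ^+ N) *
    (W * (w1 ^+ 2 + w2 ^+ 2) + W * (W ^+ 2 + beta) * w ^+ 2)
  <= 3 * q ^+ 2 + K ^+ 5 * lam * W ^+ 3 * c * w ^+ 2
   - flux_div nu lam W Wt sg sgt sg1 sg2 V Vt V1 V2 c ct c1 c2
      p1 p2 p11 p12 p22 g g1 g2 w wt w1 w2 w11 w12 w22 wt1 wt2.
Proof.
(* the errors are bounded with the exponent 50; the rest pays for adding two of them *)
move=> hK k0 k1 kK; exists 60%N => nu lam W beta tp rho T2 pt p1 p2 p11 p12 p22
  pt1 pt2 ptt sg sgt sg1 sg2 c ct c1 c2 w wt w1 w2 w11 w12 w22 wt1 wt2.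
move=> g g1 g2 gt Wt Pt Ptt Pt1 Pt2 V Vt V1 V2 q.
move=> lam1 lamW beta0 tp0 lamtp rhoL rhoU T2U.
do 18 (move=> /bdK; let h := fresh "b" in move=> h).
move=> nuk sgk c0 gc.

have [W1 lW llW lWW [Y0 YZ]] := units_ge lam1 lamW beta0.
have [[u11 v11] [u22 v22] [u12 v12] [uS uWS] [[x1 x2] [xx1 xx2]]] :=
  grad_units K lam1 lamW beta0 w w1 w2.
have [[[aW aWW] abeta] [[zW zWW] zWWW] [zlW zlWW] [zllW zllWW]] :=
  zero_units hK lam1 lamW beta0.
have [atp arho zlrho zlWtp] := zero_units_time hK lam1 lamW beta0 tp0 lamtp rhoL rhoU.
pose Y := W ^+ 2 + beta.
pose Z := W * Y.
pose S := w1 ^+ 2 + w2 ^+ 2.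
pose U := W * S + W * Y * w ^+ 2.
rewrite -?/Y -?/Z -?/S -?/U in u11 v11 u22 v22 u12 v12 uS uWS x1 x2 xx1 xx2 aW aWW abeta zW zWW zWWW zlW zlWW zllW zllWW atp arho zlrho zlWtp *.
have sg0 : sg != 0 by rewrite gt_eqF // (lt_le_trans k0).
have bis : bd K 1 1 sg^-1.
  apply: bdK; rewrite ger0_norm ?invr_ge0; last by apply: le_trans sgk; exact: ltW.
  by apply: le_trans kK; rewrite lef_pV2 ?posrE // (lt_le_trans k0).
have i1 : bd K 0 1 1 by apply: bd0; rewrite normr1.
have inat n : (n <= 4)%N -> bd K 1 1 n%:R.
  move=> n4; apply: bdK; rewrite ger0_norm ?ler0n //.
  by apply: le_trans hK; rewrite ler_nat.
have i2 : bd K 1 1 2 := inat 2%N isT.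
have i3 : bd K 1 1 3 := inat 3%N isT.
have i4 : bd K 1 1 4 := inat 4%N isT.
have ih : bd K 0 1 (2^-1) by apply: bd0; rewrite ger0_norm ?invr_ge0 ?invf_le1 // ler1n.
have iK : bd K 1 1 K.
  by apply: bdK; rewrite ger0_norm //; apply: le_trans hK.
have aPt : bd K 5 Y Pt by rewrite /Pt; bdn hK.
have [[zPt zWPt] _] := zero_unitsM hK lam1 lamW beta0 aPt.
have bg : bd K 4 1 g by rewrite /g !expr2; bdn hK.
have bg1 : bd K 4 1 g1 by rewrite /g1; bdn hK.
have bg2 : bd K 4 1 g2 by rewrite /g2; bdn hK.
have bgt : bd K 4 1 gt by rewrite /gt; bdn hK.
have aV : bd K 9 Y V.
  rewrite /V; have -> : - nu * W ^+ 2 * g = (- nu * g) * (W * W) by ring.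
  by bdn hK.
have [[zV zWV] _] := zero_unitsM hK lam1 lamW beta0 aV.
have zrho := (zero_unitsM hK lam1 lamW beta0 arho).1.1.
clear aPt aV.
(* a1, a2 turn nu grad sg into sg times a bounded vector, so that the product of wt
   with grad sg . grad w completes P2^2 to the square of P2 + a1 w1 + a2 w2 *)
pose a1 := nu * sg^-1 * sg1; pose a2 := nu * sg^-1 * sg2.
have ba1 : bd K 3 1 a1 by rewrite /a1; bdn hK.
have ba2 : bd K 3 1 a2 by rewrite /a2; bdn hK.
pose EG := nu * sgt * S
  + - (a1 * a1 * (w1 * w1) + (2 * a1 * a2) * (w1 * w2) + a2 * a2 * (w2 * w2))
  + (- (4 * nu)) * (p1 * a1 * (W * (w1 * w1)) + (p1 * a2 + p2 * a1) * (W * (w1 * w2))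
       + p2 * a2 * (W * (w2 * w2)))
  + (- (4 * nu * g)) * (a1 * (lam * W * w * w1) + a2 * (lam * W * w * w2))
  + (4 * nu * nu) * (p11 * (W * (w1 * w1)) + (2 * p12) * (W * (w1 * w2))
       + p22 * (W * (w2 * w2)))
  + (- (2 * nu * nu * (p11 + p22))) * (W * S)
  + (4 * nu * nu) * (p1 * g * (lam * lam * W * w * w1) + g1 * (lam * W * w * w1)
       + p2 * g * (lam * lam * W * w * w2) + g2 * (lam * W * w * w2))
  + nu * (p1 * c * (lam * lam * W * w * w1) + c1 * (lam * W * w * w1)
       + p2 * c * (lam * lam * W * w * w2) + c2 * (lam * W * w * w2)).
have bEG : bd K 50 U EG by rewrite /EG; bdn hK.
(* EZ comes from the potential, EL from the multiplier lam W c w, ER from the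
   remainder Rr; EO is what is left once rho and T2 are replaced by upper bounds *)
pose EZ : R := (- (2 * nu * sg * g)) * (lam * W * tp) + sgt * V
      + (- (2 * nu * sg * g * pt)) * (lam * W * W)
      + (- (nu * sg * gt)) * (W * W) + (- (sg * sgt)) * Pt
      + (sg * sg * 2 * pt) * rho + (sg * sg * ptt) * W
      + (sg * sg * pt * pt) * (lam * W)
      + (2 * nu * nu * (g1 * p1 + g2 * p2)) * (W * W * W)
      + (2 * nu * (sg1 * p1 + sg2 * p2)) * (W * Pt)
      + (- (2 * nu * sg * (p1 * pt1 + p2 * pt2))) * (W * W)
      + (- (2 * nu * (p11 + p22))) * (W * V).
pose EL : R := (- (c * sg)) * (lam * W * tp) + (c * sg * pt) * (lam * W * W)
  + (2^-1 * sgt * c) * (lam * W) + (2^-1 * sg * c) * (lam * rho)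
  + (2^-1 * sg * pt * c) * (lam * lam * W) + (2^-1 * sg * ct) * (lam * W)
  + (2 * nu * c * g) * (lam * lam * W * W) + (- (c * nu * g)) * (lam * lam * W * W)
  + (c * nu * (p11 + p22)) * (lam * W * W).
pose ER : R := (- 2) * ((nu * g) * (nu * g) * (lam * lam * W * W)
   + (- (2 * nu * nu * g * (p11 + p22))) * (lam * W * W)
   + (nu * (p11 + p22)) * (nu * (p11 + p22)) * (W * W))
  + (- (c * c)) * (lam * lam * W * W).
pose EO : R := (- (4 * nu * sg * g * K + sg * sg * K)) * (W * W * W).
have bE0 : bd K 50 Z (EZ + EL + ER + EO).
  by rewrite /EZ /EL /ER /EO; bdn hK.
pose P1 : R := - nu * (w11 + w22) + V * w.
pose P2 : R := - sg * wt + 2 * nu * W * (p1 * w1 + p2 * w2) + 2 * nu * lam * W * g * w.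
pose Rr : R := - nu * lam * W * g + nu * W * (p11 + p22).
have qE : q = P1 + P2 + Rr * w by [].
have := @flux_identity _ nu lam W Wt sg sgt sg1 sg2 V Vt V1 V2 c ct c1 c2
  p1 p2 p11 p12 p22 g1 g2 w wt w1 w2 w11 w12 w22 wt1 wt2 P1 P2 Rr erefl erefl.
rewrite -/g -qE.
rewrite (@potential_identity _ nu lam W beta tp rho T2 pt p1 p2 p11 p12 p22 pt1 pt2
    ptt sg sgt sg1 sg2) -/g -/g1 -/g2 -/gt -/Pt -/V -/EZ.
set T := flux_div _ _ _ _ _ _ _ _ _ _ _ _ _ _ _ _ _ _ _ _ _ _ _ _ _ _ _ _ _ _ _ _ _.
move=> I.
have e1 : nu * sg1 = sg * a1 by rewrite /a1 -mulrA mulrCA mulVKf.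
have e2 : nu * sg2 = sg * a2 by rewrite /a2 -mulrA mulrCA mulVKf.
clearbody a1 a2.
have ge : g = p1 ^+ 2 + p2 ^+ 2 by [].
have key : 3 * q ^+ 2 + K ^+ 5 * lam * W ^+ 3 * c * w ^+ 2 - T
  = ((q + Rr * w) ^+ 2 + (q ^+ 2 - (lam * (W * c) * w) * q + (lam * (W * c) * w) ^+ 2))
   + P1 ^+ 2 + (P2 + (a1 * w1 + a2 * w2)) ^+ 2
   + 4 * nu ^+ 2 * (lam * W) * (p1 * w1 + p2 * w2) ^+ 2
   + nu * (lam * W * c) * (2^-1 * ((w1 + 2 * W * p1 * w) ^+ 2 + (w2 + 2 * W * p2 * w) ^+ 2))
   + lam * (W * S) * (2 * nu ^+ 2 * g + 2^-1 * nu * c)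
   + lam * (W ^+ 3 * w ^+ 2) * (2 * nu ^+ 2 * g ^+ 2 + (K ^+ 5 - 3 * nu * g) * c)
   + lam * (W * beta * w ^+ 2) * (2 * nu * sg * g + c * sg)
   + EG + (EZ + EL + ER + EO) * w ^+ 2
   + 4 * (nu * sg * g) * (W * (K * W ^+ 2 - rho)) * w ^+ 2
   + sg ^+ 2 * (K * W ^+ 3 - T2) * w ^+ 2.
  have -> : 3 * q ^+ 2 + K ^+ 5 * lam * W ^+ 3 * c * w ^+ 2 - T
   = 3 * q ^+ 2 + K ^+ 5 * lam * W ^+ 3 * c * w ^+ 2 - (P1 + P2) ^+ 2
     - lam * (W * c) * w * q
     + ((P1 + P2) ^+ 2 + lam * (W * c) * w * q - T) by ring.
  rewrite I; have -> : P1 + P2 = q - Rr * w by rewrite qE addrK.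
  have -> : 2 * nu * wt * (sg1 * w1 + sg2 * w2)
          = 2 * wt * (sg * (a1 * w1 + a2 * w2)).
    have -> : sg * (a1 * w1 + a2 * w2) = nu * (sg1 * w1 + sg2 * w2).
      by rewrite mulrDr !mulrA -e1 -e2; ring.
    by ring.
  rewrite /EG /EL /ER /EO /S; clearbody EZ g1 g2 q T.
  rewrite /Rr /P2 /V /Pt /Wt ge.
  by field.
have K0 : 0 <= K by apply: le_trans hK.
have g0 : 0 <= g by rewrite addr_ge0 ?sqr_ge0.
have le_sqK x : bd K 1 1 x -> x ^+ 2 <= K ^+ 2.
  by rewrite /bd mulr1 expr1 => xK; rewrite -[x ^+ 2]real_normK ?num_real // lerXn2r ?nnegrE.
have gK : g <= 2 * K ^+ 2 by rewrite ge; rewrite mulr_natl mulr2n lerD // le_sqK.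
have nuK : nu <= K by apply: le_trans (ler_norm _) _; move: b; rewrite /bd mulr1 expr1.
have [C1 C2 C3] := carleman_coefs hK k0 k1 nuk nuK sgk c0 g0 gK gc.
rewrite key.
have S0 : 0 <= S by rewrite addr_ge0 ?sqr_ge0.
have l0 : 0 <= lam by apply: le_trans lam1.
have W0 : 0 <= W by apply: le_trans W1.
have w0 : 0 <= w ^+ 2 by rewrite sqr_ge0.
have h0 : 0 <= (q + Rr * w) ^+ 2
   + (q ^+ 2 - (lam * (W * c) * w) * q + (lam * (W * c) * w) ^+ 2).
  rewrite addr_ge0 ?sqr_ge0 //.
  set e := lam * (W * c) * w.
  have -> : q ^+ 2 - e * q + e ^+ 2 = (q - 2^-1 * e) ^+ 2 + (3 / 4) * e ^+ 2 by field.
  by apply: addr_ge0; [exact: sqr_ge0 | apply: mulr_ge0; [by rewrite divr_ge0 | exact: sqr_ge0]].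
have h1 := sqr_ge0 P1.
have h2 := sqr_ge0 (P2 + (a1 * w1 + a2 * w2)).
have h3 : 0 <= 4 * nu ^+ 2 * (lam * W) * (p1 * w1 + p2 * w2) ^+ 2.
  apply: mulr_ge0; last exact: sqr_ge0.
  by apply: mulr_ge0; apply: mulr_ge0 => //; exact: sqr_ge0.
have h4 : 0 <= nu * (lam * W * c) *
   (2^-1 * ((w1 + 2 * W * p1 * w) ^+ 2 + (w2 + 2 * W * p2 * w) ^+ 2)).
  have nu0 : 0 <= nu by apply: le_trans nuk; exact: ltW.
  apply: mulr_ge0; first by rewrite !mulr_ge0.
  by rewrite mulr_ge0 ?invr_ge0 // addr_ge0 ?sqr_ge0.
have h5 : lam * (W * S) * k ^+ 4
          <= lam * (W * S) * (2 * nu ^+ 2 * g + 2^-1 * nu * c).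
  by apply: ler_wpM2l => //; rewrite !mulr_ge0.
have h6 : lam * (W ^+ 3 * w ^+ 2) * k ^+ 4
  <= lam * (W ^+ 3 * w ^+ 2) * (2 * nu ^+ 2 * g ^+ 2 + (K ^+ 5 - 3 * nu * g) * c).
  by apply: ler_wpM2l => //; apply: mulr_ge0 => //; apply: mulr_ge0 => //; apply: exprn_ge0.
have h7 : lam * (W * beta * w ^+ 2) * k ^+ 4
  <= lam * (W * beta * w ^+ 2) * (2 * nu * sg * g + c * sg).
  by apply: ler_wpM2l => //; apply: mulr_ge0 => //; apply: mulr_ge0 => //; apply: mulr_ge0.
have h8 := bd_lb bEG.
have h9 : - (K ^+ 50 * (Z * w ^+ 2)) <= (EZ + EL + ER + EO) * w ^+ 2.
  by rewrite mulrA -mulNr; apply: ler_wpM2r => //; apply: bd_lb.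
have h10 : 0 <= 4 * (nu * sg * g) * (W * (K * W ^+ 2 - rho)) * w ^+ 2.
  have nsg : 0 <= nu * sg * g by rewrite !mulr_ge0 //; apply: le_trans (ltW k0) _.
  apply: mulr_ge0 => //; apply: mulr_ge0; first by rewrite mulr_ge0.
  by rewrite mulr_ge0 // subr_ge0.
have h11 : 0 <= sg ^+ 2 * (K * W ^+ 3 - T2) * w ^+ 2.
  by apply: mulr_ge0 => //; rewrite mulr_ge0 ?sqr_ge0 // subr_ge0.
have h12 : Z * w ^+ 2 <= U by rewrite /U lerDr; apply: mulr_ge0.
have U0 : 0 <= U.
  by apply: addr_ge0; [apply: mulr_ge0 | apply: mulr_ge0 => //; apply: mulr_ge0].
have h13 : 2 * K ^+ 50 * U <= K ^+ 60 * U.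
  apply: ler_wpM2r => //; have -> : 60%N = (1 + 59)%N by [].
  rewrite exprD expr1; apply: ler_pM; rewrite ?exprn_ge0 //; first by apply: le_trans hK; rewrite ler_nat.
  by rewrite ler_weXn2l //; apply: le_trans hK; rewrite ler1n.
have h14 : K ^+ 50 * (Z * w ^+ 2) <= K ^+ 50 * U.
  by apply: ler_wpM2l => //; apply: exprn_ge0.
have UE : lam * U * k ^+ 4 = lam * (W * S) * k ^+ 4
   + lam * (W ^+ 3 * w ^+ 2) * k ^+ 4 + lam * (W * beta * w ^+ 2) * k ^+ 4.
  by rewrite /U /Y; ring.
have -> : (lam * k ^+ 4 - K ^+ 60) * U = lam * (W * S) * k ^+ 4
   + lam * (W ^+ 3 * w ^+ 2) * k ^+ 4 + lam * (W * beta * w ^+ 2) * k ^+ 4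
   - K ^+ 60 * U by rewrite -UE; ring.
have h13' : K ^+ 50 * U + K ^+ 50 * U <= K ^+ 60 * U by rewrite -mulr2n -mulr_natl mulrA.
move: h0 h1 h2 h3 h4 h5 h6 h7 h8 h9 h10 h11 h13' h14; clear.
move: (K ^+ 60 * U) (K ^+ 50 * U) (K ^+ 50 * (Z * w ^+ 2)) => B1 B2 B3.
set A0 := (_ + (_ - _ + _)); set A1 := P1 ^+ 2; set A2 := (P2 + _) ^+ 2.
set A3 := 4 * nu ^+ 2 * _ * _; set A4 := nu * (lam * W * c) * _.
set A5 := lam * (W * S) * k ^+ 4; set A5' := lam * (W * S) * _.
set A6 := lam * (W ^+ 3 * w ^+ 2) * k ^+ 4; set A6' := lam * (W ^+ 3 * w ^+ 2) * _.
set A7 := lam * (W * beta * w ^+ 2) * k ^+ 4; set A7' := lam * (W * beta * w ^+ 2) * _.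
set A8 := (EZ + EL + ER + EO) * w ^+ 2; set A9 := 4 * (nu * sg * g) * _ * _.
set A10 := sg ^+ 2 * _ * _.
move: A0 A1 A2 A3 A4 A5 A5' A6 A6' A7 A7' A8 A9 A10 EG.
by clear => *; lra.
Qed.

(** * Directional derivatives along lines *)

Section Directional.
Context {R : realType} {V : normedModType R}.
Implicit Types (f : V -> R) (p v : V).

(** Everything on directional derivatives is reduced to functions of one real
variable by restriction to a line. *)
Lemma is_derive_line f p v (x d : R) :
  is_derive (p + x *: v) v f d <-> is_derive x 1 (fun h => f (p + h *: v)) d.
Proof.
have E : (fun h => h^-1 *: ((f \o shift (p + x *: v)) (h *: v) - f (p + x *: v)))
  = (fun h => h^-1 *: (((fun h => f (p + h *: v)) \o shift x) (h *: 1)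
              - f (p + x *: v))).
  apply/funext => h /=; congr (_ *: (f _ - _)).
  by rewrite /shift /= [h *: 1]mulr1 scalerDl addrCA.
split=> -[h1 h2]; split.
- by move: h1; rewrite /derivable E.
- by move: h2; rewrite /derive E.
- by rewrite /derivable E.
- by rewrite /derive E.
Qed.

Lemma is_derive_line0 f p v (d : R) :
  is_derive p v f d <-> is_derive (0 : R) 1 (fun h => f (p + h *: v)) d.
Proof. by rewrite -is_derive_line scale0r addr0. Qed.

Lemma is_derive_comp_r f (g : R -> R) p v (a b : R) :
  is_derive p v f a -> is_derive (f p) 1 g b -> is_derive p v (g \o f) (b * a).
Proof.
move=> /is_derive_line0 hf hg; apply/is_derive_line0.
have -> : (fun h : R => (g \o f) (p + h *: v)) = g \o (fun h => f (p + h *: v)) by [].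
apply: is_derive1_comp.
by rewrite scale0r addr0.
Qed.

Lemma MVT_line f (df : V -> R) p v (h : R) : 0 < h ->
  (forall x, 0 < x < h -> is_derive (p + x *: v) v f (df (p + x *: v))) ->
  {within `[0, h], continuous (fun x : R => f (p + x *: v))} ->
  exists2 x, 0 < x < h & f (p + h *: v) - f p = h * df (p + x *: v).
Proof.
move=> h0 hd hc.
have [|c] := @MVT R (fun x => f (p + x *: v)) (fun x => df (p + x *: v)) 0 h h0 _ hc.
  by move=> x; rewrite in_itv /= => /hd /is_derive_line.
rewrite in_itv /= => ch; rewrite scale0r addr0 subr0 mulrC => e.
by exists c.
Qed.

Lemma MVT_line_closed f (df : V -> R) p v (h : R) : 0 < h ->
  (forall x, 0 <= x <= h -> is_derive (p + x *: v) v f (df (p + x *: v))) ->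
  exists2 x, 0 < x < h & f (p + h *: v) - f p = h * df (p + x *: v).
Proof.
move=> h0 hd; apply: MVT_line => //.
- by move=> x /andP[x0 xh]; apply: hd; rewrite !ltW.
- apply: derivable_within_continuous => x; rewrite in_itv /= => /hd.
  by move=> /is_derive_line [].
Qed.

Lemma is_derive_scale f p v (a d : R) :
  is_derive p v f d -> is_derive p (a *: v) f (a * d).
Proof.
move=> /is_derive_line0 hd; apply/is_derive_line0.
have -> : (fun h => f (p + h *: (a *: v))) = (fun h => f (p + h *: v)) \o ( *%R a).
  by apply/funext => h /=; rewrite scalerA mulrC.
rewrite mulrC; apply: is_derive1_comp.
  by rewrite mulr0.
by apply: is_derive_eq; rewrite -[RHS]mulr1.
Qed.
End Directional.

(** * Continuity on a set and mixed derivatives *)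

Section Epsilon.
Context {R : realType} {V : normedModType R}.
Implicit Types (A : set V) (f g : V -> R) (p v w : V).

Lemma addrAC2 (a b c : V) : a + b + c - a = b + c.
Proof. by rewrite -[_ + c]addrA [a + _]addrC addrK. Qed.

(** Unlike continuity for the subspace topology, this form mentions no subspace type
and is stable under the pointwise operations by the usual limit rules. *)
Definition cts A f := forall p, A p -> f @ within A (nbhs p) --> f p.

Lemma ctsE A f : cts A f <-> {within A, continuous f}.
Proof. by split => /subspace_continuousP. Qed.

Lemma cts_eps A f p : f @ within A (nbhs p) --> f p <->
  forall e, 0 < e -> exists2 d, 0 < d &
    forall q, A q -> `|q - p| < d -> `|f q - f p| < e.
Proof.
split.
- move=> /cvgrPdist_lt h e e0; have := h e e0.
  rewrite near_withinE => /nbhs_ballP[d /= d0 hd]; exists d => // q Aq qp.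
  by rewrite distrC; apply: hd => //; rewrite -ball_normE /= distrC.
- move=> h; apply/cvgrPdist_lt => e /h[d d0 hd].
  rewrite near_withinE; apply/nbhs_ballP; exists d => //= q.
  rewrite -ball_normE /= => pq Aq; rewrite distrC; apply: hd => //.
  by rewrite distrC.
Qed.

Lemma is_derive_eps f p v (d : R) : is_derive p v f d <->
  forall e, 0 < e -> exists2 r, 0 < r &
   forall h, `|h| < r -> `|f (p + h *: v) - f p - h * d| <= e * `|h|.
Proof.
pose k (h : R) := h^-1 *: ((f \o shift p) (h *: v) - f p).
have kE : is_derive p v f d <-> k @ 0^' --> d.
  split; first by move=> [h1 <-].
  by move=> h; split; [apply/cvg_ex; exists d | apply: cvg_lim].
rewrite kE; split.
- move=> /cvgrPdist_le h e e0; have := h e e0.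
  rewrite near_withinE => /nbhs_ballP[r /= r0 hr]; exists r => // x xr.
  have [->|x0] := eqVneq x 0.
    by rewrite scale0r addr0 subrr mul0r subr0 normr0 mulr0.
  have := hr x; rewrite -ball_normE /= sub0r normrN => /(_ xr x0).
  rewrite /k /shift /= distrC -(ler_pM2r (_ : 0 < `|x|)) ?normr_gt0 //.
  by rewrite -normrM mulrBl mulrAC mulVf // mul1r [d * x]mulrC [_ + p]addrC.
- move=> h; apply/cvgrPdist_le => e /h[r r0 hr].
  rewrite near_withinE; apply/nbhs_ballP; exists r => //= x.
  rewrite -ball_normE /= sub0r normrN => xr x0.
  rewrite /k /shift /= distrC -(ler_pM2r (_ : 0 < `|x|)) ?normr_gt0 //.
  rewrite -normrM mulrBl mulrAC mulVf // mul1r [d * x]mulrC [_ + p]addrC.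
  exact: hr.
Qed.

Lemma MVT_line_sym f g p v (h : R) :
  (forall x, `|x| <= `|h| -> is_derive (p + x *: v) v f (g (p + x *: v))) ->
  exists2 x, `|x| <= `|h| & f (p + h *: v) - f p = h * g (p + x *: v).
Proof.
move=> hd; have [h0|h0|h0] := ltgtP 0 h; last first.
- by exists 0; rewrite -h0 ?normr0 // scale0r addr0 subrr mul0r.
- have hn : 0 < - h by rewrite oppr_gt0.
  have [|x /andP[x0 xh]] := @MVT_line_closed _ _ f g (p + h *: v) v _ hn.
    move=> x /andP[x0 xh]; rewrite -addrA -scalerDl; apply: hd.
    by rewrite (ltr0_norm h0) ler_norml; apply/andP; split; lra.
  rewrite -!addrA -!scalerDl subrr scale0r addr0 => e.
  exists (h + x); last by lra.
  by rewrite (ltr0_norm h0) ler_norml; apply/andP; split; lra.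
- have [|x /andP[x0 xh] e] := @MVT_line_closed _ _ f g p v _ h0.
    by move=> x /andP[x0 xh]; apply: hd; rewrite !ger0_norm // ltW.
  by exists x => //; rewrite !ger0_norm // ltW.
Qed.

Lemma is_derive_shift f p k v (d : R) :
  is_derive (p + k) v f d -> is_derive p v (fun q => f (q + k)) d.
Proof.
move=> /is_derive_line0 h; apply/is_derive_line0.
by move: h; congr (is_derive _ _ _ _); apply/funext => h; rewrite addrAC.
Qed.

Lemma norm_small v w (r : R) : 0 < r -> exists2 d : R, 0 < d &
  forall h x, `|h| < d -> `|x| <= `|h| -> `|h *: v + x *: w| < r.
Proof.
move=> r0; have n0 : 0 < `|v| + `|w| + 1 by rewrite ltr_wpDl // addr_ge0.
exists (r / (`|v| + `|w| + 1)); first by rewrite divr_gt0.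
move=> h x; rewrite ltr_pdivlMr // => hr xh.
apply: (le_lt_trans (ler_normD _ _)); rewrite !normrZ.
apply: le_lt_trans hr.
have h1 : `|x| * `|w| <= `|h| * `|w| by rewrite ler_wpM2r.
rewrite !mulrDr mulr1; have := normr_ge0 h; lra.
Qed.

(** The increment along v + w is the increment along v followed by one along w, and
the second is evaluated by the mean value theorem at a point close to p. *)
Lemma is_deriveD_dir f g p v w (a : R) : is_derive p v f a ->
  (\forall q \near p, is_derive q w f (g q)) -> {for p, continuous g} ->
  is_derive p (v + w) f (a + g p).
Proof.
move=> /is_derive_eps hv hw cg; apply/is_derive_eps => e e0.
have e2 : 0 < e / 2 by rewrite divr_gt0.
have [r1 r10 hr1] := hv _ e2.
have /nbhs_ballP[r /= r0 hr] : \forall q \near p,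
    is_derive q w f (g q) /\ `|g p - g q| <= e / 2.
  by near=> q; split; near: q => //; move/cvgrPdist_le: cg => /(_ _ e2).
have [d d0 hd] := norm_small v w r0.
exists (Num.min r1 d); first by rewrite lt_min r10.
move=> h; rewrite lt_min => /andP[hr1' hd'].
have hb x : `|x| <= `|h| -> ball p r (p + h *: v + x *: w).
  by move=> xh; rewrite -ball_normE /= distrC addrAC2; apply: hd.
have [x xh ex] := @MVT_line_sym f g (p + h *: v) w h
   (fun x xh => (hr _ (hb x xh)).1).
have := (hr _ (hb x xh)).2; have := hr1 _ hr1'.
rewrite scalerDr addrA; move: ex; move: (f (p + h *: v + h *: w)) (f (p + h *: v)) (f p) (g (p + h *: v + x *: w)) (g p).
move=> f1 f2 f3 g1 g2 ex k1 k2.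
have -> : f1 - f3 - h * (a + g2) = (f2 - f3 - h * a) + h * (g1 - g2).
  by rewrite mulrBr -ex; ring.
apply: (le_trans (ler_normD _ _)); rewrite normrM.
have : `|h| * `|g1 - g2| <= `|h| * (e / 2) by rewrite ler_wpM2l // distrC.
by move: k1; lra.
Unshelve. all: by end_near.
Qed.

(** The theorem of Schwarz: the second difference over a small parallelogram is a
value of gvw and a value of gwv, according to the order in which the mean value
theorem is applied. *)
Lemma derive_commute f gv gw gvw gwv p v w :
  (\forall q \near p, is_derive q v f (gv q)) ->
  (\forall q \near p, is_derive q w f (gw q)) ->
  (\forall q \near p, is_derive q w gv (gvw q)) ->
  (\forall q \near p, is_derive q v gw (gwv q)) ->
  {for p, continuous gvw} -> {for p, continuous gwv} -> gvw p = gwv p.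
Proof.
move=> h1 h2 h3 h4 c1 c2; apply/eqP; rewrite -subr_eq0 -normr_le0.
apply/ler_addgt0Pr => e e0; rewrite add0r.
have e2 : 0 < e / 2 by rewrite divr_gt0.
have /nbhs_ballP[r /= r0 hr] : \forall q \near p,
   [/\ is_derive q v f (gv q), is_derive q w f (gw q), is_derive q w gv (gvw q),
     is_derive q v gw (gwv q) & `|gvw p - gvw q| <= e / 2 /\ `|gwv p - gwv q| <= e / 2].
  by near=> q; split; [| | | |split]; near: q => //;
   [move/cvgrPdist_le: c1 | move/cvgrPdist_le: c2] => /(_ _ e2).
have [d d0 hd] := norm_small v w r0.
have [d' d'0 hd'] := norm_small w v r0.
pose h := Num.min d d' / 2.
have h0 : 0 < h by rewrite divr_gt0 // lt_min d0.
have hlt x : x <= h -> x < d /\ x < d'.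
  move=> xh; have : h < Num.min d d'.
    by rewrite /h ltr_pdivrMr // mulr_natr mulr2n ltrDl lt_min d0.
  rewrite lt_min => /andP[]; split; lra.
have B x y : 0 <= x <= h -> 0 <= y <= h -> ball p r (p + x *: v + y *: w).
  move=> /andP[x0 xh] /andP[y0 yh]; rewrite -ball_normE /= distrC addrAC2.
  have [xy|yx] := leP y x; first by apply: hd; rewrite ger0_norm ?ger0_norm //; apply hlt.
  by rewrite addrC; apply: hd'; rewrite ger0_norm ?ger0_norm ?(ltW yx) //; apply hlt.
clearbody h.
have h00 : 0 <= h <= h by apply/andP; split; [exact: ltW|exact: lexx].
have z00 : 0 <= (0 : R) <= h by apply/andP; split; [exact: lexx|exact: ltW].
have dv x y : 0 <= x <= h -> 0 <= y <= h ->
  is_derive (p + x *: v) v (fun q => f (q + y *: w)) (gv (p + x *: v + y *: w)).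
  by move=> xh yh; apply: is_derive_shift; have [] := hr _ (B _ _ xh yh).
have dw x y : 0 <= x <= h -> 0 <= y <= h ->
  is_derive (p + y *: w) w (fun q => f (q + x *: v)) (gw (p + y *: w + x *: v)).
  move=> xh yh; apply: is_derive_shift.
  by rewrite addrAC; have [] := hr _ (B _ _ xh yh).
have W0 (q : V) : (fun x => f (x + (0 : R) *: q)) = f.
  by apply/funext => x; rewrite scale0r addr0.
(* e1 and e3 evaluate the same second difference in the two orders *)
have [|x /andP[/ltW x0 /ltW xh]] := @MVT_line_closed _ _
   (fun q => f (q + h *: w) - f (q + 0 *: w)) (fun q => gv (q + h *: w) - gv (q + 0 *: w)) p v h h0.
  by move=> x xh; apply: is_deriveB; apply: dv.
have xxh : 0 <= x <= h by rewrite x0 xh.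
have [|y /andP[/ltW y0 /ltW yh]] := @MVT_line_closed _ _ gv gvw (p + x *: v) w h h0.
  by move=> y yh; have [] := hr _ (B _ _ xxh yh).
have yyh : 0 <= y <= h by rewrite y0 yh.
rewrite !scale0r !addr0 => -> e1.
have [|x' /andP[/ltW x'0 /ltW x'h]] := @MVT_line_closed _ _
   (fun q => f (q + h *: v) - f (q + 0 *: v)) (fun q => gw (q + h *: v) - gw (q + 0 *: v)) p w h h0.
  by move=> z zh; apply: is_deriveB; apply: dw.
have xxh' : 0 <= x' <= h by rewrite x'0 x'h.
have [|y' /andP[/ltW y'0 /ltW y'h]] := @MVT_line_closed _ _ gw gwv (p + x' *: w) v h h0.
  by move=> z zh; rewrite addrAC; have [] := hr _ (B _ _ zh xxh').
have yyh' : 0 <= y' <= h by rewrite y'0 y'h.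
rewrite !scale0r !addr0 => -> e3.
have [_ _ _ _ [k1 _]] := hr _ (B _ _ xxh yyh).
have [_ _ _ _ [_]] := hr _ (B _ _ yyh' xxh').
rewrite [p + y' *: v + _]addrAC.
have : gvw (p + x *: v + y *: w) = gwv (p + x' *: w + y' *: v).
  have hh : h * h != 0 by rewrite mulf_neq0 // gt_eqF.
  apply: (mulfI hh); rewrite -!mulrA -e1 -e3 [p + h *: w + _]addrAC; ring.
move=> <-; move: k1; move: (gvw (p + x *: v + y *: w)) (gvw p) (gwv p) => c a b k1 k2.
have -> : a - b = (a - c) - (b - c) by ring.
by apply: (le_trans (ler_normB _ _)); lra.
Unshelve. all: by end_near.
Qed.

(** A derivative passes to boundary points: the mean value estimate holds along
parallel segments inside, and it survives the limit since f and g are continuous up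
to the boundary. *)
Lemma is_derive_limit A f g p v (d : R) : 0 < d -> cts A f ->
  A p -> g @ within A (nbhs p) --> g p ->
  (forall h, `|h| < d -> A (p + h *: v)) ->
  (forall e, 0 < e -> exists2 k, `|k| < e &
     forall h, `|h| < d -> A (p + k + h *: v) /\
        is_derive (p + k + h *: v) v f (g (p + k + h *: v))) ->
  is_derive p v f (g p).
Proof.
move=> d0 cf Ap /cts_eps cg Ah hk; apply/is_derive_eps => e e0.
have [r r0 hr] := cg _ e0.
have r2 : 0 < r / 2 by rewrite divr_gt0.
have [d' d'0 hd'] := norm_small 0 v r2.
exists (Num.min d d'); first by rewrite lt_min d0.
move=> h; rewrite lt_min => /andP[hd hd2].
apply/ler_addgt0Pr => eta eta0.
have eta2 : 0 < eta / 2 by rewrite divr_gt0.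
have /cts_eps /(_ _ eta2)[s1 s10 hs1] := cf _ (Ah h hd).
have /cts_eps /(_ _ eta2)[s2 s20 hs2] := cf _ Ap.
have m0 : 0 < Num.min (r / 2) (Num.min s1 s2) by rewrite !lt_min r2 s10.
have [k] := hk _ m0; rewrite !lt_min => /and3P[kr k1 k2] hkk.
have [x xh ex] := @MVT_line_sym f g (p + k) v h
  (fun x xh => (hkk x (le_lt_trans xh hd)).2).
have A1 := (hkk h hd).1.
have A2 : A (p + k).
  have d0' : `|0 : R| < d by rewrite normr0.
  by have := (hkk 0 d0').1; rewrite scale0r addr0.
have A3 := (hkk x (le_lt_trans xh hd)).1.
have i1 : `|f (p + k + h *: v) - f (p + h *: v)| < eta / 2.
  by apply: hs1 => //; rewrite [p + k + _]addrAC [_ + k]addrC addrK.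
have i2 : `|f (p + k) - f p| < eta / 2.
  by apply: hs2 => //; rewrite [p + k]addrC addrK.
have i3 : `|g (p + k + x *: v) - g p| < e.
  apply: hr => //; rewrite addrAC2.
  apply: (le_lt_trans (ler_normD _ _)).
  have := hd' h x hd2 xh; rewrite scaler0 add0r; lra.
move: ex i1 i2 i3; move: (f (p + h *: v)) (f (p + k)) (f p) (f (p + k + h *: v)) (g (p + k + x *: v)) (g p).
move=> a1 a2 a3 a4 b1 b2 ex i1 i2 i3.
have -> : a1 - a3 - h * b2 = h * (b1 - b2) - (a4 - a1) + (a2 - a3).
  by rewrite mulrBr -ex; ring.
apply: (le_trans (ler_normD _ _)).
apply: (le_trans (lerD (ler_normB _ _) (lexx _))).
rewrite normrM.
have : `|h| * `|b1 - b2| <= e * `|h| by rewrite mulrC ler_wpM2r // ltW.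
lra.
Qed.
End Epsilon.

(** * Functions of class C1 and C2 on the closed cylinder *)

Lemma cts_interior {R : realType} {V : normedModType R} (U A : set V) (f : V -> R) p :
  open U -> U `<=` A -> cts A f -> U p -> {for p, continuous f}.
Proof.
move=> oU UA cf Up; apply/cvgrPdist_lt => e e0.
have /cvgrPdist_lt /(_ _ e0) := cf p (UA _ Up).
rewrite near_withinE => h; near=> q.
have Uq : U q by near: q; exact: open_nbhs_nbhs.
by move: (UA _ Uq); near: q.
Unshelve. all: by end_near.
Qed.

Lemma cts_subset {R : realType} {V : normedModType R} (A B : set V) (f : V -> R) :
  B `<=` A -> cts A f -> cts B f.
Proof. by move=> BA /ctsE cf; apply/ctsE; exact: continuous_subspaceW cf. Qed.

Lemma is_derive_mul {R : realType} {V : normedModType R} (f g : V -> R) (p v : V) (a b : R) : is_derive p v f a ->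
  is_derive p v g b -> is_derive p v (fun p => f p * g p) (a * g p + f p * b).
Proof.
move=> hf hg; have := is_deriveM hf hg.
by rewrite /GRing.scale /= [g p * a]mulrC addrC.
Qed.

Section ContinuityRules.
Context {R : realType} {V : normedModType R}.

Lemma cts_cst (A : set V) (c : R) : cts A (fun=> c).
Proof. by move=> p _; exact: cvg_cst. Qed.

Lemma cts_add (A : set V) (f g : V -> R) :
  cts A f -> cts A g -> cts A (fun p => f p + g p).
Proof. by move=> cf cg p Ap; apply: cvgD; [exact: cf | exact: cg]. Qed.

Lemma cts_mul (A : set V) (f g : V -> R) :
  cts A f -> cts A g -> cts A (fun p => f p * g p).
Proof. by move=> cf cg p Ap; apply: cvgM; [exact: cf | exact: cg]. Qed.

Lemma cts_opp (A : set V) (f : V -> R) : cts A f -> cts A (fun p => - f p).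
Proof. by move=> cf p Ap; apply: cvgN; exact: cf. Qed.

Lemma cts_comp (A : set V) (g : R -> R) (f : V -> R) :
  continuous g -> cts A f -> cts A (fun p => g (f p)).
Proof. by move=> cg cf p Ap; apply: (cvg_comp _ _ (cf p Ap)); exact: cg. Qed.

Lemma cts_exprn (A : set V) (f : V -> R) n : cts A f -> cts A (fun p => f p ^+ n).
Proof.
move=> cf; elim: n => [|n IH]; first exact: cts_cst.
have -> : (fun p => f p ^+ n.+1) = (fun p => f p * f p ^+ n).
  by apply/funext => p; rewrite exprS.
exact: cts_mul.
Qed.

End ContinuityRules.

Section C1.
Context {R : realType}.
Let E := (R * (R * R))%type.
Variable O : set (R * R).
Implicit Types (T : R) (p : E).

Definition slab T : set E := `[0, T] `*` closure O.
Definition et : E := (1, (0, 0)).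
Definition ex : E := (0, (1, 0)).
Definition ey : E := (0, (0, 1)).

Lemma cyl_slab T : cyl T O `<=` slab T.
Proof.
move=> -[t x] [/= t0 Ox]; split => /=; last exact: subset_closure.
exact: subset_itv_oo_cc t0.
Qed.

Lemma cyl_open T : open O -> open (cyl T O).
Proof.
move=> oO; have -> : cyl T O = (fst @^-1` `]0, T[%classic) `&` (snd @^-1` O).
  by apply/seteqP; split.
apply: openI; apply: open_comp => //.
- by move=> p _; exact: cvg_fst.
- by move=> p _; exact: cvg_snd.
Qed.

(** A function with its three partial derivatives, all continuous up to the boundary
of the cylinder. Bundling the derivatives makes sums, products and compositions
computable, so that identities between derivatives reduce to ring identities. *)
Record C1fun T := MkC1 {
  val :> E -> R; dT : E -> R; dX : E -> R; dY : E -> R;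
  cts_val : cts (slab T) val; cts_dT : cts (slab T) dT;
  cts_dX : cts (slab T) dX; cts_dY : cts (slab T) dY;
  is_dT : forall p, cyl T O p -> is_derive p et val (dT p);
  is_dX : forall p, cyl T O p -> is_derive p ex val (dX p);
  is_dY : forall p, cyl T O p -> is_derive p ey val (dY p) }.

End C1.
Arguments cts_val {R O T} c.
Arguments cts_dT {R O T} c.
Arguments cts_dX {R O T} c.
Arguments cts_dY {R O T} c.

(** The rules above, driven by the head symbol: blind unification would unfold the
functions instead. *)
Ltac cts_rules := repeat lazymatch goal with
  | |- cts _ (fun p => @?f p + @?g p) => apply: cts_add
  | |- cts _ (fun p => @?f p * @?g p) => apply: cts_mul
  | |- cts _ (fun p => - @?f p) => apply: cts_opp
  | |- cts _ (fun p => @?f p ^+ _) => apply: cts_exprn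
  | |- cts _ (fun p => val ?f p) => exact: cts_val
  | |- cts _ (val ?f) => exact: cts_val
  | |- cts _ (fun p => dX ?f p) => exact: cts_dX
  | |- cts _ (fun p => dY ?f p) => exact: cts_dY
  | |- cts _ (dT ?f) => exact: cts_dT
  | |- cts _ (dX ?f) => exact: cts_dX
  | |- cts _ (dY ?f) => exact: cts_dY
  | |- cts _ (fun p => ?c) => exact: cts_cst
  end.

Section C1Ops.
Context {R : realType}.
Let E := (R * (R * R))%type.
Variable O : set (R * R).
Implicit Types (T : R) (p : E).

Section Ops.
Variable T : R.

Definition C1cst (c : R) : C1fun O T.
Proof.
apply: (@MkC1 R O T (fun=> c) (fun=> 0) (fun=> 0) (fun=> 0)); do ?exact: cts_cst.
all: by move=> p _; exact: is_derive_cst.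
Defined.

Definition C1add (f g : C1fun O T) : C1fun O T.
Proof.
apply: (@MkC1 R O T (fun p => f p + g p) (fun p => dT f p + dT g p)
  (fun p => dX f p + dX g p) (fun p => dY f p + dY g p)).
1-4: by cts_rules.
all: by move=> p Up; apply: is_deriveD;
  solve [exact: is_dT | exact: is_dX | exact: is_dY].
Defined.

Definition C1opp (f : C1fun O T) : C1fun O T.
Proof.
apply: (@MkC1 R O T (fun p => - f p) (fun p => - dT f p)
  (fun p => - dX f p) (fun p => - dY f p)).
1-4: by cts_rules.
all: by move=> p Up; apply: is_deriveN;
  solve [exact: is_dT | exact: is_dX | exact: is_dY].
Defined.

Definition C1mul (f g : C1fun O T) : C1fun O T.
Proof.
apply: (@MkC1 R O T (fun p => f p * g p) (fun p => dT f p * g p + f p * dT g p)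
  (fun p => dX f p * g p + f p * dX g p) (fun p => dY f p * g p + f p * dY g p)).
1-4: by cts_rules.
all: by move=> p Up; apply: is_derive_mul;
  solve [exact: is_dT | exact: is_dX | exact: is_dY].
Defined.

Definition C1comp (g g' : R -> R) (cg' : continuous g')
  (dg : forall x : R, is_derive x 1 g (g' x)) (f : C1fun O T) : C1fun O T.
Proof.
apply: (@MkC1 R O T (fun p => g (f p)) (fun p => g' (f p) * dT f p)
  (fun p => g' (f p) * dX f p) (fun p => g' (f p) * dY f p)).
- apply: cts_comp; last exact: cts_val.
  move=> x; apply/differentiable_continuous/derivable1_diffP.
  by have [] := dg x.
1-3: apply: cts_mul; [apply: cts_comp => //; exact: cts_val|
  solve [exact: cts_dT | exact: cts_dX | exact: cts_dY]].
all: by move=> p Up; apply: is_derive_comp_r; try exact: dg;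
  solve [exact: is_dT | exact: is_dX | exact: is_dY].
Defined.

Definition C1exp : C1fun O T -> C1fun O T :=
  C1comp (@continuous_expR R) (@is_derive_expR R).

End Ops.

Lemma slab_sub T T' : T' <= T -> slab O T' `<=` slab O T.
Proof.
move=> h -[t x] [/= + Ox]; rewrite in_itv /= => /andP[t0 tT]; split => //=.
by rewrite in_itv /= t0 (le_trans tT).
Qed.

Lemma cyl_sub T T' : T' <= T -> cyl T' O `<=` cyl T O.
Proof.
move=> h -[t x] [/= + Ox]; rewrite in_itv /= => /andP[t0 tT]; split => //=.
by rewrite in_itv /= t0 (lt_le_trans tT).
Qed.

Definition C1restr T T' (h : T' <= T) (f : C1fun O T) : C1fun O T'.
Proof.
apply: (@MkC1 R O T' f (dT f) (dX f) (dY f)).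
1-4: by apply: (cts_subset (slab_sub h)); cts_rules.
all: by move=> p /(cyl_sub h); solve [exact: is_dT | exact: is_dX | exact: is_dY].
Defined.

(** Only the three mixed symmetries are recorded: the second derivatives are those of
ct, cx and cy. *)
Record C2fun T := MkC2 {
  c0 :> C1fun O T; ct : C1fun O T; cx : C1fun O T; cy : C1fun O T;
  dT_c0 : dT c0 = ct; dX_c0 : dX c0 = cx; dY_c0 : dY c0 = cy;
  sym_tx : forall p, cyl T O p -> dX ct p = dT cx p;
  sym_ty : forall p, cyl T O p -> dY ct p = dT cy p;
  sym_xy : forall p, cyl T O p -> dY cx p = dX cy p }.

Section FromClass.
Variables (T : R) (A : set E).
Hypotheses (oO : open O) (QA : slab O T `<=` A).

Lemma class_C1P (f : E -> R) : class_C 1 (cyl T O) A f ->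
  exists F : C1fun O T, val F = f.
Proof.
move=> [cf hf].
have [ht [gt [gt1 [gt2 _]]]] := hf et.
have [hx [gx [gx1 [gx2 _]]]] := hf ex.
have [hy [gy [gy1 [gy2 _]]]] := hf ey.
have c g : {within A, continuous g} -> cts (slab O T) g.
  by move=> cg; apply: (cts_subset QA); apply/ctsE.
unshelve eexists (@MkC1 R O T f gt gx gy _ _ _ _ _ _ _) => //; try exact: c.
- by move=> p Up; rewrite gt1 //; apply: DeriveDef => //; exact: ht.
- by move=> p Up; rewrite gx1 //; apply: DeriveDef => //; exact: hx.
- by move=> p Up; rewrite gy1 //; apply: DeriveDef => //; exact: hy.
Qed.

Lemma C1_near (f : C1fun O T) p : cyl T O p ->
  [/\ \forall q \near p, is_derive q et f (dT f q),
      \forall q \near p, is_derive q ex f (dX f q) &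
      \forall q \near p, is_derive q ey f (dY f q)].
Proof.
move=> Up; have := open_nbhs_nbhs (conj (cyl_open (T:=T) oO) Up) => N.
split; near=> q; have Uq : cyl T O q by [near: q].
- exact: is_dT.
- exact: is_dX.
- exact: is_dY.
Unshelve. all: by end_near.
Qed.

(** The mixed derivatives agree by derive_commute, since the second derivatives are
continuous inside the cylinder. *)
Lemma class_C2P (f : E -> R) : class_C 2 (cyl T O) A f ->
  exists F : C2fun T, val F = f.
Proof.
move=> [cf hf].
have [ht [gt [gt1 /class_C1P[Ft Fte]]]] := hf et.
have [hx [gx [gx1 /class_C1P[Fx Fxe]]]] := hf ex.
have [hy [gy [gy1 /class_C1P[Fy Fye]]]] := hf ey.
subst gt gx gy.
have c (g : E -> R) : {within A, continuous g} -> cts (slab O T) g.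
  by move=> cg; apply: (cts_subset QA); apply/ctsE.
have h1 p : cyl T O p -> is_derive p et f (Ft p).
  by move=> Up; rewrite gt1 //; apply: DeriveDef => //; exact: ht.
have h2 p : cyl T O p -> is_derive p ex f (Fx p).
  by move=> Up; rewrite gx1 //; apply: DeriveDef => //; exact: hx.
have h3 p : cyl T O p -> is_derive p ey f (Fy p).
  by move=> Up; rewrite gy1 //; apply: DeriveDef => //; exact: hy.
pose F := @MkC1 R O T f Ft Fx Fy (c _ cf) (cts_val Ft) (cts_val Fx) (cts_val Fy)
  h1 h2 h3.
have ci g p : cts (slab O T) g -> cyl T O p -> {for p, continuous g}.
  by move=> cg; apply: cts_interior cg; [exact: cyl_open | exact: cyl_slab].
unshelve eexists (@MkC2 T F Ft Fx Fy _ _ _ _ _ _) => //.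
- move=> p Up; have [a1 a2 a3] := C1_near F Up.
  have [b1 b2 b3] := C1_near Ft Up; have [d1 d2 d3] := C1_near Fx Up.
  by apply: (derive_commute a1 a2 b2 d1); apply: ci => //; [exact: cts_dX|exact: cts_dT].
- move=> p Up; have [a1 a2 a3] := C1_near F Up.
  have [b1 b2 b3] := C1_near Ft Up; have [d1 d2 d3] := C1_near Fy Up.
  by apply: (derive_commute a1 a3 b3 d1); apply: ci => //; [exact: cts_dY|exact: cts_dT].
- move=> p Up; have [a1 a2 a3] := C1_near F Up.
  have [b1 b2 b3] := C1_near Fx Up; have [d1 d2 d3] := C1_near Fy Up.
  by apply: (derive_commute a2 a3 b3 d2); apply: ci => //; [exact: cts_dY|exact: cts_dX].
Qed.

Lemma C1_dir (f : C1fun O T) p (a b c : R) : cyl T O p ->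
  is_derive p (a, (b, c)) f (a * dT f p + b * dX f p + c * dY f p).
Proof.
move=> Up; have N := open_nbhs_nbhs (conj (cyl_open (T:=T) oO) Up).
have -> : (a, (b, c)) = a *: et + b *: ex + c *: ey :> E.
  apply: injective_projections; last apply: injective_projections.
  - by change (a = a * 1 + b * 0 + c * 0); ring.
  - by change (b = a * 0 + b * 1 + c * 0); ring.
  - by change (c = a * 0 + b * 0 + c * 1); ring.
have ci g : cts (slab O T) g -> {for p, continuous g}.
  by move=> cg; apply: cts_interior Up; [exact: cyl_open | exact: cyl_slab|].
apply: (@is_deriveD_dir _ _ _ (fun q => c * dY f q)).
- apply: (@is_deriveD_dir _ _ _ (fun q => b * dX f q)).
  + by apply: is_derive_scale; exact: is_dT.
  + by near=> q; apply: is_derive_scale; apply: is_dX; near: q.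
  + by apply: ci; apply: cts_mul; [exact: cts_cst | exact: cts_dX].
- by near=> q; apply: is_derive_scale; apply: is_dY; near: q.
- by apply: ci; apply: cts_mul; [exact: cts_cst | exact: cts_dY].
Unshelve. all: by end_near.
Qed.

End FromClass.
End C1Ops.

(** * Measurability and boundedness *)

Section CountableBase.

(** A countable base makes an open set of a product measurable for the product
sigma-algebra, boxes with rational endpoints being products of intervals. *)
Definition cbase (X : topologicalType) (B : nat -> set X) :=
  forall U x, open U -> U x -> exists n, B n x /\ B n `<=` U.

Lemma cbase_open (X : topologicalType) (B : nat -> set X) (U : set X) :
  cbase B -> open U -> U = \bigcup_(n in [set n | B n `<=` U]) B n.
Proof.
move=> hB oU; apply/seteqP; split => x.
- by move=> /(hB U x oU)[n [Bx BU]]; exists n.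
- by move=> [n /= BU Bx]; exact: BU.
Qed.

Definition npair (n : nat) : nat * nat := odflt (0, 0)%N (unpickle n).

Lemma cbaseX (X Y : topologicalType) (B1 : nat -> set X) (B2 : nat -> set Y) :
  cbase B1 -> cbase B2 -> cbase (fun n => B1 (npair n).1 `*` B2 (npair n).2).
Proof.
move=> h1 h2 U [x y] oU Uxy.
have : nbhs (x, y) U by apply: open_nbhs_nbhs.
move=> [[P Q] /= [nP nQ] PQU].
have [n1 [B1x B1P]] := h1 P^° x (open_interior P) nP.
have [n2 [B2y B2Q]] := h2 Q^° y (open_interior Q) nQ.
exists (pickle (n1, n2)); rewrite /npair pickleK /=; split => //.
by move=> [a b] [/= /B1P /interior_subset Pa /B2Q /interior_subset Qb]; apply: PQU.
Qed.

Variable R : realType.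
Definition qitv (n : nat) : set R :=
  let q : rat * rat := odflt (0, 0) (unpickle n) in `]ratr q.1, ratr q.2[.

Lemma qitv_base : cbase qitv.
Proof.
move=> U x oU Ux.
have /nbhs_ballP[e /= e0 he] : nbhs x U by apply: open_nbhs_nbhs.
have [|q1] := @rat_in_itvoo R (x - e) x; first by lra.
rewrite in_itv /= => /andP[a1 a2].
have [|q2] := @rat_in_itvoo R x (x + e); first by lra.
rewrite in_itv /= => /andP[b1 b2].
exists (pickle (q1, q2)); rewrite /qitv pickleK /=; split.
  by rewrite in_itv /= a2.
move=> y /=; rewrite in_itv /= => /andP[y1 y2]; apply: he.
by rewrite /ball /= ltr_norml; apply/andP; split; lra.
Qed.

Let MR := measurableTypeR R.

Lemma measurable_qitv n : measurable (qitv n : set MR).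
Proof. exact: measurable_itv. Qed.

Lemma open_measurable2 (U : set (R * R)) :
  open U -> measurable (U : set (MR * MR)%type).
Proof.
move=> oU; rewrite (cbase_open (cbaseX qitv_base qitv_base) oU).
apply: bigcup_measurable => n _.
by apply: measurableX; exact: measurable_qitv.
Qed.

Lemma open_measurable3 (U : set (R * (R * R))) :
  open U -> measurable (U : set (MR * (MR * MR))%type).
Proof.
move=> oU; rewrite (cbase_open (cbaseX qitv_base (cbaseX qitv_base qitv_base)) oU).
apply: bigcup_measurable => n _.
by do 2 (apply: measurableX; first exact: measurable_qitv); exact: measurable_qitv.
Qed.

End CountableBase.

Section MeasurableCts.
Variable R : realType.
Let MR := measurableTypeR R.
Let E3 := (MR * (MR * MR))%type.
Let E2 := (MR * MR)%type.

Lemma cts_preimage {V : normedModType R} (A : set V) (f : V -> R) (Y : set R) :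
  cts A f -> open Y -> exists2 W : set V, open W & A `&` f @^-1` Y = A `&` W.
Proof.
move=> /ctsE /continuousP cf oY; have := cf _ oY.
by move=> /open_subspaceP[W oW e]; exists W => //; rewrite ![A `&` _]setIC.
Qed.

Lemma cts_measurable3 (A : set (R * (R * R))) (f : R * (R * R) -> R) :
  measurable (A : set E3) -> cts A f -> measurable_fun (A : set E3) f.
Proof.
move=> mA cf; apply: (measurability _ (RGenOpens.measurableE R)) => //.
move=> _ [_ [a [b ->] <-]].
have [|W oW ->] := cts_preimage cf (_ : open [set` `]a, b[ ]).
  by apply: interval_open.
by apply: measurableI => //; exact: open_measurable3.
Qed.

Lemma cts_measurable2 (A : set (R * R)) (f : R * R -> R) :
  measurable (A : set E2) -> cts A f -> measurable_fun (A : set E2) f.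
Proof.
move=> mA cf; apply: (measurability _ (RGenOpens.measurableE R)) => //.
move=> _ [_ [a [b ->] <-]].
have [|W oW ->] := cts_preimage cf (_ : open [set` `]a, b[ ]).
  by apply: interval_open.
by apply: measurableI => //; exact: open_measurable2.
Qed.

Lemma cts_bounded {V : normedModType R} (A : set V) (f : V -> R) :
  compact A -> cts A f -> exists2 M : R, 0 < M & forall p : V, A p -> `|f p| <= M.
Proof.
move=> cA /ctsE cf; have [A0|/set0P/negP/negbNE/eqP A0] := pselect (A !=set0); last first.
  by exists 1 => // p; rewrite A0.
have [c1 _ h1] := compact_EVT_max A0 cA cf.
have [c2 _ h2] := compact_EVT_min A0 cA cf.
exists (`|f c1| + `|f c2| + 1); first by rewrite ltr_wpDl // addr_ge0.
move=> p Ap; have := h1 p (mem_set Ap); have := h2 p (mem_set Ap).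
have := ler_norm (f c1); have := ler_norm (- f c2); rewrite normrN => a b c d.
have := normr_ge0 (f c1); have := normr_ge0 (f c2) => x y.
by rewrite ler_norml; apply/andP; split; lra.
Qed.
End MeasurableCts.

Section BoundedIntegral.
Context d (X : measurableType d) (R : realType) (mu : {measure set X -> \bar R}).

Lemma bounded_integrable (A : set X) (f : X -> R) (M : R) : measurable A ->
  (mu A < +oo)%E -> measurable_fun A f -> (forall x, A x -> `|f x| <= M) ->
  mu.-integrable A (EFin \o f).
Proof.
move=> mA fA mf hM; apply: measurable_bounded_integrable => //.
exists M; split; first exact: num_real.
by move=> K MK x Ax /=; apply: (le_trans (hM x Ax)); exact: ltW.
Qed.

Lemma bounded_cvg (A : set X) (f_ : nat -> X -> R) (f : X -> R) (M : R) :
  measurable A -> (mu A < +oo)%E -> (forall n, measurable_fun A (f_ n)) ->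
  (forall n x, A x -> `|f_ n x| <= M) ->
  (forall x, A x -> f_ n x @[n --> \oo] --> f x) ->
  \int[mu]_(x in A) f_ n x @[n --> \oo] --> \int[mu]_(x in A) f x.
Proof.
move=> mA fA mf hM hf.
have iM : mu.-integrable A (EFin \o (cst M : X -> R)).
  apply: (@bounded_integrable _ _ `|M|) => //.
have mfl : measurable_fun A f := measurable_fun_cvg mf hf.
have cE x : A x -> (EFin \o f_ ^~ x) n @[n --> \oo] --> (f x)%:E.
  by move=> Ax; apply: cvg_EFin; [exact: nearW | exact: hf].
have [intf _ h] := dominated_convergence mA (fun n => (measurable_EFinP _ _).2 (mf n))
   ((measurable_EFinP _ _).2 mfl) (aeW _ cE)
   iM (aeW _ (fun x n Ax => hM n x Ax)).
by apply: fine_cvg; rewrite fineK //; exact: integrable_fin_num.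
Qed.
End BoundedIntegral.

(** * Integration by parts on the cylinder *)

Section Lines.
Variable R : realType.
Notation mu := (@lebesgue_measure R).

Lemma integral_derivative_compact (h h' : R -> R) (M : R) : 0 < M ->
  (forall x : R, is_derive x 1 h (h' x)) -> continuous h' ->
  (forall x : R, M <= `|x| -> h x = 0) -> (forall x : R, M <= `|x| -> h' x = 0) ->
  (\int[mu]_x (h' x)%:E = 0)%E.
Proof.
move=> M0 dh ch hM h'M.
have -> : (\int[mu]_x (h' x)%:E = \int[mu]_(x in `[(- M)%R, M]) (h' x)%:E)%E.
  rewrite [RHS]integral_mkcond; apply: eq_integral => x _.
  rewrite patchE; case: ifPn => // /negP; rewrite inE /= in_itv /= => /negP xM.
  rewrite h'M //; move: xM; rewrite -ler_norml -ltNge; exact: ltW.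
have MM : - M < M by lra.
have chh : continuous h.
  by move=> x; apply/differentiable_continuous/derivable1_diffP; have [] := dh x.
rewrite (@continuous_FTC2 _ h' h _ _ MM).
- by rewrite !hM ?subee // ?normrN ger0_norm // ltW.
- exact: continuous_subspaceT.
- split.
  + by move=> x _; have [] := dh x.
  + by apply: cvg_at_right_filter; exact: chh.
  + by apply: cvg_at_left_filter; exact: chh.
- by move=> x _; rewrite derive1E; have [] := dh x.
Qed.

Lemma integral_derivative_segment (h h' : R -> R) (T : R) : 0 < T ->
  (forall x : R, 0 < x < T -> is_derive x 1 h (h' x)) ->
  {within `[0, T], continuous h} -> {within `[0, T], continuous h'} ->
  (\int[mu]_(x in `]0%R, T[) (h' x)%:E = (h T - h 0)%:E)%E.
Proof.
move=> T0 dh ch ch'.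
have mh : measurable_fun `[0, T] (EFin \o h').
  by apply/measurable_EFinP; apply: subspace_continuous_measurable_fun.
rewrite integral_itv_bndo_bndc; last first.
  by apply: measurable_funS mh => // x; exact: subset_itv_oo_cc.
rewrite integral_itv_obnd_cbnd; last first.
  by apply: measurable_funS mh => // x; exact: subset_itv_oc_cc.
rewrite (@continuous_FTC2 _ h' h _ _ T0) //.
- have /continuous_within_itvP := ch => /(_ T0)[_ h1 h2]; split => //.
  by move=> x; rewrite in_itv /= => /dh [].
- by move=> x; rewrite in_itv /= derive1E => /dh [].
Qed.
End Lines.

Lemma line_et (R : realType) (y : R * R) (u : R) :
  ((0, y) : R * (R * R)) + u *: (@et R) = (u, y).
Proof.
apply: injective_projections; last apply: injective_projections.
- by change (0 + u * 1 = u); ring.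
- by change (y.1 + u * 0 = y.1); ring.
- by change (y.2 + u * 0 = y.2); ring.
Qed.

Lemma line_ex (R : realType) (t b : R) (u : R) :
  ((t, (0, b)) : R * (R * R)) + u *: (@ex R) = (t, (u, b)).
Proof.
apply: injective_projections; last apply: injective_projections.
- by change (t + u * 0 = t); ring.
- by change (0 + u * 1 = u); ring.
- by change (b + u * 0 = b); ring.
Qed.

Lemma line_ey (R : realType) (t a : R) (u : R) :
  ((t, (a, 0)) : R * (R * R)) + u *: (@ey R) = (t, (a, u)).
Proof.
apply: injective_projections; last apply: injective_projections.
- by change (t + u * 0 = t); ring.
- by change (a + u * 0 = a); ring.
- by change (0 + u * 1 = u); ring.
Qed.

Lemma is_derive_time (R : realType) (O : set (R * R)) (T : R) (H : C1fun O T)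
  (t : R) (y : R * R) : cyl T O (t, y) ->
  is_derive t 1 (fun u => H (u, y)) (dT H (t, y)).
Proof.
move=> Up; have := is_dT H Up.
have {1}-> : (t, y) = (0, y) + t *: et :> R * (R * R) by rewrite line_et.
move=> /is_derive_line; congr (is_derive _ _ _ _).
by apply/funext => u; rewrite line_et.
Qed.

Section IBP.
Context {R : realType}.
Let E := (R * (R * R))%type.
Let MR := measurableTypeR R.
Variables (O : set (R * R)) (hO : bounded_domain O).
Notation mu := (@lebesgue_measure R).
Notation mu2 := (leb2 R).
Notation mu3 := (leb3 R).

Let oO : open O. Proof. by have [] := hO. Qed.

Lemma O_box : exists2 M : R, 0 < M &
  closure O `<=` `[- M, M] `*` `[- M, M].
Proof.
have [_ _ _ [M [_ hM]]] := hO.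
have M1 : M < `|M| + 1 by rewrite ltr_pwDr // ler_norm.
exists (`|M| + 1) => //.
set B := _ `*` _.
have -> : B = closure B.
  apply/closure_id; apply: compact_closed; first exact: norm_hausdorff.
  by apply: compact_setX; exact: segment_compact.
apply: closureS => -[x y] Oxy; have := hM _ M1 _ Oxy.
rewrite /= /Num.norm /= ge_max => /andP[hx hy].
by split => /=; rewrite in_itv /= -ler_norml.
Qed.

Lemma compact_slab (T : R) : compact (slab O T).
Proof.
apply: compact_setX; first exact: segment_compact.
have [M M0 hM] := O_box.
apply: (subclosed_compact (@closed_closure _ _) _ hM).
by apply: compact_setX; exact: segment_compact.
Qed.

Lemma measurable_O : measurable (O : set (MR * MR)%type).
Proof. exact: open_measurable2. Qed.

Lemma measurable_cyl T : measurable (cyl T O : set (MR * (MR * MR))%type).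
Proof. by apply: open_measurable3; exact: cyl_open. Qed.

Lemma finite_O : (mu2 O < +oo)%E.
Proof.
have [M M0 hM] := O_box.
have mI : measurable (`[- M, M]%classic : set MR) by exact: measurable_itv.
apply: (@le_lt_trans _ _ (mu2 (`[- M, M] `*` `[- M, M]))).
  apply: le_measure; rewrite ?inE; [exact: measurable_O | exact: measurableX |].
  by move=> x Ox; apply: hM; exact: subset_closure.
rewrite /leb2 product_measure1E //= lebesgue_measure_itv /= lte_fin.
by case: ifP => // _; rewrite ?mul0e // -?EFinN -?EFinD -?EFinM ltry.
Qed.

Lemma finite_cyl T : (mu3 (cyl T O) < +oo)%E.
Proof.
have mI : measurable (`]0, T[%classic : set MR) by exact: measurable_itv.
have mO := measurable_O.
rewrite /leb3 /cyl product_measure1E //=.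
rewrite lebesgue_measure_itv /= lte_fin.
have := finite_O; have : (0 <= mu2 O)%E by exact: measure_ge0.
rewrite /=; case: (leb2 R O) => // r r0 _.
by case: ifP => // _; rewrite ?mul0e // -?EFinN -?EFinD -?EFinM ltry.
Qed.

Lemma cts_integrable T (f : E -> R) : cts (slab O T) f ->
  mu3.-integrable (cyl T O) (EFin \o f).
Proof.
move=> cf; have [M _ hM] := cts_bounded (@compact_slab T) cf.
apply: (@bounded_integrable _ _ _ _ _ _ M).
- exact: measurable_cyl.
- exact: finite_cyl.
- apply: cts_measurable3; first exact: measurable_cyl.
  by apply: cts_subset cf; exact: cyl_slab.
- by move=> p /cyl_slab; exact: hM.
Qed.

Lemma cts_slice T (f : E -> R) t : 0 <= t <= T -> cts (slab O T) f ->
  cts (closure O) (fun x => f (t, x)).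
Proof.
move=> tT cf x Ox; apply/cts_eps => e e0.
have Sx : slab O T (t, x) by split => //=; rewrite in_itv.
have /cts_eps /(_ _ e0)[d d0 hd] := cf _ Sx; exists d => // y Oy xy.
apply: hd; first by split => //=; rewrite in_itv.
by change (Num.max `|t - t| `|y - x| < d); rewrite subrr normr0 gt_max d0.
Qed.

Lemma slice_integrable T (f : E -> R) t : 0 <= t <= T -> cts (slab O T) f ->
  mu2.-integrable O (EFin \o (fun x => f (t, x))).
Proof.
move=> tT cf; have [M _ hM] := cts_bounded (@compact_slab T) cf.
apply: (@bounded_integrable _ _ _ _ _ _ M).
- exact: measurable_O.
- exact: finite_O.
- apply: cts_measurable2; first exact: measurable_O.
  by apply: cts_subset (cts_slice tT cf); exact: subset_closure.
- by move=> x Ox; apply: hM; split => /=; [rewrite in_itv|exact: subset_closure].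
Qed.

Lemma cyl_integral T (f : E -> R) :
  (\int[mu3]_(p in cyl T O) (f p)%:E = \int[mu3]_p ((f \_ (cyl T O)) p)%:E)%E.
Proof.
rewrite integral_mkcond; apply: eq_integral => p _.
by rewrite !patchE; case: ifP.
Qed.

Lemma cyl_patch_integrable T (f : E -> R) : cts (slab O T) f ->
  mu3.-integrable setT (EFin \o (f \_ (cyl T O))).
Proof.
move=> cf; have -> : EFin \o (f \_ (cyl T O)) = (EFin \o f) \_ (cyl T O).
  by apply/funext => p; rewrite /= !patchE; case: ifP.
apply: (integrable_mkcond _ (measurable_cyl T)).1; exact: cts_integrable.
Qed.

Lemma slice_patch_integrable T (f : E -> R) t : cts (slab O T) f ->
  mu2.-integrable setT (fun y => ((f \_ (cyl T O)) (t, y))%:E).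
Proof.
move=> cf; have [tT|tT] := pselect (0 < t < T); last first.
  have -> : (fun y => ((f \_ (cyl T O)) (t, y))%:E) = cst 0%E.
    apply/funext => y; rewrite patchE; case: ifPn => //; rewrite inE.
    by case => /=; rewrite in_itv.
  exact: integrable0.
have -> : (fun y => ((f \_ (cyl T O)) (t, y))%:E)
   = (EFin \o (fun x => f (t, x))) \_ O.
  apply/funext => y; rewrite !patchE.
  have -> : ((t, y) \in cyl T O) = (y \in O).
    apply/idP/idP; rewrite !inE; first by case.
    by move=> Oy; split => //=; rewrite in_itv.
  by case: ifP.
apply: (integrable_mkcond _ measurable_O).1.
by case/andP: tT => /ltW t0 /ltW tT; apply: (@slice_integrable T) => //; apply/andP.
Qed.

(** A function that vanishes near the lateral boundary extends by 0 to a C1 function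
on the whole strip, hence the integral of its space derivatives is 0 on every line. *)
Section Lateral.
Variables (T : R) (H : C1fun O T).
Hypothesis H0 : forall p : E, 0 < p.1 < T -> ~ O p.2 ->
  \forall q \near p, cyl T O q -> H q = 0.

Section Direction.
Variables (v : E) (dH : E -> R).
Hypotheses (cdH : cts (slab O T) dH)
  (isdH : forall p, cyl T O p -> is_derive p v H (dH p)).

Lemma lateral_patch (p : E) : 0 < p.1 < T ->
  is_derive p v (H \_ (cyl T O)) ((dH \_ (cyl T O)) p) /\
  {for p, continuous (dH \_ (cyl T O))}.
Proof.
move=> pT; have [Op|Op] := pselect (O p.2).
- have Up : cyl T O p by split => //=; rewrite in_itv.
  have NU : \forall q \near p, cyl T O q.
    by apply: open_nbhs_nbhs; split => //; exact: cyl_open.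
  have e (f : E -> R) : \forall q \near p, f q = (f \_ (cyl T O)) q.
    by near=> q; rewrite patchE mem_set //; near: q.
  split.
    by rewrite patchE mem_set //; apply: near_eq_is_derive (e H) (isdH Up).
  rewrite /prop_for /continuous_at; have -> : (dH \_ (cyl T O)) p = dH p.
    by rewrite patchE mem_set.
  apply: cvg_trans (cts_interior (cyl_open oO) (@cyl_slab _ _ _) cdH Up).
  by apply: near_eq_cvg; exact: e.
- have z1 : \forall q \near p, 0 = (H \_ (cyl T O)) q.
    near=> q; rewrite patchE; case: ifPn => //; rewrite inE => Uq.
    by symmetry; move: Uq; near: q; exact: H0.
  have z2 : \forall q \near p, 0 = (dH \_ (cyl T O)) q.
    have /near_join : \forall q \near p, cyl T O q -> H q = 0 by exact: H0.
    move=> h; near=> q; rewrite patchE; case: ifPn => //; rewrite inE => Uq.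
    have hq : \forall q' \near q, cyl T O q' -> H q' = 0 by near: q.
    have [_ <-] := isdH Uq.
    have [_ //] : is_derive q v H 0.
    apply: near_eq_is_derive (is_derive_cst 0 q v).
    near=> q' => /=; symmetry; apply: (near hq q') => //.
    by near: q'; apply: open_nbhs_nbhs; split => //; exact: cyl_open.
  split; rewrite /prop_for /continuous_at -(nbhs_singleton z2).
    exact: near_eq_is_derive z1 (is_derive_cst 0 p v).
  by apply: cvg_trans (cvg_cst 0 : (fun=> 0 : R) @ p --> (0 : R)); apply: near_eq_cvg.
Unshelve. all: by end_near.
Qed.

Lemma lateral_line (p : E) (M : R) : 0 < M -> v.1 = 0 -> 0 < p.1 < T ->
  (forall x : R, M <= `|x| -> ~ cyl T O (p + x *: v)) ->
  (\int[mu]_x ((dH \_ (cyl T O)) (p + x *: v)%R)%:E = 0)%E.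
Proof.
move=> M0 v0 pT hM.
have pxT (x : R) : 0 < (p + x *: v).1 < T.
  by change (0 < p.1 + x * v.1 < T); rewrite v0 mulr0 addr0.
apply: (@integral_derivative_compact _ (fun x => (H \_ (cyl T O)) (p + x *: v)) _ M) => //.
- by move=> x; have [h _] := lateral_patch (pxT x); exact: (is_derive_line _ _ _ _ _).1 h.
- move=> x; have [_ c] := lateral_patch (pxT x).
  have l : (fun u : R => p + u *: v) @ x --> p + x *: v.
    apply: cvgD; first exact: cvg_cst.
    by apply: cvgZr_tmp; exact: cvg_id.
  exact: (cvg_comp _ _ l c).
- by move=> x /hM h; rewrite patchE memNset.
- by move=> x /hM h; rewrite patchE memNset.
Qed.
End Direction.

Lemma lateral_x (t x2 : R) :
  (\int[mu]_x ((dX H \_ (cyl T O)) (t, (x, x2)))%:E = 0)%E.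
Proof.
have [tT|tT] := pselect (0 < t < T); last first.
  apply: integral0_eq => x _; rewrite patchE memNset // => -[] /=.
  by rewrite in_itv.
have [M M0 hM] := O_box.
rewrite -[RHS](@lateral_line ex (dX H) (cts_dX H) (@is_dX _ _ _ H) (t, (0, x2)) (M + 1)) //.
- by apply: eq_integral => x _; rewrite line_ex.
- by rewrite addr_gt0.
- move=> x xM; rewrite line_ex => -[/= _ /(@subset_closure _ O) /hM [/=]].
  by rewrite in_itv /= -ler_norml => xM'; lra.
Qed.

Lemma lateral_y (t x1 : R) :
  (\int[mu]_x ((dY H \_ (cyl T O)) (t, (x1, x)))%:E = 0)%E.
Proof.
have [tT|tT] := pselect (0 < t < T); last first.
  apply: integral0_eq => x _; rewrite patchE memNset // => -[] /=.
  by rewrite in_itv.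
have [M M0 hM] := O_box.
rewrite -[RHS](@lateral_line ey (dY H) (cts_dY H) (@is_dY _ _ _ H) (t, (x1, 0)) (M + 1)) //.
- by apply: eq_integral => x _; rewrite line_ey.
- by rewrite addr_gt0.
- move=> x xM; rewrite line_ey => -[/= _ /(@subset_closure _ O) /hM [/= _]].
  by rewrite in_itv /= -ler_norml => xM'; lra.
Qed.

Lemma ibp_x : (\int[mu3]_(p in cyl T O) (dX H p)%:E = 0)%E.
Proof.
rewrite cyl_integral -[LHS]/(\int[_ \x mu2]_p _)%E.
rewrite -(integral12_prod_meas1 (cyl_patch_integrable (cts_dX H))).
apply: integral0_eq => t _; rewrite /fubini_F /=.
rewrite -[LHS]/(\int[_ \x mu]_p _)%E.
rewrite -(integral21_prod_meas1 (slice_patch_integrable t (cts_dX H))).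
by apply: integral0_eq => x2 _; exact: lateral_x.
Qed.

Lemma ibp_y : (\int[mu3]_(p in cyl T O) (dY H p)%:E = 0)%E.
Proof.
rewrite cyl_integral -[LHS]/(\int[_ \x mu2]_p _)%E.
rewrite -(integral12_prod_meas1 (cyl_patch_integrable (cts_dY H))).
apply: integral0_eq => t _; rewrite /fubini_F /=.
rewrite -[LHS]/(\int[_ \x mu]_p _)%E.
rewrite -(integral12_prod_meas1 (slice_patch_integrable t (cts_dY H))).
by apply: integral0_eq => x1 _; exact: lateral_y.
Qed.

End Lateral.

Lemma cts_time T (f : E -> R) y : O y -> cts (slab O T) f ->
  {within `[0, T], continuous (fun t => f (t, y))}.
Proof.
move=> Oy cf; apply/ctsE => t tT; apply/cts_eps => e e0.
have cOy : closure O y by exact: subset_closure.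
have /cts_eps /(_ _ e0)[d d0 hd] := cf (t, y) (conj tT cOy).
exists d => // u uT ut; apply: hd; first by split.
by change (Num.max `|u - t| `|y - y| < d); rewrite subrr normr0 gt_max d0 andbT.
Qed.

Lemma ibp_t T (H : C1fun O T) : 0 < T ->
  (\int[mu3]_(p in cyl T O) (dT H p)%:E
   = \int[mu2]_(x in O) (H (T, x) - H (0%R, x))%:E)%E.
Proof.
move=> T0; rewrite cyl_integral -[LHS]/(\int[_ \x mu2]_p _)%E.
rewrite -(integral21_prod_meas1 (cyl_patch_integrable (cts_dT H))).
rewrite [RHS]integral_mkcond; apply: eq_integral => y _; rewrite /fubini_G /=.
rewrite patchE; case: ifPn => [|/negP]; rewrite inE => Oy; last first.
  by apply: integral0_eq => t _; rewrite patchE memNset // => -[].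
have d (t : R) : 0 < t < T -> is_derive t 1 (fun u => H (u, y)) (dT H (t, y)).
  by move=> tT; apply: is_derive_time; split => //=; rewrite in_itv.
rewrite -(integral_derivative_segment T0 d (cts_time Oy (cts_val H))
  (cts_time Oy (cts_dT H))).
rewrite [RHS]integral_mkcond; apply: eq_integral => t _; rewrite !patchE.
have -> : ((t, y) \in cyl T O) = (t \in `]0, T[%classic).
  apply/idP/idP; rewrite !inE; first by case.
  by split.
by case: ifP.
Qed.
End IBP.

(** * The energy estimate by cut-off at the lateral boundary *)

Section Cutoff.
Variable R : realType.
Implicit Types x y : R.

Definition pos x : R := Num.max x 0.
Definition pos2 x : R := pos x ^+ 2.

Lemma pos_cont : continuous pos.
Proof.
move=> x; apply: continuous_max; first exact: cvg_id.
exact: cvg_cst.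
Qed.

Lemma is_derive_pos2 x : is_derive x 1 pos2 (2 * pos x).
Proof.
apply/is_derive_eps => e e0; exists e => // h he.
have -> : x + h *: 1 = x + h by rewrite [h *: _]mulr1.
suff H : `|pos2 (x + h) - pos2 x - h * (2 * pos x)| <= h ^+ 2.
  apply: (le_trans H); rewrite -(real_normK (num_real h)) expr2.
  by rewrite ler_wpM2r // ltW.
rewrite ler_norml /pos2 /pos /Num.max.
by case: (ltP x 0) => x0; case: (ltP (x + h) 0) => xh; apply/andP; split; nra.
Qed.

(** A C1 step with derivative at most 1: piecewise quadratic, with knots 0, 1, 2. *)
Definition spline x : R := (pos2 x - 2 * pos2 (x - 1) + pos2 (x - 2)) / 2.
Definition spline' x : R := pos x - 2 * pos (x - 1) + pos (x - 2).

Lemma spline'_cont : continuous spline'.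
Proof.
have sh (a : R) : continuous (fun x => pos (x - a)).
  move=> x; apply: (cvg_comp (fun x => x - a) pos); last exact: pos_cont.
  by apply: cvgD; [exact: cvg_id | exact: cvg_cst].
move=> x; apply: cvgD; last exact: sh.
apply: cvgB; first exact: pos_cont.
by apply: cvgM; [exact: cvg_cst | exact: sh].
Qed.

Lemma is_derive_spline x : is_derive x 1 spline (spline' x).
Proof.
have sh (a : R) : is_derive x 1 (fun x => pos2 (x - a)) (2 * pos (x - a)).
  rewrite -[X in is_derive _ _ _ X]mulr1.
  apply: (@is_derive1_comp _ pos2 (fun x => x - a)); first exact: is_derive_pos2.
  have := is_deriveB (is_derive_id x (1:R)) (is_derive_cst a x (1:R)).
  by rewrite subr0.
have h := is_deriveD (is_deriveB (is_derive_pos2 x)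
  (is_derive_mul (is_derive_cst (2 : R) x (1:R)) (sh 1))) (sh 2).
have := is_derive_mul h (is_derive_cst (2^-1 : R) x (1:R)).
rewrite /spline /spline'.
by congr (is_derive _ _ _ _); rewrite /cst /=; field.
Qed.

Lemma spline_le0 x : x <= 0 -> spline x = 0.
Proof.
move=> x0; rewrite /spline /pos2 /pos !max_r //; lra.
Qed.

Lemma spline_ge2 x : 2 <= x -> spline x = 1 /\ spline' x = 0.
Proof.
move=> x2; rewrite /spline /spline' /pos2 /pos !max_l; lra.
Qed.

Lemma spline_bounds x : 0 <= spline x <= 1 /\ 0 <= spline' x <= 1.
Proof.
rewrite /spline /spline' /pos2 /pos /Num.max.
case: (ltP x 0) => h0; case: (ltP (x - 1) 0) => h1; case: (ltP (x - 2) 0) => h2;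
  try lra; split; apply/andP; split; nra.
Qed.

Section Scale.
Variables (e : R) (e0 : 0 < e).
Definition cut y : R := spline (y / e - 1).
Definition cut' y : R := spline' (y / e - 1) / e.

Lemma cut'_cont : continuous cut'.
Proof.
move=> x; apply: cvgM; last exact: cvg_cst.
apply: (cvg_comp (fun y => y / e - 1) spline'); last exact: spline'_cont.
by apply: cvgB; [apply: cvgM; [exact: cvg_id | exact: cvg_cst] | exact: cvg_cst].
Qed.

Lemma is_derive_cut y : is_derive y 1 cut (cut' y).
Proof.
apply: (@is_derive1_comp _ spline (fun y => y / e - 1)); first exact: is_derive_spline.
have := is_deriveB (is_derive_mul (is_derive_id y (1:R)) (is_derive_cst (e^-1 : R) y (1:R)))
  (is_derive_cst (1:R) y (1:R)).
by congr (is_derive _ _ _ _); rewrite /cst /=; ring.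
Qed.

Lemma cut_le y : y <= e -> cut y = 0.
Proof. by move=> ye; apply: spline_le0; rewrite subr_le0 ler_pdivrMr // mul1r. Qed.

Lemma cut_ge y : 3 * e <= y -> cut y = 1 /\ cut' y = 0.
Proof.
move=> ye; have h : 2 <= y / e - 1.
  have h3 : 3 <= y / e by rewrite ler_pdivlMr.
  by move: h3; lra.
by have [] := spline_ge2 h; rewrite /cut /cut' => -> ->; rewrite mul0r.
Qed.

Lemma cut_bounds y : 0 <= cut y <= 1 /\ 0 <= cut' y <= e^-1.
Proof.
have [h1 /andP[h2 h3]] := spline_bounds (y / e - 1); split => //.
by rewrite /cut' divr_ge0 ?(ltW e0) //= -[X in _ <= X]mul1r ler_pM2r ?invr_gt0.
Qed.
End Scale.
End Cutoff.

Section Energy.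
Context {R : realType}.
Let E := (R * (R * R))%type.
Variables (O : set (R * R)) (hO : bounded_domain O) (T : R) (T0 : 0 < T).
Notation mu := (@lebesgue_measure R).
Notation mu2 := (leb2 R).
Notation mu3 := (leb3 R).
Notation I3 f := (\int[mu3]_(p in cyl T O) f p).
Notation I2 f := (\int[mu2]_(x in O) f x).

Let oO : open O. Proof. by have [] := hO. Qed.
Let m3 := measurable_cyl hO T.
Let m2 := measurable_O hO.

Lemma I3D (f g : E -> R) : cts (slab O T) f -> cts (slab O T) g ->
  I3 (fun p => f p + g p) = I3 f + I3 g.
Proof. by move=> cf cg; apply: RintegralD => //; exact: cts_integrable. Qed.

Lemma I3Z (f : E -> R) c : cts (slab O T) f -> I3 (fun p => c * f p) = c * I3 f.
Proof. by move=> cf; apply: RintegralZl => //; exact: cts_integrable. Qed.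

Lemma I3_le (f g : E -> R) : cts (slab O T) f -> cts (slab O T) g ->
  (forall p, cyl T O p -> f p <= g p) -> I3 f <= I3 g.
Proof. by move=> cf cg fg; apply: le_Rintegral => //; exact: cts_integrable. Qed.

Lemma I2B (f g : E -> R) s t : 0 <= s <= T -> 0 <= t <= T ->
  cts (slab O T) f -> cts (slab O T) g ->
  I2 (fun x => f (s, x) - g (t, x)) = I2 (fun x => f (s, x)) - I2 (fun x => g (t, x)).
Proof. by move=> hs ht cf cg; apply: RintegralB => //; exact: (slice_integrable hO _ (T:=T)). Qed.

Lemma I2_le (f g : E -> R) s t : 0 <= s <= T -> 0 <= t <= T ->
  cts (slab O T) f -> cts (slab O T) g ->
  (forall x, O x -> f (s, x) <= g (t, x)) ->
  I2 (fun x => f (s, x)) <= I2 (fun x => g (t, x)).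
Proof. by move=> hs ht cf cg fg; apply: le_Rintegral => //; exact: (slice_integrable hO _ (T:=T)). Qed.

Lemma I3_cvg (f_ : nat -> E -> R) (f : E -> R) M : (forall n, cts (slab O T) (f_ n)) ->
  (forall n p, cyl T O p -> `|f_ n p| <= M) ->
  (forall p, cyl T O p -> f_ n p @[n --> \oo] --> f p) ->
  I3 (f_ n) @[n --> \oo] --> I3 f.
Proof.
move=> cf hM hf; apply: (bounded_cvg m3 (finite_cyl hO T) _ hM hf) => n.
by apply: cts_measurable3 => //; apply: cts_subset (cf n); exact: cyl_slab.
Qed.

Lemma I2_cvg (f_ : nat -> E -> R) (f : E -> R) M t : 0 <= t <= T ->
  (forall n, cts (slab O T) (f_ n)) ->
  (forall n x, O x -> `|f_ n (t, x)| <= M) ->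
  (forall x, O x -> f_ n (t, x) @[n --> \oo] --> f (t, x)) ->
  I2 (fun x => f_ n (t, x)) @[n --> \oo] --> I2 (fun x => f (t, x)).
Proof.
move=> tT cf hM hf.
apply: (bounded_cvg m2 (finite_O hO) _ hM hf) => n.
apply: cts_measurable2 => //; apply: cts_subset (cts_slice tT (cf n)).
exact: subset_closure.
Qed.

Variables (D F1 F2 G : C1fun O T) (L S : E -> R).
Hypotheses (cL : cts (slab O T) L) (cS : cts (slab O T) S).
Hypothesis L0 : forall p, cyl T O p -> 0 <= L p.
Hypothesis S0 : forall p, cyl T O p -> 0 <= S p.
Hypothesis D0 : forall (t : R) (x : R * R), 0 < t < T -> bdry O x -> D (t, x) = 0.
Hypothesis Dpos : forall (t : R) (x : R * R), 0 <= t < T -> O x -> 0 < D (t, x).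
Hypothesis LS : forall p, cyl T O p -> L p + (dX F1 p + dY F2 p - dT G p) <= S p.
Hypothesis G0 : forall x, O x -> 0 <= G (0, x).
Variables (C e0 : R) (C0 : 0 <= C) (e00 : 0 < e0).
Hypothesis strip : forall p, cyl T O p -> D p <= e0 ->
  dX D p * F1 p + dY D p * F2 p - dT D p * G p <= C * D p.

Definition cutoff (e : R) : C1fun O T := C1comp (@cut'_cont R e) (@is_derive_cut R e) D.

Lemma cutoff_lateral (e : R) (F : C1fun O T) (p : E) : 0 < e -> 0 < p.1 < T -> ~ O p.2 ->
  \forall q \near p, cyl T O q -> C1mul (cutoff e) F q = 0.
Proof.
move=> e_gt0 pT nOp.
have z q : D q <= e -> C1mul (cutoff e) F q = 0.
  by move=> De; rewrite /= cut_le // mul0r.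
have [cp|ncp] := pselect (closure O p.2).
- have bp : bdry O p.2 by split => // /interior_subset.
  have Dp : D p = 0 by move: (D0 pT bp); rewrite -surjective_pairing.
  have Sp : slab O T p.
    by split => //=; case/andP: pT => /ltW a /ltW b; rewrite in_itv /= a.
  have /cts_eps /(_ _ e_gt0)[d d0 hd] := cts_val D _ Sp.
  apply/nbhs_ballP; exists d => //= q; rewrite -ball_normE /= distrC => qp Uq.
  apply: z; have := hd q (cyl_slab Uq) qp; rewrite Dp subr0 => h.
  by apply: le_trans (ler_norm _) _; exact: ltW.
- have : \forall q \near p, (~` closure O) q.2.
    have : nbhs p.2 (~` closure O).
      by apply: open_nbhs_nbhs; split => //; apply: closed_openC; exact: closed_closure.
    have sc : (snd : E -> R * R) @ p --> p.2 by exact: cvg_snd.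
    by move=> h; exact: (sc _ h).
  apply: filterS => q nq [_ Oq]; exfalso; apply: nq; exact: subset_closure.
Qed.

Lemma I3_EFin (f : E -> R) (r : R) :
  (\int[mu3]_(p in cyl T O) (f p)%:E = r%:E)%E -> I3 f = r.
Proof. by rewrite /Rintegral => ->. Qed.

(** Multiply the inequality LS by a cut-off of D at height e and integrate. The
derivative of the cut-off lives in e <= D <= 3 e and is at most 1 / e there, while
the flux through the level sets of D is at most C D: the product stays bounded, on
a set that shrinks to nothing. *)
Lemma energy_cutoff (e : R) : 0 < e -> 3 * e <= e0 ->
  I3 (fun p => cutoff e p * L p) + I2 (fun x => cutoff e (0, x) * G (0, x))
  <= I3 S + I2 (fun x => `|G (T, x)|)
     + 3 * C * I3 (fun p => 1 - cutoff (3 * e) p).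
Proof.
move=> e_gt0 ee0; pose X := cutoff e.
have TT : 0 <= T <= T by rewrite lexx ltW.
have OT : 0 <= (0 : R) <= T by rewrite lexx ltW.
have Xb p : 0 <= X p <= 1 by have [] := cut_bounds e_gt0 (D p).
have lat F p := @cutoff_lateral e F p e_gt0.
have ix := I3_EFin (ibp_x hO (lat F1)).
have iy := I3_EFin (ibp_y hO (lat F2)).
have it : I3 (dT (C1mul X G)) = I2 (fun x => X (T, x) * G (T, x))
                               - I2 (fun x => X (0, x) * G (0, x)).
  rewrite /Rintegral (ibp_t hO (C1mul X G) T0).
  by apply: (I2B (f := C1mul X G) (g := C1mul X G)) => //; exact: cts_val.
have cX := cts_val X.
have cXL : cts (slab O T) (fun p => X p * L p) by exact: cts_mul.
have c3 : cts (slab O T) (fun p => 1 - cutoff (3 * e) p).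
  apply: cts_add; first exact: cts_cst.
  by apply: cts_opp; exact: cts_val.
pose V p := - (dX (C1mul X F1) p + dY (C1mul X F2) p - dT (C1mul X G) p).
have c1 := cts_dX (C1mul X F1).
have c2 := cts_dY (C1mul X F2).
have c4 := cts_dT (C1mul X G).
have cV : cts (slab O T) V.
  by apply: cts_opp; apply: cts_add; [exact: cts_add | exact: cts_opp].
have iV : I3 V = I2 (fun x => X (T, x) * G (T, x)) - I2 (fun x => X (0, x) * G (0, x)).
  have -> : V = (fun p => (-1) * (dX (C1mul X F1) p + dY (C1mul X F2) p)
                 + dT (C1mul X G) p).
    by apply/funext => p; rewrite /V; ring.
  rewrite I3D; [|by apply: cts_mul; [exact: cts_cst|exact: cts_add]|exact: c4].
  rewrite I3Z; last exact: cts_add.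
  by rewrite I3D // ix iy it addr0 mulr0 add0r.
have key : I3 (fun p => X p * L p) <= I3 (fun p => S p + (V p
             + 3 * C * (1 - cutoff (3 * e) p))).
  apply: I3_le => //.
    by apply: cts_add => //; apply: cts_add => //; apply: cts_mul => //; exact: cts_cst.
  move=> p Up; have [/andP[X0 X1] /andP[Y0 Y1]] := cut_bounds e_gt0 (D p).
  have XL : X p * (L p + (dX F1 p + dY F2 p - dT G p)) <= S p.
    apply: (@le_trans _ _ (X p * S p)); first by rewrite ler_wpM2l // LS.
    by rewrite ler_piMl // S0.
  pose B := dX D p * F1 p + dY D p * F2 p - dT D p * G p.
  have XB : cut' e (D p) * B <= 3 * C * (1 - cutoff (3 * e) p).
    have [De|De] := leP (3 * e) (D p).
      have [_ ->] := cut_ge e_gt0 De; rewrite mul0r mulr_ge0 ?mulr_ge0 // subr_ge0.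
      have e3 : 0 < 3 * e by rewrite mulr_gt0.
      by have [/andP[]] := cut_bounds e3 (D p).
    have -> : cutoff (3 * e) p = 0 by apply: cut_le; [rewrite mulr_gt0 | exact: ltW].
    rewrite subr0 mulr1.
    have Be : B <= 3 * C * e.
      apply: (le_trans (strip Up _)); first by apply: le_trans ee0; exact: ltW.
      have -> : 3 * C * e = C * (3 * e) by ring.
      by rewrite ler_wpM2l // ltW.
    apply: (@le_trans _ _ (cut' e (D p) * (3 * C * e))); first by rewrite ler_wpM2l.
    have Ce : 0 <= 3 * C * e by rewrite !mulr_ge0 // ltW.
    have := ler_wpM2r Ce Y1; rewrite [e^-1 * _]mulrC.
    by rewrite mulfK // gt_eqF.
  have VE : V p = - (X p * (dX F1 p + dY F2 p - dT G p)) - cut' e (D p) * B.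
    by rewrite /V /B /=; ring.
  rewrite VE; move: XL XB; rewrite mulrDr; move: (X p * L p) (X p * _) (cut' e _ * B).
  by move=> *; lra.
have cK : cts (slab O T) (fun p => 3 * C * (1 - cutoff (3 * e) p)).
  by apply: cts_mul => //; exact: cts_cst.
have key2 := key; rewrite I3D // in key2; last exact: cts_add.
rewrite I3D // in key2; rewrite I3Z // in key2; rewrite iV in key2.
have GT : I2 (fun x => X (T, x) * G (T, x)) <= I2 (fun x => `|G (T, x)|).
  apply: (I2_le (f := C1mul X G) (g := fun p => `|G p|)) => //.
  - exact: cts_val.
  - by apply: cts_comp; [exact: norm_continuous | exact: cts_val].
  - move=> x Ox /=; have /andP[X0 X1] := Xb (T, x).
    apply: (le_trans (ler_norm _)); rewrite normrM ger0_norm //.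
    by rewrite ler_piMl.
by move: key2 GT; rewrite /X; lra.
Qed.

(** Let e tend to 0 in energy_cutoff. A one-sided bound on the flux across the level
sets of D replaces the boundary integral of the divergence theorem. *)
Lemma energy_estimate :
  I3 L + I2 (fun x => G (0, x)) <= I3 S + I2 (fun x => `|G (T, x)|).
Proof.
have OT : 0 <= (0 : R) <= T by rewrite lexx ltW.
pose e (n : nat) : R := (e0 / 9) * n.+1%:R^-1.
have e_gt0 n : 0 < e n by rewrite mulr_gt0 ?divr_gt0 // invr_gt0 ltr0n.
have e3_gt0 n : 0 < 3 * e n by rewrite mulr_gt0.
have e_le n : e n <= e0 / 9.
  apply: ler_piMr; first by rewrite divr_ge0 // ltW.
  by rewrite invf_le1 ?ltr0n // ler1n.
have e_cvg : e n @[n --> \oo] --> (0 : R).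
  rewrite -[X in _ --> X](mulr0 (e0 / 9)).
  by apply: cvgM; [exact: cvg_cst | exact: cvg_harmonic].
have cut1 (k : R) (p : E) : 0 < k -> 0 < D p -> cutoff (k * e n) p @[n --> \oo] --> (1 : R).
  move=> k0 Dp; have k3 : 0 < D p / (3 * k) by rewrite divr_gt0 ?mulr_gt0.
  apply: cvg_near_cst; have /cvgrPdist_lt /(_ _ k3) := e_cvg.
  apply: filterS => n; rewrite sub0r normrN ger0_norm ?ltW // => h.
  have ke : 0 < k * e n by rewrite mulr_gt0.
  apply: (cut_ge ke _).1; move: h; rewrite ltr_pdivlMr ?mulr_gt0 // => h.
  by rewrite mulrA mulrC ltW.
have [ML ML0 hML] := cts_bounded (compact_slab hO (T:=T)) cL.
have [MG MG0 hMG] := cts_bounded (compact_slab hO (T:=T)) (cts_val G).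
have cb n (k : R) p : 0 < k -> `|cutoff (k * e n) p| <= 1.
  move=> k0; have ke : 0 < k * e n by rewrite mulr_gt0.
  by have [/andP[h1 h2] _] := cut_bounds ke (D p); rewrite ger0_norm.
have E1 n : cutoff (e n) = cutoff (1 * e n) by rewrite mul1r.
have lim1 : I3 (fun p => cutoff (e n) p * L p) @[n --> \oo] --> I3 L.
  apply: (@I3_cvg _ _ ML).
  - by move=> n; apply: cts_mul => //; exact: cts_val.
  - move=> n p Up; rewrite normrM -[ML]mul1r E1 ler_pM //; first exact: cb.
    by apply: hML; exact: cyl_slab.
  - move=> p Up; rewrite -[X in _ --> X](mul1r (L p)).
    apply: cvgM; last exact: cvg_cst.
    under eq_fun do rewrite E1; apply: cut1 => //.
    case: p Up => t x [/= ]; rewrite in_itv /= => /andP[t0 tT] Ox.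
    by apply: Dpos => //; rewrite ltW.
have lim2 : I2 (fun x => cutoff (e n) (0, x) * G (0, x)) @[n --> \oo]
            --> I2 (fun x => G (0, x)).
  apply: (@I2_cvg (fun n => C1mul (cutoff (e n)) G) G MG 0) => //.
  - by move=> n; exact: cts_val.
  - move=> n x Ox /=; rewrite normrM -[MG]mul1r.
    rewrite ler_pM //; first by have := cb n 1 (0, x) ltr01; rewrite mul1r.
    by apply: hMG; split => /=; [rewrite in_itv | exact: subset_closure].
  - move=> x Ox; rewrite -[X in _ --> X](mul1r (G (0, x))).
    apply: cvgM; last exact: cvg_cst.
    have OT2 : 0 <= (0 : R) < T by rewrite lexx.
    have := cut1 1 (0, x) ltr01 (Dpos OT2 Ox).
    by under eq_fun do rewrite mul1r.
have lim3 : I3 (fun p => 1 - cutoff (3 * e n) p) @[n --> \oo] --> (0 : R).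
  have -> : (0 : R) = I3 (fun p => 0 * L p) by rewrite I3Z // mul0r.
  apply: (@I3_cvg _ _ 2).
  - move=> n; apply: cts_add; first exact: cts_cst.
    by apply: cts_opp; exact: cts_val.
  - move=> n p Up; apply: (le_trans (ler_normB _ _)).
    by rewrite normr1 lerD2l; apply: cb.
  - move=> p Up; rewrite mul0r -[X in _ --> X](subrr 1).
    apply: cvgB; first exact: cvg_cst.
    apply: cut1 => //.
    case: p Up => t x [/= ]; rewrite in_itv /= => /andP[t0 tT] Ox.
    by apply: Dpos => //; rewrite ltW.
have lhs : I3 (fun p => cutoff (e n) p * L p)
    + I2 (fun x => cutoff (e n) (0, x) * G (0, x)) @[n --> \oo]
    --> I3 L + I2 (fun x => G (0, x)) by apply: cvgD lim1 lim2.
have rhs : I3 S + I2 (fun x => `|G (T, x)|)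
     + 3 * C * I3 (fun p => 1 - cutoff (3 * e n) p) @[n --> \oo]
     --> I3 S + I2 (fun x => `|G (T, x)|) + 3 * C * 0.
  by apply: cvgD; [exact: cvg_cst | apply: cvgM; [exact: cvg_cst | exact: lim3]].
rewrite mulr0 addr0 in rhs.
apply: (ler_cvg_to lhs rhs); apply: nearW => n.
apply: energy_cutoff => //; move: e00 (e_le n) (e_gt0 n); move: (e n) => en; lra.
Qed.

End Energy.

(** * Exit times and derivatives at the boundary *)

Lemma line_xy (R : realType) (t : R) (x : R * R) (a b h : R) :
  ((t, x) : R * (R * R)) + h *: ((0, (a, b)) : R * (R * R)) = (t, x + h *: (a, b)).
Proof.
apply: injective_projections => //.
by change (t + h * 0 = t); ring.
Qed.

(** s is the supremum of the times before which the half-line stays in O; it is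
finite because O is bounded. *)
Lemma exit_time (R : realType) (O : set (R * R)) (x v : R * R) :
  bounded_domain O -> O x -> v != 0 -> exists2 s : R, 0 < s &
    (forall h, 0 <= h < s -> O (x + h *: v)) /\ bdry O (x + s *: v).
Proof.
move=> hO Ox v0; have [oO _ _ [M [_ hM]]] := hO.
pose S := [set s : R | 0 <= s /\ forall h, 0 <= h <= s -> O (x + h *: v)].
have lc (s : R) : (fun h : R => x + h *: v) @ s --> x + s *: v.
  apply: cvgD; first exact: cvg_cst.
  by apply: cvgZr_tmp; exact: cvg_id.
have Sopen (s : R) : O (x + s *: v) -> exists2 r : R, 0 < r &
    forall h, `|h - s| < r -> O (x + h *: v).
  move=> Os; have := lc s O (open_nbhs_nbhs (conj oO Os)).
  move=> /nbhs_ballP[r /= r0 hr]; exists r => // h hs; apply: hr.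
  by rewrite /ball /= distrC.
have S0 : S 0.
  split => // h h0; have -> : h = 0 by apply/eqP; rewrite eq_le andbC.
  by rewrite scale0r addr0.
have nv : 0 < `|v| by rewrite normr_gt0.
have Sub : ubound S ((`|M| + 1 + `|x|) / `|v|).
  move=> s [s0 hs]; rewrite ler_pdivlMr //.
  have M1 : M < `|M| + 1 by rewrite ltr_pwDr // ler_norm.
  have ss : 0 <= s <= s by rewrite s0 lexx.
  have := hM _ M1 _ (hs s ss) => /= h1.
  have -> : s * `|v| = `|x + s *: v - x|.
    by rewrite addrAC subrr add0r normrZ ger0_norm.
  by apply: (le_trans (ler_normB _ _)); rewrite lerD2r.
have hsup : has_sup S by split; [exists 0 | exists ((`|M| + 1 + `|x|) / `|v|)].
pose s := sup S.
have Slt h : 0 <= h -> h < s -> O (x + h *: v).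
  move=> h0 hs; have hh : 0 < s - h by rewrite subr_gt0.
  have [k [k0 Sk]] := sup_adherent hh hsup.
  by rewrite subKr => hk; apply: Sk; rewrite h0 ltW.
have Sle h : S h -> h <= s by exact: sup_upper_bound.
have s0 : 0 < s.
  have [r r0 hr] := Sopen 0 (S0.2 0 (introT andP (conj (lexx 0) (lexx 0)))).
  apply: (@lt_le_trans _ _ (r / 2)); first by rewrite divr_gt0.
  apply: Sle; split; first by rewrite divr_ge0 // ltW.
  move=> h /andP[h0 hr2]; apply: hr; rewrite subr0 ger0_norm //.
  by apply: (le_lt_trans hr2); rewrite ltr_pdivrMr // mulr_natr mulr2n ltrDl.
exists s => //; split; first by move=> h /andP[]; exact: Slt.
split.
- move=> B /(lc s) /nbhs_ballP[r /= r0 hr].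
  pose h := Num.max 0 (s - r / 2).
  have h0 : 0 <= h by rewrite le_max lexx.
  have hs : h < s by rewrite gt_max s0 ltrBlDr ltrDl divr_gt0.
  exists (x + h *: v); split; first exact: Slt.
  apply: hr; rewrite /ball /= ger0_norm ?subr_ge0 ?(ltW hs) //.
  have : s - r / 2 <= h by rewrite le_max lexx orbT.
  lra.
- move/interior_subset => Os; have [r r0 hr] := Sopen s Os.
  suff : s + r / 2 <= s by apply/negP; rewrite -ltNge ltrDl divr_gt0.
  apply: Sle; split; first by rewrite addr_ge0 // ?divr_ge0 // ltW.
  move=> h /andP[h0 hsr]; have [hs|hs] := ltP h s; first exact: Slt.
  by apply: hr; rewrite ger0_norm ?subr_ge0 //; lra.
Qed.

Section Segments.
Context {R : realType}.
Let E := (R * (R * R))%type.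
Variables (O : set (R * R)) (oO : open O) (T : R).

Lemma cts_line (A : set E) (f : E -> R) (p v : E) (h : R) : cts A f ->
  (forall x, 0 <= x <= h -> A (p + x *: v)) ->
  {within `[0, h], continuous (fun x : R => f (p + x *: v))}.
Proof.
move=> cf hA; apply/ctsE => x; rewrite /= in_itv /= => xh.
apply/cts_eps => e e0.
have /cts_eps /(_ _ e0)[d d0 hd] := cf _ (hA x xh).
have v1 : 0 < `|v| + 1 by rewrite ltr_pwDr.
exists (d / (`|v| + 1)); first by rewrite divr_gt0.
move=> y; rewrite /= in_itv /= => yh; rewrite ltr_pdivlMr // => yx.
apply: hd; first exact: hA.
rewrite opprD addrACA subrr add0r -scalerBl normrZ.
by apply: le_lt_trans yx; rewrite ler_wpM2l // lerDl.
Qed.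

Lemma MVT_space (F : C1fun O T) (t : R) (x : R * R) (a b h : R) :
  0 < h -> 0 < t < T -> (forall s, 0 <= s < h -> O (x + s *: (a, b))) ->
  closure O (x + h *: (a, b)) ->
  exists2 s, 0 < s < h & F (t, x + h *: (a, b)) - F (t, x)
    = h * (a * dX F (t, x + s *: (a, b)) + b * dY F (t, x + s *: (a, b))).
Proof.
move=> h0 tT hx hc.
pose p : E := (t, x); pose v : E := (0, (a, b)).
have [||s sh] := @MVT_line _ _ F (fun q => a * dX F q + b * dY F q) p v h h0.
- move=> s /andP[/ltW s0 sh]; rewrite line_xy.
  have Us : cyl T O (t, x + s *: (a, b)).
    by split => /=; [rewrite in_itv | apply: hx; rewrite s0].
  by have := C1_dir oO F 0 a b Us; rewrite mul0r add0r.
- apply: cts_line (cts_val F) _ => s /andP[s0 sh]; rewrite line_xy.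
  split => /=; first by case/andP: tT => /ltW t0 /ltW tT; rewrite in_itv /= t0.
  move: sh; rewrite le_eqVlt => /predU1P[->//|sh].
  by apply: subset_closure; apply: hx; rewrite s0.
- by rewrite !line_xy => e; exists s.
Qed.

Lemma slab_time (t : R) (y : R * R) : 0 < t < T -> closure O y -> slab O T (t, y).
Proof. by move=> /andP[/ltW t0 /ltW tT] Oy; split => //=; rewrite in_itv /= t0. Qed.

(** By is_derive_limit along the time lines through nearby interior points. *)
Lemma is_dT_closure (F : C1fun O T) (t : R) (y : R * R) :
  0 < t < T -> closure O y -> is_derive ((t, y) : E) et F (dT F (t, y)).
Proof.
move=> /andP[t0 tT] Oy.
have d0 : 0 < Num.min t (T - t) by rewrite lt_min t0 subr_gt0.
have hd (h : R) : `|h| < Num.min t (T - t) -> 0 < t + h < T.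
  rewrite lt_min => /andP[]; rewrite !ltr_norml => /andP[h1 h2] /andP[h3 h4].
  by apply/andP; split; lra.
have lt (h : R) (z : R * R) : ((t, z) : E) + h *: et = (t + h, z).
  apply: injective_projections; last apply: injective_projections.
  - by change (t + h * 1 = t + h); ring.
  - by change (z.1 + h * 0 = z.1); ring.
  - by change (z.2 + h * 0 = z.2); ring.
have St : slab O T (t, y) by apply: slab_time; rewrite ?t0.
apply: (is_derive_limit d0 (cts_val F) St (cts_dT F _ St)).
- by move=> h hh; rewrite lt; apply: slab_time => //; exact: hd.
- move=> e e0; have := Oy (ball y e) (nbhsx_ballx y e e0).
  move=> [x [Ox yx]]; exists ((0, x - y) : E).
    change (Num.max `|0 : R| `|x - y| < e).
    by rewrite normr0 gt_max e0 /= distrC; move: yx; rewrite -ball_normE.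
  move=> h hh; have -> : ((t, y) : E) + (0, x - y) = (t, x).
    apply: injective_projections; first by change (t + 0 = t); rewrite addr0.
    by change (y + (x - y) = x); rewrite addrC subrK.
  rewrite lt; have Ut : cyl T O (t + h, x).
    by split => //=; rewrite in_itv /=; exact: hd.
  by split; [exact: cyl_slab | exact: is_dT].
Qed.

(** The point (0, x) is a limit of the interior points (t, x), so is_derive_limit
applies to the space directions. *)
Lemma is_dXY_time (F : C1fun O T) (t : R) (x : R * R) :
  0 <= t < T -> O x -> is_derive ((t, x) : E) ex F (dX F (t, x)) /\
     is_derive ((t, x) : E) ey F (dY F (t, x)).
Proof.
move=> /andP[t0 tT] Ox.
have [r r0 hr] : exists2 r : R, 0 < r & ball x r `<=` O.
  have /nbhs_ballP[r /= r0 hr] : nbhs x O by apply: open_nbhs_nbhs.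
  by exists r.
have lx (s h : R) : ((s, x) : E) + h *: ex = (s, x + h *: (1, 0)) by rewrite line_xy.
have ly (s h : R) : ((s, x) : E) + h *: ey = (s, x + h *: (0, 1)) by rewrite line_xy.
have hx (h : R) : `|h| < r -> O (x + h *: (1, 0)).
  move=> hh; apply: hr; rewrite -ball_normE /= opprD addrA subrr add0r normrN normrZ.
  change (`|h| * Num.max `|1 : R| `|0 : R| < r).
  by rewrite normr1 normr0 max_l // mulr1.
have hy (h : R) : `|h| < r -> O (x + h *: (0, 1)).
  move=> hh; apply: hr; rewrite -ball_normE /= opprD addrA subrr add0r normrN normrZ.
  change (`|h| * Num.max `|0 : R| `|1 : R| < r).
  by rewrite normr1 normr0 max_r // mulr1.
have T0 : 0 <= t <= T by rewrite t0 ltW.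
have Sl (y : R * R) : O y -> slab O T (t, y).
  by move=> Oy; split => /=; [rewrite in_itv | exact: subset_closure].
have St := Sl x Ox.
have pert (e : R) : 0 < e -> exists2 s : R, 0 < s < T & `|s - t| < e.
  move=> e0; have [h|h] := ltP (t + e / 2) ((t + T) / 2).
  - exists (t + e / 2); first by apply/andP; split; lra.
    by rewrite ltr_norml; apply/andP; split; lra.
  - exists ((t + T) / 2); first by apply/andP; split; lra.
    by rewrite ltr_norml; apply/andP; split; lra.
have kE (s : R) : ((t, x) : E) + (s - t, 0) = (s, x).
  apply: injective_projections; first by change (t + (s - t) = s); ring.
  by change (x + 0 = x); rewrite addr0.
have kN (s e : R) : 0 < e -> `|s - t| < e -> `|(s - t, 0) : E| < e.
  by move=> e0 h; change (Num.max `|s - t| `|0 : R * R| < e); rewrite normr0 gt_max h.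
split.
- apply: (is_derive_limit r0 (cts_val F) St (cts_dX F _ St)).
    by move=> h hh; rewrite lx; apply: Sl; exact: hx.
  move=> e e0; have [s sT se] := pert e e0; exists (s - t, 0); first exact: kN.
  move=> h hh; rewrite kE lx.
  have Us : cyl T O (s, x + h *: (1, 0)) by split => /=; [rewrite in_itv | exact: hx].
  by split; [exact: cyl_slab | exact: is_dX].
- apply: (is_derive_limit r0 (cts_val F) St (cts_dY F _ St)).
    by move=> h hh; rewrite ly; apply: Sl; exact: hy.
  move=> e e0; have [s sT se] := pert e e0; exists (s - t, 0); first exact: kN.
  move=> h hh; rewrite kE ly.
  have Us : cyl T O (s, x + h *: (0, 1)) by split => /=; [rewrite in_itv | exact: hy].
  by split; [exact: cyl_slab | exact: is_dY].
Qed.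

End Segments.

Lemma is_derive_min (R : realType) (V : normedModType R) (f : V -> R) (p v : V) (c r : R) :
  0 < r -> is_derive p v f c ->
  (forall h, `|h| < r -> f p <= f (p + h *: v)) -> c = 0.
Proof.
move=> r0 /is_derive_eps hc hm; apply/eqP; rewrite -normr_le0.
apply/ler_addgt0Pr => e e0; rewrite add0r.
have [s s0 hs] := hc _ e0.
pose h := Num.min r s / 2.
have h0 : 0 < h by rewrite divr_gt0 // lt_min r0.
have hlt : h < Num.min r s.
  by rewrite /h ltr_pdivrMr // mulr_natr mulr2n ltrDl lt_min r0.
move: hlt; rewrite lt_min => /andP[hr hs'].
have nh : `|h| = h by rewrite ger0_norm // ltW.
have h1 : `|h| < r by rewrite nh.
have h2 : `|h| < s by rewrite nh.
have h3 : `|- h| < r by rewrite normrN.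
have h4 : `|- h| < s by rewrite normrN.
have m1 := hm _ h1; have m2 := hm _ h3.
have := hs _ h2; have := hs _ h4; rewrite normrN nh !ler_norml.
move=> /andP[a1 a2] /andP[b1 b2].
by apply/andP; split; rewrite -(ler_pM2l h0); lra.
Qed.

(** * Vanishing rates near the lateral boundary *)

Section Layer.
Context {R : realType}.
Let E := (R * (R * R))%type.
Variables (O : set (R * R)) (hO : bounded_domain O) (T : R).
Let oO : open O. Proof. by have [] := hO. Qed.

Definition grad_le (F : C1fun O T) (K : R) :=
  forall p, cyl T O p -> `|dX F p| <= K /\ `|dY F p| <= K.

Lemma grad_le_exists (F : C1fun O T) : exists2 K : R, 0 < K & grad_le F K.
Proof.
have [K1 K10 h1] := cts_bounded (compact_slab hO (T:=T)) (cts_dX F).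
have [K2 K20 h2] := cts_bounded (compact_slab hO (T:=T)) (cts_dY F).
exists (K1 + K2); first by rewrite addr_gt0.
move=> p /cyl_slab Sp; have := h1 p Sp; have := h2 p Sp; lra.
Qed.

Lemma space_lipschitz (F : C1fun O T) (K : R) (t : R) (x : R * R) (a b h : R) :
  0 <= K -> grad_le F K -> 0 <= h -> 0 < t < T ->
  (forall s, 0 <= s < h -> O (x + s *: (a, b))) ->
  closure O (x + h *: (a, b)) ->
  `|F (t, x + h *: (a, b)) - F (t, x)| <= h * ((`|a| + `|b|) * K).
Proof.
move=> K0 FK; rewrite le_eqVlt => /predU1P[<-|h0] tT hx hc.
  by rewrite scale0r addr0 subrr normr0 mul0r.
have [s /andP[/ltW s0 sh] ->] := MVT_space oO F h0 tT hx hc.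
have [|h1 h2] := FK (t, x + s *: (a, b)).
  by split => /=; [rewrite in_itv | apply: hx; rewrite s0].
rewrite normrM (ger0_norm (ltW h0)) ler_wpM2l ?(ltW h0) // mulrDl.
by apply: (le_trans (ler_normD _ _)); rewrite !normrM lerD // ler_wpM2l.
Qed.

Lemma sqr_normD_le (x y : R) : (`|x| + `|y|) ^+ 2 <= 2 * (x ^+ 2 + y ^+ 2).
Proof.
rewrite -[in X in _ <= X](real_normK (num_real x)) -[in X in _ <= X](real_normK (num_real y)).
by have := sqr_ge0 (`|x| - `|y|); lra.
Qed.

(** Second order expansion in space; the constant 2 accounts for the two components
of the direction. *)
Lemma space_taylor (Psi : C2fun O T) (M : R) (t : R) (x : R * R) (u v h : R) :
  0 < M -> grad_le (cx Psi) M -> grad_le (cy Psi) M ->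
  0 < t < T -> O x -> 0 < h ->
  (forall s, 0 <= s < h -> O (x + s *: (u, v))) -> closure O (x + h *: (u, v)) ->
  `|Psi (t, x + h *: (u, v)) - Psi (t, x)
     - h * (u * cx Psi (t, x) + v * cy Psi (t, x))| <= h ^+ 2 * (2 * M * (u ^+ 2 + v ^+ 2)).
Proof.
move=> M0 PxM PyM tT Ox h0 hx hc.
have [s /andP[s0 sh] ->] := MVT_space oO Psi h0 tT hx hc.
rewrite dX_c0 dY_c0 -mulrBr normrM (ger0_norm (ltW h0)) expr2 -mulrA.
rewrite ler_wpM2l ?(ltW h0) //.
have hs s' : 0 <= s' < s -> O (x + s' *: (u, v)).
  by case/andP=> s'0 s's; apply: hx; rewrite s'0 (lt_trans s's).
have hcs : closure O (x + s *: (u, v)).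
  by apply: subset_closure; apply: hx; rewrite (ltW s0).
have l1 := space_lipschitz (ltW M0) PxM (ltW s0) tT hs hcs.
have l2 := space_lipschitz (ltW M0) PyM (ltW s0) tT hs hcs.
move: l1 l2; move: (cx Psi (t, x + s *: (u, v))) (cy Psi (t, x + s *: (u, v))).
move=> c1 c2 l1 l2.
have -> : u * c1 + v * c2 - (u * cx Psi (t, x) + v * cy Psi (t, x))
  = u * (c1 - cx Psi (t, x)) + v * (c2 - cy Psi (t, x)) by ring.
have uvM : 0 <= (`|u| + `|v|) * M by rewrite mulr_ge0 // ?addr_ge0 // ltW.
apply: (@le_trans _ _ (s * ((`|u| + `|v|) ^+ 2 * M))).
  have -> : s * ((`|u| + `|v|) ^+ 2 * M) = `|u| * (s * ((`|u| + `|v|) * M))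
     + `|v| * (s * ((`|u| + `|v|) * M)) by ring.
  by apply: (le_trans (ler_normD _ _)); rewrite !normrM lerD // ler_wpM2l.
apply: (@le_trans _ _ (s * (2 * (u ^+ 2 + v ^+ 2) * M))).
  by rewrite ler_wpM2l ?(ltW s0) // ler_wpM2r ?(ltW M0) // sqr_normD_le.
rewrite [2 * (_ + _) * M]mulrAC [X in X <= _]mulrC [X in _ <= X]mulrC.
by apply: ler_wpM2l (ltW sh); rewrite !mulr_ge0 ?(ltW M0) // addr_ge0 ?sqr_ge0.
Qed.

Variables (Psi : C2fun O T) (b : R -> R) (alpha : R).
Hypothesis a0 : 0 < alpha.
Hypothesis Psi_bdry : forall (t : R) (y : R * R), 0 < t < T -> bdry O y -> Psi (t, y) = b t.
Hypothesis Psi_min : forall (t : R) (x : R * R), 0 < t < T -> O x -> b t <= Psi (t, x).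

Let d (p : E) := Psi p - b p.1.
Let n2 (p : E) := cx Psi p ^+ 2 + cy Psi p ^+ 2.

Variables (K M : R).
Hypotheses (K0 : 0 < K) (M0 : 0 < M).
Hypothesis PsiK : forall p, cyl T O p -> `|cx Psi p| <= K /\ `|cy Psi p| <= K.
Hypotheses (PxM : grad_le (cx Psi) M) (PyM : grad_le (cy Psi) M).

(** A step 1 / (4 M) along - grad Psi lowers Psi by at least alpha^2 / (8 M): starting
from a height below half of that, the boundary is met before the end of the step. *)
Definition layer_eps := alpha ^+ 2 / (16 * M).

(** Where grad Psi does not vanish, Psi decreases along - grad Psi at a definite rate
as long as the step is short compared with the second derivatives. As Psi cannot go
below its boundary value, the boundary must be met at a distance O(d). *)
Lemma descent (t : R) (x : R * R) : 0 < t < T -> O x ->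
  alpha ^+ 2 <= n2 (t, x) -> d (t, x) <= layer_eps ->
  let v := (- cx Psi (t, x), - cy Psi (t, x)) in
  exists2 s : R, 0 < s & [/\ forall h, 0 <= h < s -> O (x + h *: v),
    bdry O (x + s *: v) & s * alpha ^+ 2 <= 2 * d (t, x)].
Proof.
move=> tT Ox an dx v.
have a20 : 0 < alpha ^+ 2 by rewrite exprn_gt0.
have n20 : 0 < n2 (t, x) by apply: lt_le_trans an.
have v0 : v != 0.
  apply/eqP => v0; move: n20; rewrite /n2.
  have /(congr1 fst) /= e1 := v0; have /(congr1 snd) /= e2 := v0.
  move/eqP: e1; rewrite oppr_eq0 => /eqP ->; move/eqP: e2; rewrite oppr_eq0 => /eqP ->.
  by rewrite expr0n /= addr0 ltxx.
have [s s0 [hs bs]] := exit_time hO Ox v0.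
have step (h : R) : 0 < h -> h <= (4 * M)^-1 -> h <= s ->
    closure O (x + h *: v) -> Psi (t, x + h *: v) <= Psi (t, x) - h * n2 (t, x) / 2.
  move=> h0 hM hhs hc.
  have hx k : 0 <= k < h -> O (x + k *: v).
    by case/andP=> k0 kh; apply: hs; rewrite k0 (lt_le_trans kh).
  have uv : (- cx Psi (t, x)) ^+ 2 + (- cy Psi (t, x)) ^+ 2 = n2 (t, x).
    by rewrite !sqrrN.
  have := space_taylor M0 PxM PyM tT Ox h0 hx hc; rewrite uv.
  have -> : - cx Psi (t, x) * cx Psi (t, x) + - cy Psi (t, x) * cy Psi (t, x)
          = - n2 (t, x) by rewrite /n2; ring.
  rewrite ler_norml => /andP[_].
  have : h ^+ 2 * (2 * M * n2 (t, x)) <= h * n2 (t, x) / 2.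
    have -> : h ^+ 2 * (2 * M * n2 (t, x)) = (h * (4 * M)) * (h * n2 (t, x) / 2) by field.
    apply: ler_piMl; first by rewrite divr_ge0 // mulr_ge0 // ltW.
    have M4 : 0 < 4 * M by rewrite mulr_gt0.
    have := ler_wpM2r (ltW M4) hM; rewrite mulVf //; exact: lt0r_neq0.
  lra.
have M40 : 0 < (4 * M)^-1 by rewrite invr_gt0 mulr_gt0.
exists s => //; split => //.
have [sM|sM] := leP s (4 * M)^-1.
- have := step s s0 sM (lexx s) bs.1; rewrite (Psi_bdry tT bs) /d /=.
  have : s * alpha ^+ 2 <= s * n2 (t, x) by rewrite ler_wpM2l // ltW.
  lra.
- have Oh : O (x + (4 * M)^-1 *: v) by apply: hs; rewrite ltW.
  have := step _ M40 (lexx _) (ltW sM) (subset_closure Oh).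
  have := Psi_min tT Oh.
  have : (4 * M)^-1 * alpha ^+ 2 <= (4 * M)^-1 * n2 (t, x) by rewrite ler_wpM2l // ltW.
  move: dx; rewrite /d /layer_eps /=.
  have -> : alpha ^+ 2 / (16 * M) = (4 * M)^-1 * alpha ^+ 2 / 4.
    by field; rewrite gt_eqF.
  have : 0 < (4 * M)^-1 * alpha ^+ 2 by rewrite mulr_gt0.
  lra.
Qed.

Lemma layer_pos (t : R) (x : R * R) : 0 < t < T -> O x ->
  alpha ^+ 2 <= n2 (t, x) -> d (t, x) <= layer_eps -> 0 < d (t, x).
Proof.
move=> tT Ox an dx; have [s s0 [_ _ h]] := descent tT Ox an dx.
have : 0 < s * alpha ^+ 2 by rewrite mulr_gt0 // exprn_gt0.
lra.
Qed.

(** Integrate the gradient of F along the segment given by descent. *)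
Lemma layer_vanish (F : C1fun O T) (KF : R) : 0 < KF -> grad_le F KF ->
  (forall (t : R) (y : R * R), 0 < t < T -> bdry O y -> F (t, y) = 0) ->
  forall (t : R) (x : R * R), 0 < t < T -> O x -> alpha ^+ 2 <= n2 (t, x) ->
   d (t, x) <= layer_eps -> `|F (t, x)| <= 4 * K * KF / alpha ^+ 2 * d (t, x).
Proof.
move=> KF0 FK F0 t x tT Ox an dx.
have a20 : 0 < alpha ^+ 2 by rewrite exprn_gt0.
have [s s0 [hs bs sd]] := descent tT Ox an dx.
have := space_lipschitz (ltW KF0) FK (ltW s0) tT hs bs.1.
rewrite (F0 _ _ tT bs) sub0r !normrN => h; apply: (le_trans h).
have [k1 k2] : `|cx Psi (t, x)| <= K /\ `|cy Psi (t, x)| <= K.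
  by apply: PsiK; split => //=; rewrite in_itv.
have s2 : s <= 2 * d (t, x) / alpha ^+ 2 by rewrite ler_pdivlMr.
apply: (@le_trans _ _ (s * (2 * K * KF))).
  by rewrite ler_wpM2l ?(ltW s0) // ler_wpM2r ?(ltW KF0) //; lra.
have KK : 0 <= 2 * K * KF by rewrite !mulr_ge0 // ltW.
apply: (le_trans (ler_wpM2r KK s2)).
by have -> : 2 * d (t, x) / alpha ^+ 2 * (2 * K * KF)
  = 4 * K * KF / alpha ^+ 2 * d (t, x) by ring.
Qed.

End Layer.

Section Tangential.
Context {R : realType}.
Let E := (R * (R * R))%type.
Variables (O : set (R * R)) (hO : bounded_domain O) (T : R).
Variables (Psi : C2fun O T) (b : R -> R) (alpha : R) (a0 : 0 < alpha).
Hypothesis Psi_bdry : forall (t : R) (y : R * R), 0 < t < T -> bdry O y -> Psi (t, y) = b t.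
Hypothesis Psi_min : forall (t : R) (x : R * R), 0 < t < T -> O x -> b t <= Psi (t, x).
Let d (p : E) := Psi p - b p.1.
Let n2 (p : E) := cx Psi p ^+ 2 + cy Psi p ^+ 2.

Lemma gradient_bounds : exists K M : R, [/\ 0 < K, 0 < M,
  (forall p, cyl T O p -> `|cx Psi p| <= K /\ `|cy Psi p| <= K),
  grad_le (cx Psi) M & grad_le (cy Psi) M].
Proof.
have [K K0 hK] := grad_le_exists hO Psi.
have [M1 M10 h1] := grad_le_exists hO (cx Psi).
have [M2 M20 h2] := grad_le_exists hO (cy Psi).
exists K, (M1 + M2); split => //; first by rewrite addr_gt0.
- by move=> p Up; have := hK p Up; rewrite dX_c0 dY_c0.
- by move=> p Up; have := h1 p Up; lra.
- by move=> p Up; have := h2 p Up; lra.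
Qed.

Lemma vanish_bound (F : C1fun O T) :
  (forall (t : R) (y : R * R), 0 < t < T -> bdry O y -> F (t, y) = 0) ->
  exists C e : R, [/\ 0 < C, 0 < e & forall (t : R) (x : R * R), 0 < t < T -> O x ->
   alpha ^+ 2 <= n2 (t, x) -> d (t, x) <= e -> `|F (t, x)| <= C * d (t, x)].
Proof.
move=> F0; have [K [M [K0 M0 PK P1 P2]]] := gradient_bounds.
have [KF KF0 hF] := grad_le_exists hO F.
have a20 : 0 < alpha ^+ 2 by rewrite exprn_gt0.
exists (4 * K * KF / alpha ^+ 2), (layer_eps alpha M); split.
- by rewrite divr_gt0 // !mulr_gt0.
- by rewrite divr_gt0 // mulr_gt0.
- exact: (layer_vanish hO a0 Psi_bdry Psi_min K0 M0 PK P1 P2 KF0 hF F0).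
Qed.

Lemma positive_bound : exists2 e : R, 0 < e &
  forall (t : R) (x : R * R), 0 < t < T -> O x -> alpha ^+ 2 <= n2 (t, x) ->
   d (t, x) <= e -> 0 < d (t, x).
Proof.
have [K [M [K0 M0 PK P1 P2]]] := gradient_bounds.
exists (layer_eps alpha M); first by rewrite divr_gt0 ?exprn_gt0 // mulr_gt0.
by move=> t x tT Ox an dx; apply: (layer_pos hO a0 Psi_bdry Psi_min M0 P1 P2).
Qed.
End Tangential.

Section Tangential2.
Context {R : realType}.
Let E := (R * (R * R))%type.
Variables (O : set (R * R)) (hO : bounded_domain O) (T : R).
Variables (Psi : C2fun O T) (b : R -> R) (alpha : R) (a0 : 0 < alpha).
Hypothesis Psi_bdry : forall (t : R) (y : R * R), 0 < t < T -> bdry O y -> Psi (t, y) = b t.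
Hypothesis Psi_min : forall (t : R) (x : R * R), 0 < t < T -> O x -> b t <= Psi (t, x).
Let d (p : E) := Psi p - b p.1.
Let n2 (p : E) := cx Psi p ^+ 2 + cy Psi p ^+ 2.

(** Let h be the derivative of F in the direction v orthogonal to grad Psi. Moving by
l along v changes Psi by O(l^2), so for l = sqrt (d / q) the new point still lies in
the domain, at a height comparable with d. There F is O(d) at both ends, hence
l h = O(d) + O(l^2) by Taylor, that is h = O(sqrt d). *)
Lemma tangential_bound (F : C2fun O T) :
  (forall (t : R) (y : R * R), 0 < t < T -> bdry O y -> F (t, y) = 0) ->
  exists C e : R, [/\ 0 < C, 0 < e & forall (t : R) (x : R * R), 0 < t < T -> O x ->
   alpha ^+ 2 <= n2 (t, x) -> d (t, x) <= e ->
   (cx Psi (t, x) * cy F (t, x) - cy Psi (t, x) * cx F (t, x)) ^+ 2 <= C * d (t, x)].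
Proof.
move=> F0; have [K [M [K0 M0 PK P1 P2]]] := gradient_bounds hO Psi.
have [K' [M2 [_ M20 _ F1 F2]]] := gradient_bounds hO F.
have ah : 0 < alpha / 2 by rewrite divr_gt0.
have [CF [e1 [CF0 e10 hF]]] := vanish_bound hO ah Psi_bdry Psi_min F0.
have [e2 e20 hpos] := positive_bound hO a0 Psi_bdry Psi_min.
have a20 : 0 < alpha ^+ 2 by rewrite exprn_gt0.
pose q := 8 * M * K ^+ 2.
have q0 : 0 < q by rewrite !mulr_gt0 // exprn_gt0.
pose l0 := alpha ^+ 2 / (16 * K ^+ 2 * M).
have l00 : 0 < l0 by rewrite divr_gt0 // !mulr_gt0 // exprn_gt0.
pose A := (5 / 2) * CF * q + 4 * M2 * K ^+ 2.
have A0 : 0 < A by rewrite addr_gt0 // !mulr_gt0 // ?exprn_gt0 // divr_gt0.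
exists (A ^+ 2 / q), (Num.min (e1 / 2) (Num.min e2 (q * l0 ^+ 2))).
split; first by rewrite divr_gt0 ?exprn_gt0.
  by rewrite !lt_min e20 divr_gt0 //= mulr_gt0 // exprn_gt0.
move=> t x tT Ox an; rewrite !le_min => /and3P[de1 de2 de3].
have dpos : 0 < d (t, x) by exact: hpos.
have Up : cyl T O (t, x) by split => //=; rewrite in_itv.
have [k1 k2] := PK _ Up.
pose l := Num.sqrt (d (t, x) / q).
have l2 : l ^+ 2 = d (t, x) / q by rewrite sqr_sqrtr // divr_ge0 // ltW.
have dE : d (t, x) = q * l ^+ 2 by rewrite l2 mulrC divfK // gt_eqF.
have lpos : 0 < l by rewrite sqrtr_gt0 divr_gt0.
have ll0 : l <= l0.
  rewrite -(@ler_pXn2r _ 2) ?nnegrE ?(ltW l00) ?(ltW lpos) // l2.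
  by rewrite ler_pdivrMr // mulrC.
set p1 := cx Psi (t, x) in k1 *; set p2 := cy Psi (t, x) in k2 *.
have n2K : p1 ^+ 2 + p2 ^+ 2 <= 2 * K ^+ 2.
  have sq (y : R) : `|y| <= K -> y ^+ 2 <= K ^+ 2.
    by move=> yK; rewrite -(real_normK (num_real y)) lerXn2r ?nnegrE ?(ltW K0).
  by have := sq _ k1; have := sq _ k2; lra.
pose v : R * R := (- p2, p1).
have vn : (- p2) ^+ 2 + p1 ^+ 2 = p1 ^+ 2 + p2 ^+ 2 by ring.
have v0 : v != 0.
  apply/eqP => v0; have := lt_le_trans a20 an; rewrite /n2 -/p1 -/p2.
  have /(congr1 fst) /= e3 := v0; have /(congr1 snd) /= e4 := v0.
  move/eqP: e3; rewrite oppr_eq0 => /eqP ->; rewrite e4.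
  by rewrite expr0n /= addr0 ltxx.
have [s s0 [hs bs]] := exit_time hO Ox v0.
have step (h : R) : 0 < h -> h <= l -> h <= s -> closure O (x + h *: v) ->
   `|Psi (t, x + h *: v) - Psi (t, x)| <= d (t, x) / 2.
  move=> h0 hl hhs hc.
  have hx k : 0 <= k < h -> O (x + k *: v).
    by case/andP=> k0 kh; apply: hs; rewrite k0 (lt_le_trans kh).
  have := space_taylor hO M0 P1 P2 tT Ox h0 hx hc.
  rewrite -/p1 -/p2 (_ : - p2 * p1 + p1 * p2 = 0) ?mulr0 ?subr0; last by ring.
  move=> h1; apply: (le_trans h1).
  have hl2 : h ^+ 2 <= l ^+ 2 by rewrite lerXn2r ?nnegrE // ltW.
  have -> : d (t, x) / 2 = l ^+ 2 * (2 * M * (2 * K ^+ 2)) by rewrite dE /q; field.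
  apply: ler_pM => //; first exact: sqr_ge0.
    by rewrite mulr_ge0 ?addr_ge0 ?sqr_ge0 // mulr_ge0 // ltW.
  by rewrite vn ler_wpM2l // mulr_ge0 // ltW.
(* at an exit point Psi would drop by d, more than the d / 2 allowed by step *)
have ls : l < s.
  rewrite ltNge; apply/negP => sl.
  have := step s s0 sl (lexx s) bs.1; rewrite (Psi_bdry tT bs).
  have -> : b t - Psi (t, x) = - d (t, x) by rewrite /d /=; ring.
  by rewrite normrN ger0_norm ?(ltW dpos) //; lra.
have Oz : O (x + l *: v) by apply: hs; rewrite (ltW lpos).
have hx k : 0 <= k < l -> O (x + k *: v).
  by case/andP=> k0 kl; apply: hs; rewrite k0 (lt_trans kl).
have cz := subset_closure Oz.
have dz : d (t, x + l *: v) <= 3 / 2 * d (t, x).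
  have := step l lpos (lexx l) (ltW ls) cz; rewrite ler_norml => /andP[_].
  by rewrite /d /=; lra.
have n2z : (alpha / 2) ^+ 2 <= n2 (t, x + l *: v).
  have g1 := space_lipschitz hO (ltW M0) P1 (ltW lpos) tT hx cz.
  have g2 := space_lipschitz hO (ltW M0) P2 (ltW lpos) tT hx cz.
  rewrite -/p1 in g1; rewrite -/p2 in g2.
  have b1 : l * ((`|- p2| + `|p1|) * M) <= alpha ^+ 2 / (8 * K).
    apply: (@le_trans _ _ (l0 * ((K + K) * M))).
      apply: ler_pM => //; [exact: ltW|by rewrite mulr_ge0 ?addr_ge0 // ltW|].
      by rewrite ler_wpM2r ?(ltW M0) // normrN lerD.
    by rewrite /l0 le_eqVlt; apply/orP; left; apply/eqP; field; rewrite ?gt_eqF.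
  have := le_trans g1 b1; have := le_trans g2 b1.
  move: an; rewrite /n2 -/p1 -/p2.
  move: (cx Psi (t, x + l *: v)) (cy Psi (t, x + l *: v)) => c1 c2 an i2 i1.
  have j (y z : R) : `|y| <= K -> `|z - y| <= alpha ^+ 2 / (8 * K) ->
     y ^+ 2 - alpha ^+ 2 / 4 <= z ^+ 2.
    move=> yK zy; have := sqr_ge0 (z - y).
    have : `|y * (z - y)| <= K * (alpha ^+ 2 / (8 * K)) by rewrite normrM ler_pM.
    have -> : K * (alpha ^+ 2 / (8 * K)) = alpha ^+ 2 / 8 by field; rewrite gt_eqF.
    by rewrite ler_norml => /andP[]; lra.
  have := j _ _ k1 i1; have := j _ _ k2 i2.
  have -> : (alpha / 2) ^+ 2 = alpha ^+ 2 / 4 by field.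
  lra.
have ax : (alpha / 2) ^+ 2 <= n2 (t, x).
  have -> : (alpha / 2) ^+ 2 = alpha ^+ 2 / 4 by field.
  by move: an; lra.
have f1 := hF _ _ tT Ox ax (le_trans de1 (_ : e1 / 2 <= e1)).
have f2 := hF _ _ tT Oz n2z (_ : _ <= e1).
have {}f1 : `|F (t, x)| <= CF * d (t, x) by apply: f1; lra.
have {}f2 : `|F (t, x + l *: v)| <= CF * (3 / 2 * d (t, x)).
  apply: le_trans (f2 _) _; last by rewrite ler_wpM2l // ltW.
  by apply: (le_trans dz); move: de1; lra.
have := space_taylor hO M20 F1 F2 tT Ox lpos hx cz.
set h := p1 * _ - _.
rewrite vn (_ : - p2 * cx F (t, x) + p1 * cy F (t, x) = h); last by rewrite /h; ring.
move=> f3.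
have f4 : l ^+ 2 * (2 * M2 * (p1 ^+ 2 + p2 ^+ 2)) <= l ^+ 2 * (4 * M2 * K ^+ 2).
  rewrite ler_wpM2l ?sqr_ge0 //.
  have -> : 4 * M2 * K ^+ 2 = 2 * M2 * (2 * K ^+ 2) by ring.
  by rewrite ler_wpM2l // mulr_ge0 // ltW.
have lh : `|l * h| <= l * (l * A).
  have -> : l * (l * A) = CF * (3 / 2 * d (t, x)) + CF * d (t, x) + l ^+ 2 * (4 * M2 * K ^+ 2).
    by rewrite dE /A; field.
  have -> : l * h = F (t, x + l *: v) - F (t, x)
     - (F (t, x + l *: v) - F (t, x) - l * h) by ring.
  apply: (le_trans (ler_normB _ _)); apply: lerD; last exact: le_trans f4.
  by apply: (le_trans (ler_normB _ _)); apply: lerD.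
have hA : `|h| <= l * A.
  by move: lh; rewrite normrM (ger0_norm (ltW lpos)) ler_pM2l.
rewrite -(real_normK (num_real h)).
apply: (@le_trans _ _ ((l * A) ^+ 2)).
  by rewrite lerXn2r ?nnegrE // mulr_ge0 // ltW.
by rewrite exprMn l2 le_eqVlt; apply/orP; left; apply/eqP; ring.
Qed.
End Tangential2.

(** * A boundary layer function *)

Section Bump.
Context {R : realType}.
Let E := (R * (R * R))%type.
Variables (O : set (R * R)) (T : R).

Lemma is_derive_linear (f : E -> R) (p v : E) :
  (forall (q : E) (h : R), f (p + h *: q) = f p + h * f q) -> is_derive p v f (f v).
Proof.
move=> hf; apply/is_derive_eps => e e0; exists 1 => // h _.
rewrite hf (_ : f p + h * f v - f p - h * f v = 0); last by ring.
by rewrite normr0 mulr_ge0 // ltW.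
Qed.

Definition C1linear (f : E -> R) (cf : cts (slab O T) f)
  (lf : forall (p q : E) (h : R), f (p + h *: q) = f p + h * f q) : C1fun O T.
Proof.
apply: (@MkC1 R O T f (fun=> f et) (fun=> f ex) (fun=> f ey)) => //;
  do ?exact: cts_cst.
all: by move=> p _; exact: is_derive_linear.
Defined.

Definition coordT : C1fun O T.
Proof.
apply: (@C1linear (fun p => p.1)) => //.
by move=> p _; apply: cvg_within_filter; exact: cvg_fst.
Defined.

Definition coordX : C1fun O T.
Proof.
apply: (@C1linear (fun p => p.2.1)) => //.
move=> p _; apply: cvg_within_filter.
by apply: (cvg_comp snd fst); [exact: cvg_snd | exact: cvg_fst].
Defined.

Definition coordY : C1fun O T.
Proof.
apply: (@C1linear (fun p => p.2.2)) => //.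
move=> p _; apply: cvg_within_filter.
by apply: (cvg_comp snd snd); [exact: cvg_snd | exact: cvg_snd].
Defined.

Definition C1sq (f : C1fun O T) : C1fun O T := C1mul f f.

Definition sqdist (p0 : E) : C1fun O T :=
  C1add (C1sq (C1add coordT (C1cst _ _ (- p0.1))))
    (C1add (C1sq (C1add coordX (C1cst _ _ (- p0.2.1))))
           (C1sq (C1add coordY (C1cst _ _ (- p0.2.2))))).

Lemma pos2'_cont : continuous (fun x : R => 2 * pos x).
Proof. by move=> x; apply: cvgM; [exact: cvg_cst | exact: pos_cont]. Qed.

(** The positive part squared of r^2 - dist^2 is C1; the factor 4 / r^4 makes it at
least 1 where dist^2 <= r^2 / 2. *)
Definition bump (r : R) (p0 : E) : C1fun O T :=
  C1mul (C1cst _ _ (4 / r ^+ 4))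
    (C1comp pos2'_cont (@is_derive_pos2 R)
       (C1add (C1cst _ _ (r ^+ 2)) (C1opp (sqdist p0)))).

Definition box (r : R) (p0 : E) : set E :=
  `[p0.1 - r, p0.1 + r] `*` (`[p0.2.1 - r, p0.2.1 + r] `*` `[p0.2.2 - r, p0.2.2 + r]).

Lemma bump_ge0 r p0 p : 0 < r -> 0 <= bump r p0 p.
Proof.
by move=> r0; rewrite /= mulr_ge0 // ?sqr_ge0 // divr_ge0 // exprn_ge0 // ltW.
Qed.

Lemma bump_box r p0 p : 0 < r -> ~ box r p0 p -> bump r p0 p = 0.
Proof.
move=> r0 nb; have [h|h] := leP (r ^+ 2) (sqdist p0 p).
  by rewrite /= /pos2 /pos max_r ?expr0n ?mulr0 //=; rewrite subr_le0.
exfalso; apply: nb; move: h => /=.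
have le (a : R) : a * a < r ^+ 2 -> - r <= a <= r.
  move=> h; rewrite -ler_norml -(@ler_pXn2r _ 2) ?nnegrE ?(ltW r0) //.
  by rewrite real_normK ?num_real // expr2 ltW.
move: (p.1 - p0.1) (p.2.1 - p0.2.1) (p.2.2 - p0.2.2)
  (subrK p0.1 p.1) (subrK p0.2.1 p.2.1) (subrK p0.2.2 p.2.2) => a b c ea eb ec h.
have ha := sqr_ge0 a; have hb := sqr_ge0 b; have hc := sqr_ge0 c.
rewrite !expr2 in ha hb hc.
split => /=; last split => /=; rewrite in_itv /=.
- have /le : a * a < r ^+ 2 by lra.
  by case/andP=> *; apply/andP; split; lra.
- have /le : b * b < r ^+ 2 by lra.
  by case/andP=> *; apply/andP; split; lra.
- have /le : c * c < r ^+ 2 by lra.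
  by case/andP=> *; apply/andP; split; lra.
Qed.

Lemma bump_ge1 r p0 p : 0 < r -> sqdist p0 p < r ^+ 2 / 2 -> 1 <= bump r p0 p.
Proof.
move=> r0 h; change (1 <= 4 / r ^+ 4 * pos2 (r ^+ 2 - sqdist p0 p)).
rewrite /pos2 /pos max_l; last by have := exprn_gt0 2 r0; lra.
have r40 : 0 < r ^+ 4 by rewrite exprn_gt0.
rewrite mulrAC ler_pdivlMr // mul1r.
have -> : r ^+ 4 = 4 * (r ^+ 2 / 2) ^+ 2 by field.
rewrite ler_pM2l // lerXn2r ?nnegrE ?divr_ge0 ?exprn_ge0 ?(ltW r0) //.
  by have := exprn_gt0 2 r0; lra.
lra.
Qed.

Lemma box_ball r p0 (e : R) : r < e -> box r p0 `<=` ball p0 e.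
Proof.
move=> re [t [x y]] [/= h1 [/= h2 h3]]; rewrite -ball_normE /=.
change (Num.max `|p0.1 - t| (Num.max `|p0.2.1 - x| `|p0.2.2 - y|) < e).
rewrite !gt_max; move: h1 h2 h3; rewrite !in_itv /= => /andP[? ?] /andP[? ?] /andP[? ?].
by apply/and3P; split; rewrite ltr_norml; apply/andP; split; lra.
Qed.

Lemma sqdist_open p0 (c : R) : open [set p | sqdist p0 p < c].
Proof.
have ct : continuous (sqdist p0 : E -> R).
  have c1 : continuous (fun p : E => p.1) by move=> p; exact: cvg_fst.
  have c2 : continuous (fun p : E => p.2.1).
    by move=> p; apply: (cvg_comp snd fst); [exact: cvg_snd | exact: cvg_fst].
  have c3 : continuous (fun p : E => p.2.2).
    by move=> p; apply: (cvg_comp snd snd); [exact: cvg_snd | exact: cvg_snd].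
  have sq (f : E -> R) (a : R) : continuous f ->
    continuous (fun p => (f p + a) * (f p + a)).
    move=> cf p; have h : f q + a @[q --> p] --> f p + a.
      by apply: cvgD; [exact: cf | exact: cvg_cst].
    by apply: cvgM.
  move=> p; apply: cvgD; first exact: (sq _ _ c1 p).
  by apply: cvgD; [exact: (sq _ _ c2 p) | exact: (sq _ _ c3 p)].
have -> : [set p | sqdist p0 p < c] = (sqdist p0 : E -> R) @^-1` `]-oo, c[%classic.
  by apply/seteqP; split => p /=; rewrite in_itv.
apply: open_comp; first by move=> p _; exact: ct.
exact: interval_open.
Qed.

Lemma compact_box r p0 : compact (box r p0).
Proof. by do 2 (apply: compact_setX; first exact: segment_compact); exact: segment_compact. Qed.

(** A finite sum of bumps, by compactness. *)
Lemma smooth_cutoff (K V : set E) : compact K -> open V -> K `<=` V ->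
  exists (chi : C1fun O T) (S : set E), [/\ compact S, S `<=` V,
    (forall p, ~ S p -> chi p = 0), (forall p, 0 <= chi p) &
    forall p, K p -> 1 <= chi p].
Proof.
move=> cK oV KV.
have hr (p : E) : exists r : R, 0 < r /\ (K p -> box r p `<=` V).
  have [Kp|nKp] := pselect (K p); last by exists 1.
  have /nbhs_ballP[e /= e0 he] : nbhs p V by apply: open_nbhs_nbhs; split => //; exact: KV.
  exists (e / 2); split; first by rewrite divr_gt0.
  move=> _; apply: subset_trans he; apply: box_ball.
  by rewrite ltr_pdivrMr // mulr_natr mulr2n ltrDl.
have [r hr'] := choice hr.
have r0 p : 0 < r p by have [] := hr' p.
have rV p : K p -> box (r p) p `<=` V by have [] := hr' p.
pose PE : ptopologicalType := HB.pack (R * (R * R))%type.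
have cvK : cover_compact K by rewrite -(@compact_cover PE).
have := cvK E K => /(_ (fun p => [set q | sqdist p q < r p ^+ 2 / 2])).
case.
- by move=> p _; exact: sqdist_open.
- move=> p Kp; exists p => //=; rewrite !subrr !mulr0 !addr0.
  by rewrite divr_gt0 // exprn_gt0.
move=> D' D'K Kc.
have main (s : seq E) : (forall p, p \in s -> K p) ->
  exists (chi : C1fun O T) (S : set E), [/\ compact S, S `<=` V,
    (forall p, ~ S p -> chi p = 0), (forall p, 0 <= chi p) &
    forall p q, q \in s -> sqdist q p < r q ^+ 2 / 2 -> 1 <= chi p].
  elim: s => [|q s IH] hs.
    exists (C1cst _ _ 0), set0; split => //.
    exact: compact0.
  have [p ps|chi [S [cS SV S0 ch0 ch1]]] := IH; first by apply: hs; rewrite in_cons ps orbT.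
  have Kq : K q by apply: hs; rewrite in_cons eqxx.
  exists (C1add (bump (r q) q) chi), (box (r q) q `|` S); split.
  - by apply: compactU => //; exact: compact_box.
  - by move=> p [/(rV q Kq)|/SV].
  - move=> p nS; change (bump (r q) q p + chi p = 0).
    rewrite bump_box // ?S0 ?addr0 //; first by move=> Sp; apply: nS; right.
    by move=> Bp; apply: nS; left.
  - by move=> p; change (0 <= bump (r q) q p + chi p); rewrite addr_ge0 // bump_ge0.
  - move=> p q'; rewrite in_cons => /predU1P[->|q's] h.
      change (1 <= bump (r q) q p + chi p).
      by rewrite -[1]addr0 lerD // bump_ge1.
    change (1 <= bump (r q) q p + chi p).
    by rewrite -[1]add0r lerD ?bump_ge0 // (ch1 p q').
have [|chi [S [cS SV S0 ch0 ch1]]] := main (finmap.enum_fset D').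
  by move=> p pD; apply: set_mem; exact: D'K.
exists chi, S; split => // p /Kc[q qD h].
exact: (ch1 p q).
Qed.

End Bump.

Definition C2restr {R : realType} {O : set (R * R)} {T T' : R} (h : T' <= T)
  (F : C2fun O T) : C2fun O T'.
Proof.
apply: (@MkC2 R O T' (C1restr h F) (C1restr h (ct F)) (C1restr h (cx F))
  (C1restr h (cy F))).
- exact: (dT_c0 F).
- exact: (dX_c0 F).
- exact: (dY_c0 F).
- by move=> p /(cyl_sub h) Up; exact: (sym_tx F Up).
- by move=> p /(cyl_sub h) Up; exact: (sym_ty F Up).
- by move=> p /(cyl_sub h) Up; exact: (sym_xy F Up).
Defined.

Section LayerFunction.
Context {R : realType}.
Let E := (R * (R * R))%type.
Variables (O : set (R * R)) (hO : bounded_domain O) (T : R) (T0 : 0 < T).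
Let oO : open O. Proof. by have [] := hO. Qed.

Lemma bdry_nonempty : exists y, bdry O y.
Proof.
have [_ _ [x Ox] _] := hO.
have v0 : ((1, 0) : R * R) != 0.
  by apply/eqP => /(congr1 fst) /= /eqP; rewrite oner_eq0.
by have [s _ [_ bs]] := exit_time hO Ox v0; exists (x + s *: (1, 0)).
Qed.

Section Trace.
Variables (y0 : R * R) (h0 : closure O y0).

Lemma cts_trace (f : E -> R) : cts (slab O T) f -> cts (slab O T) (fun p => f (p.1, y0)).
Proof.
move=> cf p [p1 p2]; apply/cts_eps => e e0.
have /cts_eps /(_ _ e0)[d d0 hd] := cf (p.1, y0) (conj p1 h0).
exists d => // q [q1 q2] qp; apply: hd => //.
change (Num.max `|q.1 - p.1| `|y0 - y0| < d).
rewrite subrr normr0 gt_max d0 andbT; apply: le_lt_trans qp.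
change (`|q.1 - p.1| <= Num.max `|q.1 - p.1| `|q.2 - p.2|).
by rewrite le_max lexx.
Qed.

Lemma is_derive_trace0 (f : E -> R) (p v : E) :
  v.1 = 0 -> is_derive p v (fun p => f (p.1, y0)) 0.
Proof.
move=> v0; apply/is_derive_line0.
have -> : (fun h : R => f ((p + h *: v).1, y0)) = cst (f (p.1, y0)).
  by apply/funext => h; rewrite /= v0 scaler0 addr0.
exact: is_derive_cst.
Qed.

Lemma is_derive_traceT (F : C1fun O T) (p : E) : cyl T O p ->
  is_derive p et (fun p => F (p.1, y0)) (dT F (p.1, y0)).
Proof.
move=> [p1 p2]; have := is_dT_closure F p1 h0.
move=> /is_derive_line0 hd; apply/is_derive_line0; move: hd.
congr (is_derive _ _ _ _); apply/funext => h; congr (F _).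
apply: injective_projections; last apply: injective_projections => //.
- by change (p.1 + h * 1 = p.1 + h * 1).
- by change (y0.1 + h * 0 = y0.1); rewrite mulr0 addr0.
- by change (y0.2 + h * 0 = y0.2); rewrite mulr0 addr0.
Qed.

(** The boundary value of F as a function of (t, x); it is C1 in time because the
time derivative extends to the lateral boundary. *)
Definition trace (F : C1fun O T) : C1fun O T.
Proof.
apply: (@MkC1 R O T (fun p => F (p.1, y0)) (fun p => dT F (p.1, y0))
  (fun=> 0) (fun=> 0)); do ?exact: cts_cst.
- by apply: cts_trace; exact: cts_val.
- by apply: cts_trace; exact: cts_dT.
- exact: is_derive_traceT.
- by move=> p _; exact: is_derive_trace0.
- by move=> p _; exact: is_derive_trace0.
Defined.
End Trace.

Variables (Psi : C2fun O T) (K V : set E) (alpha : R).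
Hypothesis a0 : 0 < alpha.
Hypothesis Psi_bdry : forall (t : R) (y z : R * R), 0 <= t <= T ->
  bdry O y -> bdry O z -> Psi (t, y) = Psi (t, z).
Hypothesis Psi_min : forall (t : R) (x y : R * R), 0 <= t <= T ->
  O x -> bdry O y -> Psi (t, y) <= Psi (t, x).
Hypotheses (cK : compact K) (oV : open V) (KV : K `<=` V).
Hypothesis VO : forall p, V p -> O p.2.
Hypothesis Psi_grad : forall p : E, 0 <= p.1 < T -> O p.2 -> ~ K p ->
  alpha ^+ 2 <= cx Psi p ^+ 2 + cy Psi p ^+ 2.

(** D = Psi - Psi(., y0) + chi, where chi is a cut-off of the compact set K on which
grad Psi may vanish. Outside K, Psi exceeds its boundary value strictly, for an
interior minimum would be a critical point; on K the cut-off does it. For t <= T'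
the support of chi is at positive height, whence the threshold e. *)
Lemma layer_function : exists (D chi : C1fun O T) (y0 : R * R) (h0 : bdry O y0),
  [/\ (forall (t : R) (y : R * R), 0 < t < T -> bdry O y -> D (t, y) = 0),
      (forall (t : R) (x : R * R), 0 <= t < T -> O x -> 0 < D (t, x)),
      ((forall p, 0 <= chi p) /\ (forall p, K p -> 1 <= chi p)),
      (forall p, ~ V p -> chi p = 0) &
   forall T', 0 < T' -> T' < T -> exists2 e : R, 0 < e &
     forall p, cyl T' O p -> D p <= e ->
     [/\ chi p = 0, D p = Psi p - Psi (p.1, y0), dX D p = cx Psi p,
         dY D p = cy Psi p & dT D p = ct Psi p - ct Psi (p.1, y0)]].
Proof.
have [y0 b0] := bdry_nonempty.
have [chi [S [cS SV S0 ch0 chK]]] := smooth_cutoff O T cK oV KV.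
pose D := C1add (C1add Psi (C1opp (trace b0.1 Psi))) chi.
have DE p : D p = Psi p - Psi (p.1, y0) + chi p by [].
have nVb (p : E) : ~ O p.2 -> chi p = 0.
  by move=> nO; apply: S0 => /SV /VO.
have dpos (t : R) (x : R * R) : 0 <= t < T -> O x -> 0 < D (t, x).
  move=> tT Ox; have tT' : 0 <= t <= T by case/andP: tT => a b; rewrite a ltW.
  have h1 := Psi_min tT' Ox b0.
  rewrite DE /=; have [ch|ch] := ltP 0 (chi (t, x)); first by lra.
  have ch00 : chi (t, x) = 0 by apply/eqP; rewrite eq_le ch ch0.
  rewrite ch00 addr0 subr_gt0 lt_neqAle h1 andbT; apply/eqP => e.
  have nK : ~ K (t, x) by move=> /chK; rewrite ch00; lra.
  have := @Psi_grad (t, x) tT Ox nK.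
  have [r r0 hr] : exists2 r : R, 0 < r & ball x r `<=` O.
    have /nbhs_ballP[r /= r0 hr] : nbhs x O by apply: open_nbhs_nbhs.
    by exists r.
  have [hX hY] := is_dXY_time oO Psi tT Ox.
  have hmin (a b : R) : `|(a, b)%R : R * R| <= 1 -> forall h : R, `|h| < r ->
      Psi (t, x) <= Psi (((t, x) : E) + h *: ((0, (a, b)) : E)).
    move=> ab h hh; rewrite line_xy -e; apply: Psi_min => //; apply: hr.
    rewrite -ball_normE /= opprD addrA subrr add0r normrN normrZ.
    by apply: le_lt_trans hh; rewrite ler_piMr.
  have n1 : `|(1, 0) : R * R| <= 1.
    by change (Num.max `|1 : R| `|0 : R| <= 1); rewrite normr1 normr0 max_l.
  have n2 : `|(0, 1) : R * R| <= 1.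
    by change (Num.max `|0 : R| `|1 : R| <= 1); rewrite normr1 normr0 max_r.
  rewrite -dX_c0 -dY_c0 (is_derive_min r0 hX (hmin 1 0 n1))
    (is_derive_min r0 hY (hmin 0 1 n2)) expr0n /= addr0.
  by rewrite leNgt exprn_gt0.
exists D, chi, y0, b0; split => //.
- move=> t y tT bY; rewrite DE nVb; last first.
    by move=> Oy; apply: bY.2; exact: (open_nbhs_nbhs (conj oO Oy)).
  have tT' : 0 <= t <= T by case/andP: tT => /ltW a /ltW b; rewrite a.
  by rewrite (Psi_bdry tT' bY b0) subrr addr0.
- by move=> p nV; apply: S0 => /SV.
move=> T' T'0 T'T.
have cS' : compact (S `&` (fst @^-1` `[0, T'])).
  apply: compact_closedI => //; apply: closed_comp; last exact: itv_closed.
  by move=> p _; exact: cvg_fst.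
have Ssub : S `&` (fst @^-1` `[0, T']) `<=` slab O T.
  move=> p [/SV /VO Op]; rewrite /= in_itv /= => /andP[p0 pT].
  by split; [rewrite /= in_itv /= p0 (le_trans pT) // ltW | exact: subset_closure].
have [e e0 he] : exists2 e : R, 0 < e &
   forall p, S p -> 0 <= p.1 <= T' -> e < D p.
  have [ne|/set0P/negP/negbNE/eqP S00] := pselect ((S `&` (fst @^-1` `[0, T'])) !=set0).
    have [c Sc hc] := compact_EVT_min ne cS' ((ctsE _ _).1 (cts_subset Ssub (cts_val D))).
    move: Sc; rewrite inE => -[/SV /VO Oc]; rewrite /= in_itv /= => /andP[c0 cT].
    have Dc : 0 < D c.
      by rewrite (surjective_pairing c); apply: dpos => //; rewrite c0 (le_lt_trans cT).
    exists (D c / 2); first by rewrite divr_gt0.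
    move=> p Sp pT; have : D c <= D p by apply: hc; rewrite inE; split => //=; rewrite in_itv.
    by apply: lt_le_trans; rewrite ltr_pdivrMr // mulr_natr mulr2n ltrDl.
  by exists 1 => // p Sp pT; exfalso; have : set0 p by rewrite -S00; split => //=; rewrite in_itv.
exists e => // p Up De.
have [p1 p2] := Up; have pT' : 0 < p.1 < T' by move: p1; rewrite /= in_itv.
have nS : ~ S p.
  by move=> Sp; have := he p Sp; rewrite leNgt in De; move=> h; move/negP: De; apply;
   apply: h; case/andP: pT' => /ltW a /ltW b; rewrite a.
have UT : cyl T O p by split => //=; case/andP: pT' => a b; rewrite in_itv /= a (lt_trans b).
have zero v c : is_derive p v chi c -> c = 0.
  move=> [_ <-]; have [_ //] : is_derive p v chi 0.
  apply: near_eq_is_derive (is_derive_cst 0 p v).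
  have : \forall q \near p, (~` S) q.
    apply: open_nbhs_nbhs; split => //; apply: closed_openC.
    by apply: compact_closed => //; exact: norm_hausdorff.
  by apply: filterS => q /S0 ->.
split; first exact: S0.
- by rewrite DE S0 // addr0.
- have hz := zero _ _ (is_dX chi UT).
  by change (dX Psi p - 0 + dX chi p = cx Psi p); rewrite hz subr0 addr0 dX_c0.
- have hz := zero _ _ (is_dY chi UT).
  by change (dY Psi p - 0 + dY chi p = cy Psi p); rewrite hz subr0 addr0 dY_c0.
- have hz := zero _ _ (is_dT chi UT).
  change (dT Psi p - dT Psi (p.1, y0) + dT chi p = ct Psi p - ct Psi (p.1, y0)).
  by rewrite hz addr0 dT_c0.
Qed.

End LayerFunction.

(** * Size of the weights *)

Section WeightFacts.
Variable R : realType.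
Implicit Types m lam s th tht thtt psi K : R.

(** With X = e^{6 lam m} and a = e^lam, one has e = X y with 1 <= y <= a, while
Lam = lam X a^6, the parameter mu is s lam^2 X a^{-4} and a^6 <= X since m >= 1. The
last inequality is the reason for the exponent 6 m - 4 in mu. *)
Lemma weight_facts m lam s psi : 1 <= m -> 1 <= lam -> 1 <= s -> 0 <= psi <= 1 ->
  let e := expR (lam * (psi + 6 * m)) in
  let Lam := lam * expR (6 * lam * (m + 1)) in
  [/\ lam <= e, (1 + lam) * e <= Lam, Lam <= lam * e ^+ 2 &
     s * (mu_par m s lam) ^+ 2 * Lam <= s ^+ 3 * lam ^+ 3 * e ^+ 3].
Proof.
move=> m1 lam1 s1 /andP[psi0 psi1] e Lam.
pose X := expR (6 * lam * m); pose a := expR lam; pose y := expR (lam * psi).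
have lam0 : 0 <= lam by lra.
have eE : e = X * y by rewrite /e /X /y -expRD; congr expR; ring.
have a6 : expR (6 * lam) = a ^+ 6 by rewrite /a -expRM_natl; congr expR; ring.
have LE : Lam = lam * X * a ^+ 6.
  have -> : Lam = lam * (X * expR (6 * lam)) by rewrite /Lam /X -expRD; congr (_ * expR _); ring.
  by rewrite a6; ring.
have X0 : 0 < X by exact: expR_gt0.
have ag : 0 < a by exact: expR_gt0.
have y1 : 1 <= y by rewrite -expR0 ler_expR mulr_ge0.
have ya : y <= a by rewrite ler_expR ler_piMr.
have a1 : 1 + lam <= a by exact: expR_ge1Dx.
have Xa : a ^+ 6 <= X by rewrite -a6 ler_expR ler_peMr // mulr_ge0.
have eX : X <= e by rewrite eE ler_peMr // ltW.
have e0 : 0 < e by exact: expR_gt0.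
have an n : 1 <= a ^+ n by rewrite exprn_ege1 //; lra.
have muE : mu_par m s lam = s * lam ^+ 2 * X * a ^- 4.
  have XE : expR (lam * (6 * m - 4)) = X / a ^+ 4.
    have -> : a ^+ 4 = expR (4 * lam) by rewrite /a -expRM_natl; congr expR; ring.
    by rewrite /X -expRN -expRD; congr expR; ring.
  by rewrite /mu_par XE mulrA.
split.
- apply: le_trans eX; apply: le_trans Xa.
  by rewrite exprS; apply: (@le_trans _ _ a); [lra | rewrite ler_peMr // ltW].
- rewrite eE LE; apply: (@le_trans _ _ ((1 + lam) * (X * a))).
    by rewrite ler_wpM2l; [|lra|rewrite ler_wpM2l // ltW].
  have -> : lam * X * a ^+ 6 = (lam * a ^+ 5) * (X * a) by ring.
  have Xa0 : 0 <= X * a by rewrite mulr_ge0 // ltW.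
  have h5 : a <= a ^+ 5 by rewrite exprS ler_peMr // ltW.
  have h1 : 0 <= 1 + lam by lra.
  have h2 : 1 * (1 + lam) <= lam * a ^+ 5 by apply: ler_pM => //; lra.
  by apply: ler_wpM2r => //; move: h2; rewrite mul1r.
- rewrite LE -mulrA ler_wpM2l // expr2; apply: (@le_trans _ _ (X * X)).
    by rewrite ler_wpM2l // ltW.
  by rewrite ler_pM // ltW.
- rewrite LE muE.
  have a4 : a ^+ 4 != 0 by rewrite expf_neq0 // gt_eqF.
  have -> : s * (s * lam ^+ 2 * X * a ^- 4) ^+ 2 * (lam * X * a ^+ 6)
     = s ^+ 3 * lam ^+ 3 * (X ^+ 3 * (lam ^+ 2 * a ^- 2)).
    by field; rewrite gt_eqF.
  apply: ler_wpM2l; first by rewrite mulr_ge0 ?exprn_ge0 //; lra.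
  apply: (@le_trans _ _ (X ^+ 3)).
    rewrite ler_piMr ?exprn_ge0 ?(ltW X0) // ler_pdivrMr ?exprn_gt0 // mul1r.
    by rewrite lerXn2r ?nnegrE ?(ltW ag) //; lra.
  by rewrite lerXn2r ?nnegrE ?(ltW X0) ?(ltW e0).
Qed.

(** tp and beta are the positive and negative parts of the time derivative of the
exponent. The positive part is O(W^2 / lam); the negative part is proportional to
mu, and nothing but its sign is used. *)
Lemma weight_bounds m lam s psi th tht thtt K : 1 <= m -> 1 <= lam -> 1 <= s ->
  0 <= psi <= 1 -> 0 <= K -> 1 <= th -> tht <= K * th ^+ 2 ->
  thtt <= K * (th ^+ 3 + mu_par m s lam ^+ 2) ->
  let e := expR (lam * (psi + 6 * m)) in
  let Lam := lam * expR (6 * lam * (m + 1)) in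
  let W := s * lam * th * e in
  let beta := s * Num.max (- tht) 0 * (Lam - e) in
  let tp := s * Num.max tht 0 * (Lam - e) in
  let rho := s * lam * tht * e in
  let T2 := s * thtt * (Lam - e) in
  [/\ lam ^+ 2 <= W, 0 <= beta /\ 0 <= tp, lam * tp <= 2 * K * W ^+ 2,
     - beta <= rho /\ rho <= 2 * K * W ^+ 2 & T2 <= 2 * K * W ^+ 3].
Proof.
move=> m1 lam1 s1 psi01 K0 th1 htht hthtt e Lam W beta tp rho T2.
have [le eLam Lam2 muL] := weight_facts m1 lam1 s1 psi01.
rewrite -/e -/Lam in le eLam Lam2 muL.
have lam0 : 0 <= lam by lra.
have s0 : 0 <= s by lra.
have th0 : 0 <= th by lra.
have e1 : 1 <= e by lra.
have e0 : 0 <= e by lra.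
have leL : lam * e <= Lam - e by lra.
have Le0 : 0 <= Lam - e by apply: le_trans leL; rewrite mulr_ge0.
have LeL : Lam - e <= Lam by lra.
have L0 : 0 <= Lam by lra.
have W0 : 0 <= W by rewrite !mulr_ge0.
have pos_tht : Num.max tht 0 <= K * th ^+ 2.
  by rewrite ge_max htht mulr_ge0 // exprn_ge0.
have tpos : 0 <= Num.max tht 0 by rewrite le_max lexx orbT.
have npos : 0 <= Num.max (- tht) 0 by rewrite le_max lexx orbT.
have ntht : - Num.max (- tht) 0 <= tht.
  by rewrite lerNl le_max lexx.
have slam1 : 1 <= s * lam by rewrite -[1]mulr1 ler_pM.
have WE : W ^+ 2 = (s * lam) * ((s * lam) * (th ^+ 2 * e ^+ 2)).
  by rewrite /W; ring.
have te0 : 0 <= th ^+ 2 * e ^+ 2 by rewrite mulr_ge0 ?exprn_ge0.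
have KW : 0 <= K * W ^+ 2 by rewrite mulr_ge0 ?exprn_ge0.
split.
- rewrite /W expr2 (_ : s * lam * th * e = (s * th) * lam * e); last by ring.
  apply: ler_pM => //; rewrite -[X in X <= _]mul1r ler_wpM2r //.
  by rewrite -[1]mulr1 ler_pM.
- by split; rewrite !mulr_ge0.
- have : lam * tp <= K * W ^+ 2.
    have -> : lam * tp = s * lam * (Num.max tht 0 * (Lam - e)) by rewrite /tp; ring.
    have h1 : Num.max tht 0 * (Lam - e) <= K * th ^+ 2 * (lam * e ^+ 2).
      by apply: ler_pM => //; lra.
    have sl0 : 0 <= s * lam by rewrite mulr_ge0.
    apply: (le_trans (ler_wpM2l sl0 h1)).
    have -> : s * lam * (K * th ^+ 2 * (lam * e ^+ 2))
      = lam * (s * lam * K * (th ^+ 2 * e ^+ 2)) by ring.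
    have -> : K * W ^+ 2 = (s * lam) * (s * lam * K * (th ^+ 2 * e ^+ 2)).
      by rewrite WE; ring.
    apply: ler_wpM2r; first by rewrite mulr_ge0 // mulr_ge0.
    by rewrite ler_peMl.
  by lra.
- split.
  + rewrite /beta /rho.
    have h1 : s * Num.max (- tht) 0 * (lam * e) <= s * Num.max (- tht) 0 * (Lam - e).
      by apply: ler_wpM2l => //; rewrite mulr_ge0.
    have h2 : (s * lam * e) * (- Num.max (- tht) 0) <= (s * lam * e) * tht.
      by apply: ler_wpM2l => //; rewrite !mulr_ge0.
    by lra.
  + have : rho <= K * W ^+ 2.
      have -> : rho = s * lam * e * tht by rewrite /rho; ring.
      have sle0 : 0 <= s * lam * e by rewrite !mulr_ge0.
      apply: (le_trans (ler_wpM2l sle0 htht)).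
      have -> : s * lam * e * (K * th ^+ 2) = 1 * 1 * (s * lam * K * (th ^+ 2 * e)) by ring.
      have -> : K * W ^+ 2 = (s * lam) * e * (s * lam * K * (th ^+ 2 * e)).
        by rewrite /W; ring.
      apply: ler_pM => //.
        by rewrite !mulr_ge0 // exprn_ge0.
      by apply: ler_pM.
    by lra.
- have thtt' : thtt <= K * (th ^+ 3 + mu_par m s lam ^+ 2) by [].
  have h0 : T2 <= s * (K * (th ^+ 3 + mu_par m s lam ^+ 2)) * Lam.
    rewrite /T2; apply: (@le_trans _ _ (s * (K * (th ^+ 3 + mu_par m s lam ^+ 2)) * (Lam - e))).
      by rewrite ler_wpM2r // ler_wpM2l.
    apply: ler_wpM2l => //; rewrite mulr_ge0 // mulr_ge0 // addr_ge0 ?sqr_ge0 //.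
    by rewrite exprn_ge0.
  have h1 : s * th ^+ 3 * Lam <= W ^+ 3.
    have -> : W ^+ 3 = s * lam * (s * lam * e) * (s * th ^+ 3 * (lam * e ^+ 2)).
      by rewrite /W; ring.
    apply: (@le_trans _ _ (s * th ^+ 3 * (lam * e ^+ 2))).
      by rewrite ler_wpM2l // mulr_ge0 // exprn_ge0.
    rewrite ler_peMl //; first by rewrite !mulr_ge0 // exprn_ge0.
    by rewrite -[1]mulr1 ler_pM // -[1]mulr1 ler_pM.
  have h2 : s * mu_par m s lam ^+ 2 * Lam <= W ^+ 3.
    apply: (le_trans muL).
    have -> : W ^+ 3 = th ^+ 3 * (s ^+ 3 * lam ^+ 3 * e ^+ 3) by rewrite /W; ring.
    rewrite ler_peMl ?exprn_ege1 // !mulr_ge0 ?exprn_ge0 //.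
  apply: (le_trans h0).
  have -> : s * (K * (th ^+ 3 + mu_par m s lam ^+ 2)) * Lam
    = K * (s * th ^+ 3 * Lam + s * mu_par m s lam ^+ 2 * Lam) by ring.
  have -> : 2 * K * W ^+ 3 = K * (W ^+ 3 + W ^+ 3) by ring.
  by rewrite ler_wpM2l // lerD.
Qed.
End WeightFacts.

(** * Conjugation by the weight *)

Section C1rules.
Context {R : realType} {O : set (R * R)} {T : R}.
Implicit Types (f g : C1fun O T) (p : R * (R * R)).
Let valM f g p : C1mul f g p = f p * g p. Proof. by []. Qed.
Let valD f g p : C1add f g p = f p + g p. Proof. by []. Qed.
Let valN f p : C1opp f p = - f p. Proof. by []. Qed.
Let valC c p : C1cst O T c p = c. Proof. by []. Qed.
Let valE f p : C1exp f p = expR (f p). Proof. by []. Qed.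
Let dTM f g p : dT (C1mul f g) p = dT f p * g p + f p * dT g p. Proof. by []. Qed.
Let dTD f g p : dT (C1add f g) p = dT f p + dT g p. Proof. by []. Qed.
Let dTN f p : dT (C1opp f) p = - dT f p. Proof. by []. Qed.
Let dTC c p : dT (C1cst O T c) p = 0. Proof. by []. Qed.
Let dTE f p : dT (C1exp f) p = expR (f p) * dT f p. Proof. by []. Qed.
Let dXM f g p : dX (C1mul f g) p = dX f p * g p + f p * dX g p. Proof. by []. Qed.
Let dXD f g p : dX (C1add f g) p = dX f p + dX g p. Proof. by []. Qed.
Let dXN f p : dX (C1opp f) p = - dX f p. Proof. by []. Qed.
Let dXC c p : dX (C1cst O T c) p = 0. Proof. by []. Qed.
Let dXE f p : dX (C1exp f) p = expR (f p) * dX f p. Proof. by []. Qed.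
Let dYM f g p : dY (C1mul f g) p = dY f p * g p + f p * dY g p. Proof. by []. Qed.
Let dYD f g p : dY (C1add f g) p = dY f p + dY g p. Proof. by []. Qed.
Let dYN f p : dY (C1opp f) p = - dY f p. Proof. by []. Qed.
Let dYC c p : dY (C1cst O T c) p = 0. Proof. by []. Qed.
Let dYE f p : dY (C1exp f) p = expR (f p) * dY f p. Proof. by []. Qed.
Definition valE1 := (valM, valD, valN, valC, valE).
Definition C1E := (valE1, (dTM, dTD, dTN, dTC, dTE), (dXM, dXD, dXN, dXC, dXE),
  (dYM, dYD, dYN, dYC, dYE)).
End C1rules.

Declare Scope C1_scope.
Delimit Scope C1_scope with C1.
Bind Scope C1_scope with C1fun.
Notation "f + g" := (C1add f g) : C1_scope.
Notation "f * g" := (C1mul f g) : C1_scope.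
Notation "- f" := (C1opp f) : C1_scope.
Notation "f - g" := (C1add f (C1opp g)) : C1_scope.
Notation "c %:C" := (C1cst _ _ c) (at level 1, format "c %:C") : C1_scope.

(** Psi is the space weight, and th, tht stand for theta and its derivative. The
definitions are locked so that rewriting does not see through them; they are
computed by unlocking and the rules C1E. *)
Section Calculus.
Context {R : realType}.
Let E := (R * (R * R))%type.
Variables (O : set (R * R)) (hO : bounded_domain O) (T : R) (T0 : 0 < T).
Variables (Psi z : C2fun O T) (sg chi th tht : C1fun O T).
Hypotheses (th_t : dT th = tht) (th_x : forall p, dX th p = 0) (th_y : forall p, dY th p = 0).
Hypotheses (tht_x : forall p, dX tht p = 0) (tht_y : forall p, dY tht p = 0).
Variables (nu m lam s : R).

Definition Lam := lam * expR (6 * lam * (m + 1)).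
Definition ewt : C1fun O T := locked (C1exp (lam%:C * (Psi + (6 * m)%:C))%C1).
Definition W : C1fun O T := locked ((s * lam)%:C * (th * ewt))%C1.
Definition Phi : C1fun O T := locked (s%:C * (th * (Lam%:C - ewt)))%C1.
Definition Phit : C1fun O T :=
  locked (s%:C * (tht * (Lam%:C - ewt)) - ct Psi * W)%C1.
Definition Ewt : C1fun O T := locked (C1exp (- Phi)%C1).
Definition gr2 : C1fun O T := locked (cx Psi * cx Psi + cy Psi * cy Psi)%C1.
Definition V : C1fun O T := locked (- (nu%:C * (W * W * gr2)) - sg * Phit)%C1.

Lemma ewt_t p : dT ewt p = lam * ct Psi p * ewt p.
Proof. by rewrite /ewt -!lock !C1E dT_c0; ring. Qed.
Lemma ewt_x p : dX ewt p = lam * cx Psi p * ewt p.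
Proof. by rewrite /ewt -!lock !C1E dX_c0; ring. Qed.
Lemma ewt_y p : dY ewt p = lam * cy Psi p * ewt p.
Proof. by rewrite /ewt -!lock !C1E dY_c0; ring. Qed.

Definition rho p := s * lam * tht p * ewt p.

Lemma W_t p : dT W p = rho p + lam * ct Psi p * W p.
Proof. by rewrite /rho /W -!lock !C1E ewt_t th_t; ring. Qed.
Lemma W_x p : dX W p = lam * W p * cx Psi p.
Proof. by rewrite /W -!lock !C1E ewt_x th_x; ring. Qed.
Lemma W_y p : dY W p = lam * W p * cy Psi p.
Proof. by rewrite /W -!lock !C1E ewt_y th_y; ring. Qed.

Lemma W_val p : W p = s * lam * (th p * ewt p).
Proof. by rewrite /W -lock. Qed.

Lemma Phi_t p : dT Phi p = Phit p.
Proof. by rewrite /Phi /Phit -!lock !C1E ewt_t th_t W_val; ring. Qed.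
Lemma Phi_x p : dX Phi p = - (W p * cx Psi p).
Proof. by rewrite /Phi -!lock !C1E ewt_x th_x W_val; ring. Qed.
Lemma Phi_y p : dY Phi p = - (W p * cy Psi p).
Proof. by rewrite /Phi -!lock !C1E ewt_y th_y W_val; ring. Qed.

Lemma Phit_x p : cyl T O p ->
  dX Phit p = - ((rho p + lam * ct Psi p * W p) * cx Psi p) - W p * dT (cx Psi) p.
Proof.
by move=> Up; rewrite /Phit /rho -!lock !C1E W_x ewt_x tht_x (sym_tx Psi Up); ring.
Qed.
Lemma Phit_y p : cyl T O p ->
  dY Phit p = - ((rho p + lam * ct Psi p * W p) * cy Psi p) - W p * dT (cy Psi) p.
Proof.
by move=> Up; rewrite /Phit /rho -!lock !C1E W_y ewt_y tht_y (sym_ty Psi Up); ring.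
Qed.
Lemma Phit_t p : dT Phit p = s * dT tht p * (Lam - ewt p) - ct Psi p * rho p
  - dT (ct Psi) p * W p - ct Psi p * (rho p + lam * ct Psi p * W p).
Proof. by rewrite /Phit -!lock !C1E W_t ewt_t /rho; ring. Qed.

(** wf is the conjugated function w = e^{-Phi} z, and wt, wx, wy its derivatives in
expanded form, which exhibits them as C1 functions. *)
Definition wt : C1fun O T := locked (Ewt * (ct z - Phit * z))%C1.
Definition wx : C1fun O T := locked (Ewt * (cx z + W * cx Psi * z))%C1.
Definition wy : C1fun O T := locked (Ewt * (cy z + W * cy Psi * z))%C1.
Definition wv : C1fun O T := locked (Ewt * z)%C1.
Definition wf : C2fun O T.
Proof.
apply: (@MkC2 R O T wv wt wx wy).
- by apply/funext => p; rewrite /wv /wt /Ewt -!lock !C1E Phi_t dT_c0; ring.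
- by apply/funext => p; rewrite /wv /wx /Ewt -!lock !C1E Phi_x dX_c0; ring.
- by apply/funext => p; rewrite /wv /wy /Ewt -!lock !C1E Phi_y dY_c0; ring.
- move=> p Up; rewrite /wt /wx /Ewt -!lock !C1E Phi_t Phi_x W_t (Phit_x Up) (sym_tx z Up) dT_c0 dX_c0.
  by ring.
- move=> p Up; rewrite /wt /wy /Ewt -!lock !C1E Phi_t Phi_y W_t (Phit_y Up) (sym_ty z Up) dT_c0 dY_c0.
  by ring.
- move=> p Up; rewrite /wx /wy /Ewt -!lock !C1E Phi_x Phi_y W_x W_y (sym_xy z Up) (sym_xy Psi Up) dX_c0 dY_c0.
  by ring.
Defined.

Definition eta : C1fun O T := locked (lam%:C * (W * chi))%C1.
Definition scal : C1fun O T := locked (cx Psi * wx + cy Psi * wy)%C1.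
Definition gw2 : C1fun O T := locked (wx * wx + wy * wy)%C1.

(** pi and wi are the components of grad Psi and grad w in the direction of the
flux. *)
Definition flux (pi wi : C1fun O T) : C1fun O T :=
  ((2 * nu)%:C * (sg * wt * wi) - (4 * nu ^+ 2)%:C * (W * wi * scal)
   + (2 * nu ^+ 2)%:C * (W * pi * gw2)
   - (4 * nu ^+ 2 * lam)%:C * (W * gr2 * (wv * wi))
   + (2 * nu)%:C * (V * W * pi * (wv * wv)) - nu%:C * (eta * (wv * wi)))%C1.
Definition flux1 := flux (cx Psi) wx.
Definition flux2 := flux (cy Psi) wy.
Definition energy : C1fun O T :=
  (nu%:C * (sg * gw2) + sg * V * (wv * wv) + (2^-1)%:C * (sg * eta * (wv * wv)))%C1.

Lemma V_t p : dT V p = - (2 * nu * W p * (rho p + lam * ct Psi p * W p) * gr2 p)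
   - nu * W p ^+ 2 * (2 * (cx Psi p * dT (cx Psi) p + cy Psi p * dT (cy Psi) p))
   - dT sg p * Phit p - sg p * dT Phit p.
Proof. by rewrite /V /gr2 -!lock !C1E W_t; ring. Qed.
Lemma V_x p : cyl T O p -> dX V p = - (2 * nu * W p * (lam * W p * cx Psi p) * gr2 p)
   - nu * W p ^+ 2 * (2 * (cx Psi p * dX (cx Psi) p + cy Psi p * dX (cy Psi) p))
   - dX sg p * Phit p - sg p * dX Phit p.
Proof. by move=> Up; rewrite /V /gr2 -!lock !C1E W_x; ring. Qed.
Lemma V_y p : cyl T O p -> dY V p = - (2 * nu * W p * (lam * W p * cy Psi p) * gr2 p)
   - nu * W p ^+ 2 * (2 * (cx Psi p * dX (cy Psi) p + cy Psi p * dY (cy Psi) p))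
   - dY sg p * Phit p - sg p * dY Phit p.
Proof. by move=> Up; rewrite /V /gr2 -!lock !C1E W_y (sym_xy Psi Up); ring. Qed.

Lemma wv_t p : dT wv p = wt p.
Proof. by have /(congr1 (fun f => f p)) := dT_c0 wf. Qed.
Lemma wv_x p : dX wv p = wx p.
Proof. by have /(congr1 (fun f => f p)) := dX_c0 wf. Qed.
Lemma wv_y p : dY wv p = wy p.
Proof. by have /(congr1 (fun f => f p)) := dY_c0 wf. Qed.
Lemma w_sym_tx p : cyl T O p -> dX wt p = dT wx p. Proof. exact: (sym_tx wf). Qed.
Lemma w_sym_ty p : cyl T O p -> dY wt p = dT wy p. Proof. exact: (sym_ty wf). Qed.
Lemma w_sym_xy p : cyl T O p -> dY wx p = dX wy p. Proof. exact: (sym_xy wf). Qed.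

Lemma gr2_val p : gr2 p = cx Psi p ^+ 2 + cy Psi p ^+ 2.
Proof. by rewrite /gr2 -lock !C1E !expr2. Qed.

Lemma flux_div_C1 p : cyl T O p -> dX flux1 p + dY flux2 p - dT energy p =
  flux_div nu lam (W p) (rho p + lam * ct Psi p * W p) (sg p) (dT sg p) (dX sg p)
   (dY sg p) (V p) (dT V p) (dX V p) (dY V p) (chi p) (dT chi p) (dX chi p) (dY chi p)
   (cx Psi p) (cy Psi p) (dX (cx Psi) p) (dX (cy Psi) p) (dY (cy Psi) p)
   (cx Psi p ^+ 2 + cy Psi p ^+ 2)
   (2 * (cx Psi p * dX (cx Psi) p + cy Psi p * dX (cy Psi) p))
   (2 * (cx Psi p * dX (cy Psi) p + cy Psi p * dY (cy Psi) p))
   (wv p) (wt p) (wx p) (wy p) (dX wx p) (dX wy p) (dY wy p) (dT wx p) (dT wy p).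
Proof.
move=> Up; rewrite /flux1 /flux2 /flux /energy /eta /scal /gw2 /gr2 -!lock !C1E.
rewrite wv_x wv_y wv_t W_x W_y W_t (w_sym_tx Up) (w_sym_ty Up) (w_sym_xy Up)
  (sym_xy Psi Up).
rewrite /flux_div /flux1_div /energy_dt.
by field.
Qed.

Definition lapz p := dX (cx z) p + dY (cy z) p.
Definition rhs p := Ewt p * (- sg p * ct z p - nu * lapz p).

Lemma Ewt_x p : dX Ewt p = W p * cx Psi p * Ewt p.
Proof. by rewrite /Ewt -lock !C1E Phi_x; ring. Qed.
Lemma Ewt_y p : dY Ewt p = W p * cy Psi p * Ewt p.
Proof. by rewrite /Ewt -lock !C1E Phi_y; ring. Qed.

(** The conjugated operator, arranged as in flux_identity: symmetric part, skew part
and remainder. *)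
Lemma rhs_conj p : rhs p =
  - nu * (dX wx p + dY wy p) + V p * wv p
  + (- sg p * wt p + 2 * nu * W p * (cx Psi p * wx p + cy Psi p * wy p)
     + 2 * nu * lam * W p * (cx Psi p ^+ 2 + cy Psi p ^+ 2) * wv p)
  + (- nu * lam * W p * (cx Psi p ^+ 2 + cy Psi p ^+ 2)
      + nu * W p * (dX (cx Psi) p + dY (cy Psi) p)) * wv p.
Proof.
rewrite /rhs /lapz /wx /wy /wt /wv /V /gr2 -!lock !C1E Ewt_x Ewt_y W_x W_y dX_c0 dY_c0.
by ring.
Qed.

End Calculus.

(** * The pointwise inequality in terms of z *)

(** e zx = wx - Wp p1 w, where w = e zv, so the gradient of z costs the gradient of w
and Wp^2 w^2. *)
Lemma conjugate_grad {R : realType} (K Wp e zx zy zv p1 p2 : R) :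
  `|p1| <= K -> `|p2| <= K ->
  (zx ^+ 2 + zy ^+ 2) * e ^+ 2 <=
  2 * ((e * (zx + Wp * p1 * zv)) ^+ 2 + (e * (zy + Wp * p2 * zv)) ^+ 2)
  + 4 * K ^+ 2 * (Wp ^+ 2 * (e * zv) ^+ 2).
Proof.
move=> h1 h2.
pose v := e * zv; pose x := e * (zx + Wp * p1 * zv); pose y := e * (zy + Wp * p2 * zv).
rewrite -/x -/y -/v.
have -> : (zx ^+ 2 + zy ^+ 2) * e ^+ 2 = (x - Wp * p1 * v) ^+ 2 + (y - Wp * p2 * v) ^+ 2.
  by rewrite /x /y /v; ring.
have step (a b : R) : `|b| <= K ->
    (a - Wp * b * v) ^+ 2 <= 2 * a ^+ 2 + 2 * (K ^+ 2 * (Wp ^+ 2 * v ^+ 2)).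
  move=> bK; have u : b ^+ 2 * (Wp ^+ 2 * v ^+ 2) <= K ^+ 2 * (Wp ^+ 2 * v ^+ 2).
    apply: ler_wpM2r; first by apply: mulr_ge0; exact: sqr_ge0.
    by rewrite -[b ^+ 2]real_normK ?num_real // lerXn2r ?nnegrE // (le_trans _ bK).
  have : 0 <= (a + Wp * b * v) ^+ 2 by exact: sqr_ge0.
  move: u; move: (K ^+ 2 * _) => B.
  have -> : (a + Wp * b * v) ^+ 2 = 2 * a ^+ 2 + 2 * (b ^+ 2 * (Wp ^+ 2 * v ^+ 2))
    - (a - Wp * b * v) ^+ 2 by ring.
  by clear; lra.
have := lerD (step x p1 h1) (step y p2 h2).
by move/le_trans; apply; rewrite le_eqVlt; apply/orP; left; apply/eqP; ring.
Qed.

Lemma conjugate_back {R : realType} (K lam Wp e zx zy zv p1 p2 : R) : 4 <= K -> 0 <= lam ->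
  0 <= Wp -> `|p1| <= K -> `|p2| <= K ->
  (lam * Wp * (zx ^+ 2 + zy ^+ 2) + lam * Wp ^+ 3 * zv ^+ 2) * e ^+ 2 <=
  5 * K ^+ 2 * lam * (Wp * ((e * (zx + Wp * p1 * zv)) ^+ 2 + (e * (zy + Wp * p2 * zv)) ^+ 2)
     + Wp ^+ 3 * (e * zv) ^+ 2).
Proof.
move=> K4 l0 W0 h1 h2; have := conjugate_grad Wp e zx zy zv h1 h2.
move: (_ ^+ 2 + (e * (zy + _)) ^+ 2) (addr_ge0 (sqr_ge0 (e * (zx + Wp * p1 * zv)))
  (sqr_ge0 (e * (zy + Wp * p2 * zv)))) => S S0 h.
have -> : (lam * Wp * (zx ^+ 2 + zy ^+ 2) + lam * Wp ^+ 3 * zv ^+ 2) * e ^+ 2 =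
   (lam * Wp) * ((zx ^+ 2 + zy ^+ 2) * e ^+ 2 + Wp ^+ 2 * (e * zv) ^+ 2) by ring.
have -> : 5 * K ^+ 2 * lam * (Wp * S + Wp ^+ 3 * (e * zv) ^+ 2) =
   (lam * Wp) * (5 * K ^+ 2 * S + 5 * K ^+ 2 * (Wp ^+ 2 * (e * zv) ^+ 2)) by ring.
apply: ler_wpM2l; first exact: mulr_ge0.
have w0 : 0 <= Wp ^+ 2 * (e * zv) ^+ 2 by apply: mulr_ge0; exact: sqr_ge0.
have K1 : 1 <= K ^+ 2 by rewrite exprn_ege1 //; clear -K4; lra.
have w1 := ler_wpM2r w0 K1; have w2 := ler_wpM2r S0 K1.
move: h w1 w2 S0; rewrite !mul1r; set a := Wp ^+ 2 * _; set c := _ * e ^+ 2.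
by move: a c (K ^+ 2); clear => *; lra.
Qed.

Lemma max0_sub {R : realType} (x : R) : Num.max x 0 - Num.max (- x) 0 = x.
Proof. by rewrite /Num.max; case: (ltP x 0) => h1; case: (ltP (- x) 0) => h2; lra. Qed.

Section PointwiseCarleman.
Context {R : realType}.

(** The constants of the estimate depend on the coefficients through K and k only. *)
Definition coef_bounds (O : set (R * R)) (T : R) (Psi : C2fun O T) (sg chi : C1fun O T)
    (nu K k : R) (p : R * (R * R)) : Prop :=
  [/\ [/\ `|nu| <= K, k <= nu, k <= sg p, 0 <= chi p &
        (k <= cx Psi p ^+ 2 + cy Psi p ^+ 2 \/ 1 <= chi p)],
      [/\ 0 <= Psi p <= 1, `|ct Psi p| <= K, `|cx Psi p| <= K & `|cy Psi p| <= K],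
      [/\ `|dX (cx Psi) p| <= K, `|dX (cy Psi) p| <= K & `|dY (cy Psi) p| <= K],
      [/\ `|dT (cx Psi) p| <= K, `|dT (cy Psi) p| <= K & `|dT (ct Psi) p| <= K] &
      [/\ `|sg p| <= K, `|dT sg p| <= K, `|dX sg p| <= K & `|dY sg p| <= K] /\
      [/\ `|chi p| <= K, `|dT chi p| <= K, `|dX chi p| <= K & `|dY chi p| <= K]].

(** For lam >= lam0 half of lam k^4 beats K^N in carleman_pointwise; the left-hand side
is then rewritten in terms of z by conjugate_back. *)
Lemma weighted_pointwise (K k : R) : 4 <= K -> 0 < k -> k <= 2^-1 -> k^-1 <= K ->
  exists lam0, forall (O : set (R * R)) (T : R) (Psi z : C2fun O T)
    (sg chi th tht : C1fun O T) (nu m lam s : R) (p : R * (R * R)),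
  dT th = tht -> (forall p, dX th p = 0) -> (forall p, dY th p = 0) ->
  (forall p, dX tht p = 0) -> (forall p, dY tht p = 0) ->
  cyl T O p -> coef_bounds Psi sg chi nu K k p ->
  1 <= m -> 1 <= lam -> lam0 <= lam -> 1 <= s -> 1 <= th p ->
  2 * tht p <= K * th p ^+ 2 ->
  2 * dT tht p <= K * (th p ^+ 3 + mu_par m s lam ^+ 2) ->
  let Wp := W Psi th m lam s p in
  k ^+ 4 / (10 * K ^+ 2) * ((lam * Wp * (cx z p ^+ 2 + cy z p ^+ 2) + lam * Wp ^+ 3 * z p ^+ 2)
    * Ewt Psi th m lam s p ^+ 2)
  + (dX (flux1 Psi z sg chi th tht nu m lam s) p + dY (flux2 Psi z sg chi th tht nu m lam s) p
     - dT (energy Psi z sg chi th tht nu m lam s) p)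
  <= 3 * rhs Psi z sg th nu m lam s p ^+ 2
     + K ^+ 5 * lam * Wp ^+ 3 * chi p * wv Psi z th m lam s p ^+ 2.
Proof.
move=> K4 k0 k2 kK; have [N HN] := carleman_pointwise K4 k0 k2 kK.
exists (2 * K ^+ N / k ^+ 4) => O T Psi z sg chi th tht nu m lam s p th_t th_x th_y tht_x tht_y Up.
case=> [[b1 b2 b3 b4 b5] [psi01 c1 c2 c3] [d1 d2 d3] [e1 e2 e3] [[f1 f2 f3 f4] [g1 g2 g3 g4]]].
move=> m1 lam1 lamN s1 th1 tht1 tht2; cbv zeta; set Wp := W Psi th m lam s p.
have K0 : 0 <= K / 2 by clear -K4; lra.
have tht1' : tht p <= K / 2 * th p ^+ 2 by clear -tht1; lra.
have tht2' : dT tht p <= K / 2 * (th p ^+ 3 + mu_par m s lam ^+ 2) by clear -tht2; lra.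
have := weight_bounds m1 lam1 s1 psi01 K0 th1 tht1' tht2'.
have -> : 2 * (K / 2) = K by field.
set e := expR _; set L := lam * expR _ => /=.
have eE : ewt Psi m lam p = e by rewrite /ewt -lock.
have LE : Lam m lam = L by [].
have WE : s * lam * th p * e = Wp by rewrite /Wp W_val eE; ring.
rewrite WE; set beta := s * Num.max (- _) 0 * _; set tp := s * _ * _.
have rE : s * lam * tht p * e = rho Psi tht m lam s p by rewrite /rho eE.
rewrite rE; move=> [w1 [w2 w3] w4 [w5 w6] w7].
have tb : s * (tht p * (L - e)) = tp - beta.
  rewrite /tp /beta -mulrBl -mulrBr mulrA; congr (s * _ * _).
  by rewrite max0_sub.
have PtE : Phit Psi th tht m lam s p = tp - beta - ct Psi p * Wp.
  by rewrite /Phit -lock !C1E -tb LE eE.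
have := HN nu lam Wp beta tp (rho Psi tht m lam s p) (s * dT tht p * (L - e))
  (ct Psi p) (cx Psi p) (cy Psi p) (dX (cx Psi) p) (dX (cy Psi) p) (dY (cy Psi) p)
  (dT (cx Psi) p) (dT (cy Psi) p) (dT (ct Psi) p)
  (sg p) (dT sg p) (dX sg p) (dY sg p) (chi p) (dT chi p) (dX chi p) (dY chi p)
  (wv Psi z th m lam s p) (wt Psi z th tht m lam s p) (wx Psi z th m lam s p)
  (wy Psi z th m lam s p) (dX (wx Psi z th m lam s) p) (dX (wy Psi z th m lam s) p)
  (dY (wy Psi z th m lam s) p) (dT (wx Psi z th m lam s) p) (dT (wy Psi z th m lam s) p).
move=> /(_ lam1 w1 w2 w3 w4 w5 w6 w7).
move=> /(_ b1 c1 c2 c3 d1 d2 d3 e1 e2 e3 f1 f2 f3 f4 g1 g2 g3 g4).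
move=> /(_ b2 b3 b4 b5).
rewrite (flux_div_C1 Psi z sg chi th_t th_x th_y tht_x tht_y nu m lam s Up).
rewrite (rhs_conj Psi z sg tht th_x th_y nu m lam s p).
rewrite (V_t _ _ th_t) (V_x Psi sg tht th_x nu m lam s Up) (V_y Psi sg tht th_y nu m lam s Up).
rewrite (Phit_t _ th_t) (Phit_x Psi th_x tht_x m lam s Up) (Phit_y Psi th_y tht_y m lam s Up) gr2_val eE LE -/Wp.
have -> : V Psi sg th tht nu m lam s p = - nu * Wp ^+ 2 * (cx Psi p ^+ 2 + cy Psi p ^+ 2)
   - sg p * (tp - beta - ct Psi p * Wp).
  by rewrite /V -lock !C1E PtE gr2_val -/Wp; ring.
rewrite PtE.
cbv zeta.
set FD := flux_div _ _ _ _ _ _ _ _ _ _ _ _ _ _ _ _ _ _ _ _ _ _ _ _ _ _ _ _ _ _ _ _ _.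
set q := (X in 3 * X ^+ 2).
clearbody FD q; clear HN.
move: (rho _ _ _ _ _ _) w5 w6 rE => r w5 w6 rE; move=> main.
have W0 : 0 <= Wp by apply: le_trans w1; exact: sqr_ge0.
have lam0 : 0 <= lam by clear -lam1; lra.
have := conjugate_back (Ewt Psi th m lam s p) (cx z p) (cy z p) (z p) K4 lam0 W0 c2 c3.
have -> : Ewt Psi th m lam s p * (cx z p + Wp * cx Psi p * z p) = wx Psi z th m lam s p.
  by rewrite /wx -lock !C1E.
have -> : Ewt Psi th m lam s p * (cy z p + Wp * cy Psi p * z p) = wy Psi z th m lam s p.
  by rewrite /wy -lock !C1E.
have -> : Ewt Psi th m lam s p * z p = wv Psi z th m lam s p by rewrite /wv -lock !C1E.
move: main; move: (wx _ _ _ _ _ _ _ ^+ 2 + _) (addr_ge0 (sqr_ge0 (wx Psi z th m lam s p)) (sqr_ge0 (wy Psi z th m lam s p))) => S S0.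
have v0 := sqr_ge0 (wv Psi z th m lam s p); move: (wv _ _ _ _ _ _ _ ^+ 2) v0 => v v0 main.
set B := _ * Ewt _ _ _ _ _ _ ^+ 2; clearbody B => hB.
have k40 : 0 < k ^+ 4 by rewrite exprn_gt0.
have KK : 0 < 10 * K ^+ 2 by rewrite mulr_gt0 // exprn_gt0 //; clear -K4; lra.
have h1 : k ^+ 4 / (10 * K ^+ 2) * B <= lam * k ^+ 4 / 2 * (Wp * S + Wp ^+ 3 * v).
  have := ler_wpM2l (divr_ge0 (ltW k40) (ltW KK)) hB.
  have -> // : k ^+ 4 / (10 * K ^+ 2) * (5 * K ^+ 2 * lam * (Wp * S + Wp ^+ 3 * v))
     = lam * k ^+ 4 / 2 * (Wp * S + Wp ^+ 3 * v).
  by field; rewrite gt_eqF //; clear -K4; lra.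
have lN : 2 * K ^+ N <= lam * k ^+ 4 by move: lamN; rewrite ler_pdivrMr.
have h2 : lam * k ^+ 4 / 2 * (Wp * S + Wp ^+ 3 * v) <=
   (lam * k ^+ 4 - K ^+ N) * (Wp * S + Wp * (Wp ^+ 2 + beta) * v).
  have W30 : 0 <= Wp ^+ 3 by exact: exprn_ge0.
  apply: ler_pM => //.
  - by rewrite divr_ge0 // mulr_ge0 // ltW.
  - by rewrite addr_ge0 // mulr_ge0.
  - by move: lN; move: (lam * _) (K ^+ N); clear => *; lra.
  - rewrite lerD2l ler_wpM2r // (_ : Wp * (Wp ^+ 2 + beta) = Wp ^+ 3 + Wp * beta); last by ring.
    by rewrite lerDl mulr_ge0.
move: main h1 h2; clear.
set x := (_ - _) * (_ + _); set y := _ * B; set t := _ / 2 * _.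
by move: (3 * _) (K ^+ 5 * _ * _ * _ * v) x y t => *; lra.
Qed.
End PointwiseCarleman.

(** * The flux near the lateral boundary *)

Section LateralStrip.
Context {R : realType}.
Let E := (R * (R * R))%type.
Variables (O : set (R * R)) (hO : bounded_domain O) (T : R).

Lemma lateral_dT (F : C1fun O T) (t : R) (y : R * R) : 0 < t < T -> closure O y ->
  (forall s, 0 < s < T -> F (s, y) = 0) -> dT F (t, y) = 0.
Proof.
move=> tT hy F0.
have l (h : R) : ((t, y) : E) + h *: et = (t + h, y).
  apply: injective_projections; last apply: injective_projections.
  - by change (t + h * 1 = t + h); rewrite mulr1.
  - by change (y.1 + h * 0 = y.1); rewrite mulr0 addr0.
  - by change (y.2 + h * 0 = y.2); rewrite mulr0 addr0.
have /is_derive_line0 [_ <-] := is_dT_closure F tT hy.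
have [_ dc] := is_derive_cst (0 : R) (0 : R) (1 : R); rewrite -[RHS]dc.
apply: near_eq_derive.
have r0 : 0 < Num.min t (T - t) by case/andP: tT => a b; rewrite lt_min a subr_gt0.
apply/nbhs_ballP; exists (Num.min t (T - t)) => // h.
rewrite /ball /= sub0r normrN lt_min !ltr_norml => /andP[/andP[h1 h2] /andP[h3 h4]].
by rewrite l F0 //; apply/andP; split; lra.
Qed.

Lemma cts_bound (f : E -> R) : cts (slab O T) f ->
  exists2 M, 0 < M & forall p, cyl T O p -> `|f p| <= M.
Proof.
move=> cf; have [M M0 hM] := cts_bounded (compact_slab hO (T := T)) cf.
by exists M => // p /cyl_slab; exact: hM.
Qed.

Variables (Psi z : C2fun O T) (sg chi th tht : C1fun O T).
Hypotheses (th_t : dT th = tht) (th_x : forall p, dX th p = 0) (th_y : forall p, dY th p = 0).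
Hypotheses (tht_x : forall p, dX tht p = 0) (tht_y : forall p, dY tht p = 0).
Hypothesis th0 : forall p, cyl T O p -> 0 <= th p.
Variables (nu m lam s alpha : R).
Hypotheses (a0 : 0 < alpha) (sl0 : 0 <= s * lam).
Variables (D : C1fun O T) (y0 : R * R) (h0 : bdry O y0).
Hypothesis Psi_bdry : forall (t : R) (y : R * R), 0 < t < T -> bdry O y ->
  Psi (t, y) = Psi (t, y0).
Hypothesis Psi_min : forall (t : R) (x : R * R), 0 < t < T -> O x ->
  Psi (t, y0) <= Psi (t, x).
Hypothesis z0 : forall (t : R) (y : R * R), 0 < t < T -> bdry O y -> z (t, y) = 0.
Variable e : R.
Hypotheses (e0 : 0 < e) (strip : forall p, cyl T O p -> D p <= e ->
   [/\ chi p = 0, D p = Psi p - Psi (p.1, y0), dX D p = cx Psi p,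
         dY D p = cy Psi p & dT D p = ct Psi p - ct Psi (p.1, y0)]).
Hypothesis grad : forall p, cyl T O p -> D p <= e ->
  alpha ^+ 2 <= cx Psi p ^+ 2 + cy Psi p ^+ 2.

Let F1 := flux1 Psi z sg chi th tht nu m lam s.
Let F2 := flux2 Psi z sg chi th tht nu m lam s.
Let G := energy Psi z sg chi th tht nu m lam s.

(** In the layer the cut-off vanishes and grad D = grad Psi. The scalar product of
the flux with grad Psi is
  2 nu sg wt X - 2 nu^2 W X^2 + 2 nu^2 W h^2 - w ( ... ),
with X = grad Psi . grad w and h the derivative of w orthogonal to grad Psi. The
square of X has the good sign, and the other terms are O(D): w, wt and dT D vanish
on the lateral boundary, and h^2 = O(D) by tangential_bound. *)
Lemma flux_strip : exists C e' : R, [/\ 0 <= C, 0 < e' &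
  forall p, cyl T O p -> D p <= e' ->
    dX D p * F1 p + dY D p * F2 p - dT D p * G p <= C * D p].
Proof.
pose w := wf Psi z th_t th_x th_y tht_x tht_y m lam s.
have w0 (t : R) (y : R * R) : 0 < t < T -> bdry O y -> w (t, y) = 0.
  by move=> tT hy; rewrite /w /= /wv -lock !C1E z0 // mulr0.
have wt0 (t : R) (y : R * R) : 0 < t < T -> bdry O y -> ct w (t, y) = 0.
  by move=> tT hy; have := lateral_dT tT hy.1 (fun u uT => w0 u y uT hy); rewrite dT_c0.
pose P0 := C1add (ct Psi) (C1opp (trace h0.1 (ct Psi))).
have P00 (t : R) (y : R * R) : 0 < t < T -> bdry O y -> P0 (t, y) = 0.
  move=> tT hy; pose Q := C1add Psi (C1opp (trace h0.1 Psi)).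
  have Q0 u : 0 < u < T -> Q (u, y) = 0.
    by move=> uT; change (Psi (u, y) - Psi (u, y0) = 0); rewrite (Psi_bdry uT hy) subrr.
  have := lateral_dT tT hy.1 Q0.
  by change (dT Psi (t, y) - dT Psi (t, y0) = 0 -> P0 (t, y) = 0); rewrite dT_c0.
have [C1 [e1 [C10 e10 h1]]] := vanish_bound hO a0 Psi_bdry Psi_min w0.
have [C2 [e2 [C20 e20 h2]]] := vanish_bound hO a0 Psi_bdry Psi_min wt0.
have [C3 [e3 [C30 e30 h3]]] := vanish_bound hO a0 Psi_bdry Psi_min P00.
have [C4 [e4 [C40 e40 h4]]] := tangential_bound hO a0 Psi_bdry Psi_min w0.
pose X := scal Psi z th m lam s; pose Wf := W Psi th m lam s; pose gf := gr2 Psi.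
pose Vf := V Psi sg th tht nu m lam s.
have [M1 M10 b1] := cts_bound (cts_val (C1mul (C1mul (C1cst O T (2 * nu)) sg) X)).
have [M2 M20 b2] := cts_bound (cts_val (C1add (C1mul (C1cst O T (4 * nu ^+ 2 * lam))
   (C1mul (C1mul Wf gf) X)) (C1opp (C1mul (C1cst O T (2 * nu)) (C1mul (C1mul Vf Wf) (C1mul gf w)))))).
have [M3 M30 b3] := cts_bound (cts_val G).
have [M4 M40 b4] := cts_bound (cts_val (C1mul (C1cst O T (2 * nu ^+ 2)) Wf)).
exists (M1 * C2 + M2 * C1 + M3 * C3 + M4 * C4),
  (Num.min e (Num.min e1 (Num.min e2 (Num.min e3 e4)))); split.
- by rewrite !addr_ge0 // mulr_ge0 // ltW.
- by rewrite !lt_min e0 e10 e20 e30 e40.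
move=> p Up; rewrite !le_min => /and5P[De De1 De2 De3 De4].
have [ch0 DE DX DY DT] := strip Up De.
have gp := grad Up De.
have [p1 Op] := Up; have tT : 0 < p.1 < T by move: p1; rewrite /= in_itv.
rewrite DE in De1 De2 De3 De4.
move: (h1 p.1 p.2 tT Op) (h2 p.1 p.2 tT Op) (h3 p.1 p.2 tT Op) (h4 p.1 p.2 tT Op).
rewrite -surjective_pairing -DE in De1 De2 De3 De4 *.
move=> /(_ gp De1) k1 /(_ gp De2) k2 /(_ gp De3) k3 /(_ gp De4) k4.
move: (b1 _ Up) (b2 _ Up) (b3 _ Up) (b4 _ Up) => c1 c2 c3 c4.
pose h := cx Psi p * cy w p - cy Psi p * cx w p.
have W0 : 0 <= Wf p.
  rewrite /Wf W_val /ewt -lock; apply: mulr_ge0 => //; apply: mulr_ge0; first exact: th0.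
  exact: expR_ge0.
have key : dX D p * F1 p + dY D p * F2 p =
   (2 * nu * sg p * X p) * ct w p - 2 * nu ^+ 2 * (Wf p * X p ^+ 2)
   + (2 * nu ^+ 2 * Wf p) * h ^+ 2
   - (4 * nu ^+ 2 * lam * (Wf p * gf p * X p) - 2 * nu * (Vf p * Wf p * (gf p * w p))) * w p.
  rewrite DX DY /F1 /F2 /flux1 /flux2 /flux !C1E.
  have -> : eta Psi chi th m lam s p = 0 by rewrite /eta -lock !C1E ch0 !mulr0.
  rewrite /h /Vf /Wf /X /scal /gf /gr2 /gw2 -!lock !C1E.
  have -> : cx w p = wx Psi z th m lam s p by [].
  have -> : cy w p = wy Psi z th m lam s p by [].
  have -> : ct w p = wt Psi z th tht m lam s p by [].
  have -> : c0 w p = wv Psi z th m lam s p by [].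
  by ring.
have bd (a b A B : R) : `|a| <= A -> `|b| <= B -> 0 < A -> a * b <= A * B.
  move=> ha hb A0; apply: le_trans (ler_norm _) _; rewrite normrM; exact: ler_pM.
have D0 : 0 <= D p by rewrite DE subr_ge0 {2}(surjective_pairing p); exact: Psi_min.
have q1 := bd _ _ _ _ c1 k2 M10.
have q2 : - ((4 * nu ^+ 2 * lam * (Wf p * gf p * X p)
    - 2 * nu * (Vf p * Wf p * (gf p * w p))) * w p) <= M2 * (C1 * D p).
  by rewrite -mulNr; apply: bd => //; rewrite normrN; exact: c2.
have q3 : - (dT D p * G p) <= M3 * (C3 * D p).
  rewrite -mulNr mulrC; apply: bd => //; rewrite normrN DT; exact: k3.
have q4 : (2 * nu ^+ 2 * Wf p) * h ^+ 2 <= M4 * (C4 * D p).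
  by apply: bd => //; rewrite ger0_norm ?sqr_ge0.
have q5 : 0 <= 2 * nu ^+ 2 * (Wf p * X p ^+ 2).
  by apply: mulr_ge0; apply: mulr_ge0 => //; exact: sqr_ge0.
rewrite key.
have -> : (M1 * C2 + M2 * C1 + M3 * C3 + M4 * C4) * D p =
  M1 * (C2 * D p) + M2 * (C1 * D p) + M3 * (C3 * D p) + M4 * (C4 * D p) by ring.
have q1' : 2 * nu * sg p * X p * ct w p <= M1 * (C2 * D p) by exact: q1.
move: q1' q2 q3 q4 q5; clear.
set A1 := 2 * nu * sg p * X p * _; set A2 := (_ - _) * w p; set A3 := _ * G p.
set A4 := _ * h ^+ 2; set A5 := _ * (Wf p * _).
by move: A1 A2 A3 A4 A5 (M1 * _) (M2 * _) (M3 * _) (M4 * _) => *; lra.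
Qed.
End LateralStrip.

(** * The energy at the initial time *)

(** Y is the common size of W^2 and, up to a factor lam, of the time derivative of
the exponent at t = 0, where theta = 2. *)
Lemma initial_weights {R : realType} (m lam s e : R) : 1 <= m -> 1 <= lam -> 1 <= s ->
  lam <= e -> (1 + lam) * e <= Lam m lam -> e <= expR (lam * (6 * m + 1)) ->
  let Y := s ^+ 2 * lam ^+ 2 * expR (2 * lam * (6 * m + 1)) in
  let Wp := s * lam * (2 * e) in
  [/\ 1 <= Wp, Wp ^+ 2 <= 4 * Y & lam / 2 * Y <= s * mu_par m s lam * (Lam m lam - e)].
Proof.
move=> m1 lam1 s1 le eL eE Y Wp.
have lam0 : 0 <= lam by lra.
have s0 : 0 <= s by lra.
have e0 : 0 <= e by lra.
split.
- rewrite -[1]mulr1 /Wp; apply: ler_pM => //; last by lra.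
  by rewrite -[1]mulr1; apply: ler_pM.
- have -> : Wp ^+ 2 = 4 * (s ^+ 2 * lam ^+ 2 * e ^+ 2) by rewrite /Wp; ring.
  rewrite ler_pM2l // /Y ler_wpM2l ?mulr_ge0 ?exprn_ge0 //.
  have -> : expR (2 * lam * (6 * m + 1)) = expR (lam * (6 * m + 1)) ^+ 2.
    by rewrite -expRM_natl; congr expR; ring.
  by rewrite lerXn2r ?nnegrE ?expR_ge0.
- have -> : lam / 2 * Y = s * mu_par m s lam * (Lam m lam / 2).
    have -> : Y = s ^+ 2 * lam ^+ 2 * (expR (lam * (6 * m - 4)) * expR (6 * lam * (m + 1))).
      by rewrite /Y -expRD; congr (_ * expR _); ring.
    by rewrite /Lam /mu_par; field.
  rewrite ler_wpM2l; first by [].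
    by rewrite mulr_ge0 // mulr_ge0 ?expR_ge0 // mulr_ge0 // exprn_ge0.
  have : 2 * e <= (1 + lam) * e by apply: ler_wpM2r => //; lra.
  by move: eL; move: ((1 + lam) * e) (Lam m lam); clear => *; lra.
Qed.

(** At t = 0 the slope of theta is - mu / T0, and mu is tuned so that s mu Lam is
exactly lam times the square of s lam e^{lam (6 m + 1)}, which bounds s lam e^{lam psi}:
the potential V is then positive and of that size, for lam large. *)
Lemma initial_energy {R : realType} (K k t0 : R) : 4 <= K -> 0 < k -> 0 < t0 ->
  exists c lam0, 0 < c /\ forall (O : set (R * R)) (T : R) (Psi z : C2fun O T)
  (sg chi th tht : C1fun O T) (nu m lam s : R) (p : R * (R * R)),
  k <= nu -> `|nu| <= K -> k <= sg p -> `|sg p| <= K -> 0 <= chi p ->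
  0 <= Psi p <= 1 -> `|ct Psi p| <= K -> `|cx Psi p| <= K -> `|cy Psi p| <= K ->
  1 <= m -> 1 <= lam -> lam0 <= lam -> 1 <= s ->
  th p = 2 -> tht p = - (mu_par m s lam / t0) ->
  c * ((cx z p ^+ 2 + cy z p ^+ 2
        + s ^+ 2 * lam ^+ 3 * expR (2 * lam * (6 * m + 1)) * z p ^+ 2)
       * Ewt Psi th m lam s p ^+ 2) <= energy Psi z sg chi th tht nu m lam s p.
Proof.
move=> K4 k0 t00.
have K0 : 0 <= K by lra.
pose c1 := k / (4 * t0).
have c10 : 0 < c1 by rewrite divr_gt0 // mulr_gt0.
pose c := Num.min (k ^+ 2 / 2) (k * c1 / (16 * K ^+ 2 + 1)).
have K2 : 0 <= K ^+ 2 by exact: sqr_ge0.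
have K161 : 0 < 16 * K ^+ 2 + 1 by move: K2; clear; move: (K ^+ 2) => *; lra.
have c0 : 0 < c by rewrite lt_min; apply/andP; split; apply: divr_gt0 => //; [exact: exprn_gt0 | exact: mulr_gt0].
exists c, ((8 * K ^+ 3 + 4 * K ^+ 2) / c1); split => //.
move=> O T Psi z sg chi th tht nu m lam s p nuk nuK sgk sgK ch0 psi01 tK xK yK m1 lam1 lamN s1 thp thtp.
have [le eL _ _] := weight_facts m1 lam1 s1 psi01.
set e := expR (lam * (Psi p + _)) in le eL; rewrite -/(Lam m lam) in eL.
have eE : ewt Psi m lam p = e by rewrite /ewt -lock.
have lam0 : 0 <= lam by lra.
have e7 : e <= expR (lam * (6 * m + 1)).
  by rewrite ler_expR ler_wpM2l //; case/andP: psi01; lra.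
have [W1 WY mY] := initial_weights m1 lam1 s1 le eL e7.
set Y := s ^+ 2 * lam ^+ 2 * _ in WY mY.
have Y0 : 0 <= Y by rewrite mulr_ge0 ?expR_ge0 // mulr_ge0 ?exprn_ge0 //; lra.
have WE : W Psi th m lam s p = s * lam * (2 * e) by rewrite W_val eE thp.
rewrite -WE in W1 WY; set Wp := W Psi th m lam s p in W1 WY.
have VE : V Psi sg th tht nu m lam s p = - (nu * Wp ^+ 2 * (cx Psi p ^+ 2 + cy Psi p ^+ 2))
   + sg p / t0 * (s * mu_par m s lam * (Lam m lam - e)) + sg p * ct Psi p * Wp.
  rewrite /V /Phit /gr2 -!lock !C1E eE -/Wp thtp.
  by field; rewrite gt_eqF.
have sqK (a : R) : `|a| <= K -> a ^+ 2 <= K ^+ 2.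
  by move=> aK; rewrite -[a ^+ 2]real_normK ?num_real // lerXn2r ?nnegrE.
have sg0 : 0 <= sg p by apply: le_trans sgk; exact: ltW.
have nu0 : 0 <= nu by apply: le_trans nuk; exact: ltW.
have V1 : nu * Wp ^+ 2 * (cx Psi p ^+ 2 + cy Psi p ^+ 2) <= 8 * K ^+ 3 * Y.
  have -> : 8 * K ^+ 3 * Y = K * (4 * Y) * (K ^+ 2 + K ^+ 2) by ring.
  apply: ler_pM.
  - by rewrite mulr_ge0 // sqr_ge0.
  - by apply: addr_ge0; exact: sqr_ge0.
  - by apply: ler_pM => //; [exact: sqr_ge0 | rewrite -[nu]ger0_norm].
  - by apply: lerD; exact: sqK.
have V2 : c1 * 2 * lam * Y <= sg p / t0 * (s * mu_par m s lam * (Lam m lam - e)).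
  have -> : c1 * 2 * lam * Y = k / t0 * (lam / 2 * Y) by rewrite /c1; field; rewrite gt_eqF.
  apply: ler_pM => //.
  - by rewrite divr_ge0 // ltW.
  - by apply: mulr_ge0 => //; rewrite divr_ge0.
  - by rewrite ler_pM2r // invr_gt0.
have V3 : - (4 * K ^+ 2 * Y) <= sg p * ct Psi p * Wp.
  rewrite lerNl; apply: (le_trans (ler_norm _)); rewrite normrN !normrM.
  have -> : 4 * K ^+ 2 * Y = K * K * (4 * Y) by ring.
  apply: ler_pM => //; rewrite ?mulr_ge0 //; first exact: ler_pM.
  have Wp0 : 0 <= Wp by lra.
  by rewrite ger0_norm //; apply: le_trans WY; rewrite expr2 ler_peMl.
have lN : (8 * K ^+ 3 + 4 * K ^+ 2) * Y <= c1 * lam * Y.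
  by apply: ler_wpM2r => //; move: lamN; rewrite ler_pdivrMr // [lam * _]mulrC.
have Vlow : c1 * lam * Y <= V Psi sg th tht nu m lam s p.
  by rewrite VE; move: V1 V2 V3 lN; clear; set a := nu * _ * _; set b := _ * (s * _ * _);
    set d := _ * Wp; move: a b d => *; lra.
have lY : s ^+ 2 * lam ^+ 3 * expR (2 * lam * (6 * m + 1)) = lam * Y by rewrite /Y; ring.
rewrite lY.
have wvE : Ewt Psi th m lam s p * z p = wv Psi z th m lam s p by rewrite /wv -lock !C1E.
have := conjugate_grad Wp (Ewt Psi th m lam s p) (cx z p) (cy z p) (z p) xK yK.
have -> : Ewt Psi th m lam s p * (cx z p + Wp * cx Psi p * z p) = wx Psi z th m lam s p.
  by rewrite /wx -lock !C1E.
have -> : Ewt Psi th m lam s p * (cy z p + Wp * cy Psi p * z p) = wy Psi z th m lam s p.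
  by rewrite /wy -lock !C1E.
rewrite wvE => hg.
have -> : (cx z p ^+ 2 + cy z p ^+ 2 + lam * Y * z p ^+ 2) * Ewt Psi th m lam s p ^+ 2 =
  (cx z p ^+ 2 + cy z p ^+ 2) * Ewt Psi th m lam s p ^+ 2
   + lam * Y * wv Psi z th m lam s p ^+ 2 by rewrite -wvE; ring.
have -> : energy Psi z sg chi th tht nu m lam s p =
  nu * sg p * (wx Psi z th m lam s p ^+ 2 + wy Psi z th m lam s p ^+ 2)
  + sg p * V Psi sg th tht nu m lam s p * wv Psi z th m lam s p ^+ 2
  + 2^-1 * sg p * (lam * Wp * chi p) * wv Psi z th m lam s p ^+ 2.
  by rewrite /energy /gw2 /eta -!lock !C1E -/Wp; ring.
move: hg; move: (_ ^+ 2 + wy _ _ _ _ _ _ _ ^+ 2) (addr_ge0 (sqr_ge0 (wx Psi z th m lam s p))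
  (sqr_ge0 (wy Psi z th m lam s p))) => S S0.
move: (sqr_ge0 (wv Psi z th m lam s p)); move: (wv _ _ _ _ _ _ _ ^+ 2) => v v0.
move: ((_ + _) * _ ^+ 2) => B hB.
have lYv0 : 0 <= lam * Y * v by apply: mulr_ge0 => //; exact: mulr_ge0.
have B1 : B + lam * Y * v <= 2 * S + (16 * K ^+ 2 + 1) * (lam * Y * v).
  have h1 : 4 * K ^+ 2 * (Wp ^+ 2 * v) <= 16 * K ^+ 2 * (lam * Y * v).
    have -> : 16 * K ^+ 2 * (lam * Y * v) = 4 * K ^+ 2 * (lam * (4 * Y) * v) by ring.
    apply: ler_wpM2l; first by rewrite mulr_ge0.
    apply: ler_wpM2r => //; apply: (le_trans WY); rewrite ler_peMl // mulr_ge0 //.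
  by move: hB h1; clear; move: (lam * Y * v) (Wp ^+ 2 * v) (K ^+ 2) => *; lra.
apply: (le_trans (ler_wpM2l (ltW c0) B1)).
have E1 : c * (2 * S) <= nu * sg p * S.
  rewrite mulrA; apply: ler_wpM2r => //.
  have : c <= k ^+ 2 / 2 by rewrite /c ge_min lexx.
  have : k ^+ 2 <= nu * sg p by rewrite expr2; apply: ler_pM => //; exact: ltW.
  by clear; move: (k ^+ 2) (nu * sg p) => *; lra.
have E2 : c * ((16 * K ^+ 2 + 1) * (lam * Y * v)) <= sg p * V Psi sg th tht nu m lam s p * v.
  have h1 : c * (16 * K ^+ 2 + 1) <= k * c1.
    rewrite -ler_pdivlMr //.
    by rewrite /c ge_min lexx orbT.
  apply: (@le_trans _ _ (k * c1 * (lam * Y * v))).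
    by rewrite [leLHS]mulrA; exact: ler_wpM2r.
  have -> : k * c1 * (lam * Y * v) = k * (c1 * lam * Y) * v by ring.
  apply: ler_wpM2r => //; apply: ler_pM => //; first exact: ltW.
  by apply: mulr_ge0 => //; apply: mulr_ge0 => //; exact: ltW.
have E3 : 0 <= 2^-1 * sg p * (lam * Wp * chi p) * v.
  have Wp0 : 0 <= Wp by lra.
  by rewrite !mulr_ge0 // invr_ge0.
rewrite mulrDr.
move: E1 E2 E3; clear; set a := nu * _ * S; set b := _ * _ * v; set d := 2^-1 * _ * _ * v.
by move: a b d => *; lra.
Qed.

(** * The estimate before the final time *)

Notation I3 T O f := (\int[leb3 _]_(p in cyl T O) f p).
Notation I2 O f := (\int[leb2 _]_(x in O) f x).

Section SlabEstimate.
Context {R : realType}.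
Let E := (R * (R * R))%type.

Definition bulk O T (Psi z : C2fun O T) (th : C1fun O T) (m lam s : R) (p : E) : R :=
  (lam * W Psi th m lam s p * (cx z p ^+ 2 + cy z p ^+ 2)
   + lam * W Psi th m lam s p ^+ 3 * z p ^+ 2) * Ewt Psi th m lam s p ^+ 2.

Definition initial O T (Psi z : C2fun O T) (th : C1fun O T) (m lam s : R) (p : E) : R :=
  (cx z p ^+ 2 + cy z p ^+ 2
   + s ^+ 2 * lam ^+ 3 * expR (2 * lam * (6 * m + 1)) * z p ^+ 2)
  * Ewt Psi th m lam s p ^+ 2.

Definition source O T (Psi z : C2fun O T) (sg chi th : C1fun O T) (nu K m lam s : R)
    (p : E) : R :=
  3 * rhs Psi z sg th nu m lam s p ^+ 2
  + K ^+ 5 * lam * W Psi th m lam s p ^+ 3 * chi p * wv Psi z th m lam s p ^+ 2.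

Section Continuity.
Variables (O : set (R * R)) (T : R) (Psi z : C2fun O T) (sg chi th : C1fun O T).
Variables (nu K m lam s : R).

Lemma cts_bulk : cts (slab O T) (bulk Psi z th m lam s).
Proof. by rewrite /bulk; cts_rules. Qed.

Lemma cts_initial : cts (slab O T) (initial Psi z th m lam s).
Proof. by rewrite /initial; cts_rules. Qed.

Lemma cts_source : cts (slab O T) (source Psi z sg chi th nu K m lam s).
Proof. by rewrite /source /rhs /lapz; cts_rules. Qed.
End Continuity.

(** The pointwise inequality is integrated by energy_estimate, and the energy at t = 0
is bounded below by initial_energy. *)
Lemma slab_estimate (K k t0 : R) : 4 <= K -> 0 < k -> k <= 2^-1 -> k^-1 <= K -> 0 < t0 ->
  exists c lam0, 0 < c /\
  forall (O : set (R * R)) (hO : bounded_domain O) (T : R), 0 < T ->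
  forall (Psi z : C2fun O T) (sg chi th tht D : C1fun O T) (nu m lam s alpha : R) y0,
  dT th = tht -> (forall p, dX th p = 0) -> (forall p, dY th p = 0) ->
  (forall p, dX tht p = 0) -> (forall p, dY tht p = 0) ->
  1 <= m -> 1 <= lam -> lam0 <= lam -> 1 <= s ->
  (forall p, cyl T O p -> [/\ coef_bounds Psi sg chi nu K k p, 1 <= th p,
     2 * tht p <= K * th p ^+ 2 &
     2 * dT tht p <= K * (th p ^+ 3 + mu_par m s lam ^+ 2)]) ->
  (forall x, O x -> [/\ k <= sg (0, x), `|sg (0, x)| <= K, 0 <= chi (0, x) &
     0 <= Psi (0, x) <= 1] /\ [/\ `|ct Psi (0, x)| <= K, `|cx Psi (0, x)| <= K,
     `|cy Psi (0, x)| <= K, th (0, x) = 2 & tht (0, x) = - (mu_par m s lam / t0)]) ->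
  (forall (t : R) (y : R * R), 0 < t < T -> bdry O y -> z (t, y) = 0) ->
  0 < alpha -> bdry O y0 ->
  (forall (t : R) (y : R * R), 0 < t < T -> bdry O y -> Psi (t, y) = Psi (t, y0)) ->
  (forall (t : R) (x : R * R), 0 < t < T -> O x -> Psi (t, y0) <= Psi (t, x)) ->
  (forall (t : R) (y : R * R), 0 < t < T -> bdry O y -> D (t, y) = 0) ->
  (forall (t : R) (x : R * R), 0 <= t < T -> O x -> 0 < D (t, x)) ->
  (exists2 e : R, 0 < e & forall p, cyl T O p -> D p <= e ->
     [/\ chi p = 0, D p = Psi p - Psi (p.1, y0), dX D p = cx Psi p,
         dY D p = cy Psi p & dT D p = ct Psi p - ct Psi (p.1, y0)] /\
     alpha ^+ 2 <= cx Psi p ^+ 2 + cy Psi p ^+ 2) ->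
  c * I3 T O (bulk Psi z th m lam s)
  + c * I2 O (fun x => initial Psi z th m lam s (0, x)) <=
  I3 T O (source Psi z sg chi th nu K m lam s)
  + I2 O (fun x => `|energy Psi z sg chi th tht nu m lam s (T, x)|).
Proof.
move=> K4 k0 k2 kK t00.
have [l1 P] := weighted_pointwise K4 k0 k2 kK.
have [c2 [l2 [c20 Q]]] := initial_energy K4 k0 t00.
pose c1 := k ^+ 4 / (10 * K ^+ 2).
have c10 : 0 < c1.
  apply: divr_gt0; first exact: exprn_gt0.
  by apply: mulr_gt0 => //; apply: exprn_gt0; apply: lt_le_trans K4.
exists (Num.min c1 c2), (Num.max l1 l2); split; first by rewrite lt_min c10.
move=> O hO T T0 Psi z sg chi th tht D nu m lam s alpha y0 th_t th_x th_y tht_x tht_y.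
move=> m1 lam1; rewrite ge_max => /andP[lam1' lam2'] s1 B B0 z0 a0 h0 Pb Pm D0 Dpos [e e0 st].
have th0 p : cyl T O p -> 0 <= th p by move=> /B[_ h _ _]; apply: le_trans h.
have sl0 : 0 <= s * lam by rewrite mulr_ge0 //; [apply: le_trans s1 | apply: le_trans lam1].
have lam0 : 0 <= lam by apply: le_trans lam1.
have W0 p : cyl T O p -> 0 <= W Psi th m lam s p.
  move=> Up; rewrite W_val /ewt -lock; apply: mulr_ge0 => //.
  by apply: mulr_ge0; [exact: th0 | exact: expR_ge0].
have ch0 p : cyl T O p -> 0 <= chi p by move=> /B[[[_ _ _ h _]]].
have K0 : 0 <= K by apply: le_trans K4.
have [C [e' [C0 e'0 hs]]] := flux_strip hO sg th_t th_x th_y tht_x tht_y th0 nu m a0 sl0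
  (D := D) h0 (chi := chi) Pb Pm z0 e0 (fun p Up De => (st p Up De).1) (fun p Up De => (st p Up De).2).
have cL : cts (slab O T) (fun p => c1 * bulk Psi z th m lam s p).
  by apply: cts_mul; [exact: cts_cst | exact: cts_bulk].
have cS := @cts_source O T Psi z sg chi th nu K m lam s.
have S0 p : cyl T O p -> 0 <= source Psi z sg chi th nu K m lam s p.
  move=> Up; apply: addr_ge0; first by apply: mulr_ge0 => //; exact: sqr_ge0.
  apply: mulr_ge0; last exact: sqr_ge0.
  apply: mulr_ge0; last exact: ch0.
  apply: mulr_ge0; last by apply: exprn_ge0; exact: W0.
  by apply: mulr_ge0 => //; exact: exprn_ge0.
have LS p : cyl T O p -> c1 * bulk Psi z th m lam s p
    + (dX (flux1 Psi z sg chi th tht nu m lam s) p + dY (flux2 Psi z sg chi th tht nu m lam s) p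
     - dT (energy Psi z sg chi th tht nu m lam s) p) <= source Psi z sg chi th nu K m lam s p.
  move=> Up; have [b1 b2 b3 b4] := B p Up.
  exact: (P O T Psi z sg chi th tht nu m lam s p).
have := energy_estimate hO T0 cL cS S0 D0 Dpos LS C0 e'0 hs.
have cB := @cts_bulk O T Psi z th m lam s.
have cI := @cts_initial O T Psi z th m lam s.
rewrite I3Z //.
have Bpos : 0 <= I3 T O (bulk Psi z th m lam s).
  apply: Rintegral_ge0 => p Up; apply: mulr_ge0; last exact: sqr_ge0.
  have := W0 p Up => Wp.
  by apply: addr_ge0; apply: mulr_ge0; rewrite ?sqr_ge0 ?addr_ge0 ?sqr_ge0 ?mulr_ge0 ?exprn_ge0.
have Ipos x : O x -> 0 <= initial Psi z th m lam s (0, x).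
  move=> Ox; apply: mulr_ge0; last exact: sqr_ge0.
  apply: addr_ge0; first by apply: addr_ge0; exact: sqr_ge0.
  apply: mulr_ge0; last exact: sqr_ge0.
  apply: mulr_ge0; last exact: expR_ge0.
  by apply: mulr_ge0; [exact: sqr_ge0 | exact: exprn_ge0].
have TT : 0 <= (0 : R) <= T by rewrite lexx ltW.
have Gz : Num.min c1 c2 * I2 O (fun x => initial Psi z th m lam s (0, x)) <=
   I2 O (fun x => energy Psi z sg chi th tht nu m lam s (0, x)).
  apply: (@le_trans _ _ (I2 O (fun x => c2 * initial Psi z th m lam s (0, x)))).
    rewrite RintegralZl //; last exact: (slice_integrable hO _ (T := T)).
    + apply: ler_wpM2r; first exact: Rintegral_ge0.
      by rewrite ge_min lexx orbT.
    + exact: measurable_O.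
  apply: (I2_le hO (T := T) (f := fun p => c2 * initial Psi z th m lam s p)
    (g := energy Psi z sg chi th tht nu m lam s)) => //.
  - by apply: cts_mul => //; exact: cts_cst.
  - exact: cts_val.
  - move=> x Ox; have [[b1 b2 b3 b4] [b5 b6 b7 b8 b9]] := B0 x Ox.
    have [nuk nuK] : k <= nu /\ `|nu| <= K.
      have T2 : cyl T O (T / 2, x).
        by split => //=; rewrite in_itv /= divr_gt0 //= ltr_pdivrMr // ltr_pMr // ltr1n.
      by have [[[? ? _ _ _] _ _ _ _] _ _ _] := B _ T2.
    exact: Q.
have : Num.min c1 c2 * I3 T O (bulk Psi z th m lam s) <= c1 * I3 T O (bulk Psi z th m lam s).
  by apply: ler_wpM2r => //; rewrite ge_min lexx.
move: Gz; move: (Num.min c1 c2) => mm; clear.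
set a1 := Rintegral _ _ _; set a2 := Rintegral _ _ _; set a3 := Rintegral _ _ _.
set a4 := Rintegral _ _ _; set a5 := Rintegral _ _ _; move: a1 a2 a3 a4 a5 => *; lra.
Qed.
End SlabEstimate.

(** * The time weight *)

Section ThetaFacts.
Context {R : realType}.
Implicit Types (f g th : R -> R) (t u mu T : R).

Lemma is_derive_agree f g (l r t a b : R) : l < t < r ->
  (forall u, l < u < r -> f u = g u) ->
  is_derive t 1 f a -> is_derive t 1 g b -> a = b.
Proof.
move=> /andP[lt tr] fg [_ <-] [_ <-]; apply: near_eq_derive.
have : \forall u \near t, u \in `]l, r[.
  by apply: near_in_itvoo; rewrite in_itv /= lt.
by apply: filterS => u; rewrite in_itv /=; exact: fg.
Qed.

(** Used to extend what is known of theta on open intervals to their end points,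
theta being given by different formulas on both sides. *)
Lemma cts_closure_ge0 (A : set R) f t : cts A f -> A t ->
  (forall e, 0 < e -> exists u, [/\ A u, `|u - t| < e & 0 <= f u]) -> 0 <= f t.
Proof.
move=> cf At h; rewrite leNgt; apply/negP => ft0.
have e0 : 0 < - f t by rewrite oppr_gt0.
have /cts_eps /(_ _ e0)[d d0 hd] := cf t At.
have [u [Au ut fu]] := h _ d0.
by have := hd u Au ut; rewrite ltr_norml => /andP[_]; lra.
Qed.

Lemma cts_left_ge0 (l t T : R) f : 0 <= l < t -> t < T -> cts `[0, T[ f ->
  (forall u, l < u < t -> 0 <= f u) -> 0 <= f t.
Proof.
move=> /andP[l0 lt] tT cf h; apply: (cts_closure_ge0 cf).
  by rewrite /= in_itv /= tT andbT; apply: le_trans (ltW lt).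
move=> e e0; have m0 : 0 < Num.min e (t - l) by rewrite lt_min e0 subr_gt0.
have m1 : Num.min e (t - l) <= e by rewrite ge_min lexx.
have m2 : Num.min e (t - l) <= t - l by rewrite ge_min lexx orbT.
exists (t - Num.min e (t - l) / 2); split.
- by rewrite /= in_itv /=; apply/andP; split; lra.
- by rewrite ltr_norml; apply/andP; split; lra.
- by apply: h; apply/andP; split; lra.
Qed.

Lemma is_derive_powR_affine (a b r t : R) : 0 < a + b * t ->
  is_derive t 1 (fun u => (a + b * u) `^ r) (r * b * (a + b * t) `^ (r - 1)).
Proof.
move=> h.
have h2 : is_derive t 1 (fun u => a + b * u) b.
  have := is_deriveD (is_derive_cst a t (1 : R))
    (is_derive_mul (is_derive_cst b t (1 : R)) (is_derive_id t (1 : R))).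
  by congr (is_derive _ _ _ _); rewrite /cst /=; ring.
have := @is_derive1_comp R (fun x => x `^ r) (fun u => a + b * u) t _ _ (is_derive1_powR r h) h2.
by congr (is_derive _ _ _ _); ring.
Qed.

Definition C2ext T th th1 th2 : Prop :=
  [/\ cts `[0, T[ th, cts `[0, T[ th1, cts `[0, T[ th2,
   (forall t, 0 < t < T -> is_derive t 1 th (th1 t)) &
   (forall t, 0 < t < T -> is_derive t 1 th1 (th2 t))].

Lemma class_C2ext T th : class_C 2 `]0, T[ `[0, T[ th ->
  exists th1 th2, C2ext T th th1 th2.
Proof.
move=> [c0 /(_ 1)[d0 [th1 [e0 [c1 /(_ 1)[d1 [th2 [e1 [c2 _]]]]]]]]].
exists th1, th2; split; try by apply/ctsE.
- by move=> t tT; rewrite e0 /= ?in_itv //; apply: DeriveDef => //; apply: d0; rewrite /= in_itv.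
- by move=> t tT; rewrite e1 /= ?in_itv //; apply: DeriveDef => //; apply: d1; rewrite /= in_itv.
Qed.

Variables (T T0 T1 m : R) (Theta : R -> R -> R).
Hypotheses (T00 : 0 < T0) (T10 : 0 < T1) (T14 : T1 <= 1 / 4) (TT : T0 + 2 * T1 < T).
Hypotheses (m1 : 1 <= m) (hTheta : is_theta_family T T0 T1 m Theta).

Section FixedMu.
Variables (mu : R) (mu2 : 2 < mu).
Let th := Theta mu.
Let spec := hTheta.1 mu mu2.

Lemma theta_tail t : T - T1 <= t < T -> (T - t)^-1 <= th t.
Proof.
case/andP=> t1 t2; have [_ _ _ _ h] := spec; rewrite /th h ?t1 //.
have s0 : 0 < T - t by rewrite subr_gt0.
have s1 : T - t <= 1 by move: T14 t1; lra.
rewrite powRN lef_pV2 ?posrE ?powR_gt0 //.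
by apply: ge1r_powR => //; rewrite s0.
Qed.

Lemma theta_ge1 t : 0 <= t < T -> 1 <= th t.
Proof.
case/andP=> t0 tT; have [_ h1 h2 h3 _] := spec; rewrite -/th in h1 h2 h3.
have [a|a] := leP t T0; first by rewrite h1 ?t0 // lerDl powR_ge0.
have [b|b] := leP t (T - 2 * T1); first by rewrite h2 ?b ?(ltW a).
have [c|c] := leP t (T - T1).
  have <- : th (T - 2 * T1) = 1 by rewrite h2 // lexx andbT; move: TT; lra.
  apply: h3; rewrite ?in_itv /= ?c ?(ltW b) //.
  by rewrite lexx /=; move: T10; lra.
have h : T - T1 <= t < T by rewrite (ltW c).
apply: le_trans (theta_tail h); rewrite invf_ge1 ?subr_gt0 //.
by move: T14 c; lra.
Qed.

Variables (th1 th2 : R -> R) (ext : C2ext T th th1 th2).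

Lemma theta_initial t : 0 < t < T0 ->
  [/\ th t = 1 + (1 - t / T0) `^ mu,
      th1 t = - (mu / T0) * (1 - t / T0) `^ (mu - 1) &
      th2 t = mu * (mu - 1) / T0 ^+ 2 * (1 - t / T0) `^ (mu - 2)].
Proof.
have [_ _ _ d1 d2] := ext; have [_ h1 _ _ _] := spec; rewrite -/th in h1.
have tp u : 0 < u < T0 -> 0 < u < T.
  by case/andP=> a b; rewrite a /=; apply: (lt_trans b); move: TT T10; lra.
have pp u : 0 < u < T0 -> 0 < 1 + (- T0^-1) * u.
  by case/andP=> _ b; rewrite mulNr subr_gt0 mulrC ltr_pdivrMr // mul1r.
have pE u : 1 - u / T0 = 1 + (- T0^-1) * u by ring.
have e1 u : 0 < u < T0 -> th1 u = - (mu / T0) * (1 - u / T0) `^ (mu - 1).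
  move=> uT; have e u' : 0 < u' < T0 -> th u' = 1 + (1 + (- T0^-1) * u') `^ mu.
    by case/andP=> a b; rewrite h1 ?pE // (ltW a) ltW.
  rewrite (is_derive_agree uT e (d1 u (tp u uT))
    (is_deriveD (is_derive_cst (1:R) u (1:R)) (is_derive_powR_affine mu (pp u uT)))).
  by rewrite pE; ring.
move=> tT; split.
- by case/andP: tT => a b; rewrite h1 // (ltW a) ltW.
- exact: e1.
- have e u' : 0 < u' < T0 -> th1 u' = - (mu / T0) * (1 + (- T0^-1) * u') `^ (mu - 1).
    by move=> ?; rewrite e1 // pE.
  rewrite (is_derive_agree tT e (d2 t (tp t tT))
    (is_derive_mul (is_derive_cst (- (mu / T0) : R) t (1:R))
      (is_derive_powR_affine (mu - 1) (pp t tT)))).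
  rewrite pE (_ : mu - 1 - 1 = mu - 2); last by ring.
  by rewrite /cst /=; field; rewrite gt_eqF.
Qed.

Lemma theta_flat t : T0 < t < T - 2 * T1 -> [/\ th t = 1, th1 t = 0 & th2 t = 0].
Proof.
have [_ _ _ d1 d2] := ext; have [_ _ h1 _ _] := spec; rewrite -/th in h1.
have tp u : T0 < u < T - 2 * T1 -> 0 < u < T.
  by case/andP=> a b; rewrite (lt_trans T00 a) /=; move: T10 b; lra.
have e0 u : T0 < u < T - 2 * T1 -> th u = cst 1 u.
  by case/andP=> a b; rewrite h1 // (ltW a) ltW.
have e1 u : T0 < u < T - 2 * T1 -> th1 u = cst 0 u.
  by move=> uT; exact: (is_derive_agree uT e0 (d1 u (tp u uT)) (is_derive_cst (1:R) u (1:R))).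
move=> tT; split; [exact: e0 | exact: e1 |].
exact: (is_derive_agree tT e1 (d2 t (tp t tT)) (is_derive_cst (0:R) t (1:R))).
Qed.

Lemma theta_blowup t : T - T1 < t < T ->
  [/\ th t = (T - t) `^ (- m), th1 t = m * (T - t) `^ (- m - 1) &
      th2 t = m * (m + 1) * (T - t) `^ (- m - 2)].
Proof.
have [_ _ _ d1 d2] := ext; have [_ _ _ _ h1] := spec; rewrite -/th in h1.
have tp u : T - T1 < u < T -> 0 < u < T.
  by case/andP=> a b; rewrite b andbT; move: T00 T10 TT a; lra.
have pp u : T - T1 < u < T -> 0 < T + (-1) * u.
  by case/andP=> _ b; rewrite mulN1r subr_gt0.
have pE u : T - u = T + (-1) * u by ring.
have e0 u : T - T1 < u < T -> th u = (T + (-1) * u) `^ (- m).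
  by case/andP=> a b; rewrite -pE h1 // (ltW a).
have e1 u : T - T1 < u < T -> th1 u = m * (T + (-1) * u) `^ (- m - 1).
  move=> uT; rewrite (is_derive_agree uT e0 (d1 u (tp u uT))
     (is_derive_powR_affine (- m) (pp u uT))).
  by ring.
move=> tT; split.
- by rewrite e0 // pE.
- by rewrite e1 // pE.
- rewrite (is_derive_agree tT e1 (d2 t (tp t tT))
    (is_derive_mul (is_derive_cst m t (1:R))
      (is_derive_powR_affine (- m - 1) (pp t tT)))).
  rewrite pE (_ : - m - 1 - 1 = - m - 2); last by ring.
  by rewrite /cst /=; ring.
Qed.

Lemma theta1_tail_ge0 t : T - T1 < t < T -> 0 <= th1 t.
Proof.
by move=> /theta_blowup[_ -> _]; rewrite mulr_ge0 ?powR_ge0 //; apply: le_trans m1.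
Qed.

Lemma theta1_0 : th1 0 = - (mu / T0).
Proof.
have [_ c1 _ _ _] := ext.
have key (sg : R) : sg = 1 \/ sg = -1 -> 0 <= sg * (th1 0 - (- (mu / T0) * (1 - 0 / T0) `^ (mu - 1))).
  move=> hs.
  have cf : cts `[0, T0[ (fun t => sg * (th1 t - (- (mu / T0) * (1 - t / T0) `^ (mu - 1)))).
    apply: cts_mul; first exact: cts_cst.
    apply: cts_add.
      apply: cts_subset c1 => u; rewrite /= !in_itv /= => /andP[-> b] /=.
      by apply: (lt_trans b); move: TT T10; lra.
    apply: cts_opp; apply: cts_mul; first exact: cts_cst.
    move=> u; rewrite /= in_itv /= => /andP[u0 uT].
    apply: cvg_within_filter.
    have h : 0 < 1 + (- T0^-1) * u.
      by rewrite mulNr subr_gt0 mulrC ltr_pdivrMr // mul1r.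
    have [d _] := is_derive_powR_affine (mu - 1) h.
    have -> : (fun t => (1 - t / T0) `^ (mu - 1)) = (fun t => (1 + - T0^-1 * t) `^ (mu - 1)).
      by apply/funext => x; congr (_ `^ _); ring.
    rewrite (_ : 1 - u / T0 = 1 + - T0^-1 * u); last by ring.
    have c : {for u, continuous (fun t => (1 + - T0^-1 * t) `^ (mu - 1))}.
      by apply/differentiable_continuous/derivable1_diffP.
    exact: c.
  have A0 : `[0, T0[%classic (0 : R) by rewrite /= in_itv /= lexx.
  apply: (cts_closure_ge0 cf A0) => e e0.
  have m0 : 0 < Num.min e T0 by rewrite lt_min e0.
  have me : Num.min e T0 <= e by rewrite ge_min lexx.
  have mT : Num.min e T0 <= T0 by rewrite ge_min lexx orbT.
  have ut : 0 < Num.min e T0 / 2 < T0 by apply/andP; split; lra.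
  exists (Num.min e T0 / 2); split.
  - by rewrite /= in_itv /=; case/andP: ut => a ->; rewrite ltW.
  - by rewrite subr0 ger0_norm; lra.
  - by have [_ -> _] := theta_initial ut; rewrite subrr mulr0.
have k1 := key 1 (or_introl erefl); have k2 := key (-1) (or_intror erefl).
move: k1 k2; rewrite mul0r subr0 powR1 mulr1; lra.
Qed.

Lemma theta_0 : th 0 = 2.
Proof.
have [_ h1 _ _ _] := spec; rewrite /th h1 ?lexx ?(ltW T00) //.
by rewrite mul0r subr0 powR1; ring.
Qed.

End FixedMu.

(** The bounds on theta', theta'' are uniform in mu: near 0 the derivatives are
explicit, on the remaining interval theta does not depend on mu, and there only
the explicit blow-up near T matters. *)
Lemma theta_bounds : exists2 K : R, 0 <= K & forall mu, 2 < mu ->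
  exists th1 th2, C2ext T (Theta mu) th1 th2 /\
  forall t, 0 < t < T -> th1 t <= K * Theta mu t ^+ 2 /\
     th2 t <= K * (Theta mu t ^+ 3 + mu ^+ 2).
Proof.
have l3 : 2 < (3 : R) by lra.
have [a3 [b3 ext3]] : exists a3 b3, C2ext T (Theta 3) a3 b3.
  by have [h _ _ _ _] := hTheta.1 3 l3; exact: class_C2ext.
have AB : `[T - 2 * T1, T - T1] `<=` `[0, T[.
  move=> u; rewrite /= !in_itv /= => /andP[a b]; apply/andP; split.
    by move: T00 TT a; lra.
  by move: T10 b; lra.
have [Ma Ma0 hMa] : exists2 M, 0 < M & forall t, `[T - 2 * T1, T - T1]%classic t -> `|a3 t| <= M.
  apply: cts_bounded; first exact: segment_compact.
  by have [_ c _ _ _] := ext3; exact: cts_subset c.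
have [Mb Mb0 hMb] : exists2 M, 0 < M & forall t, `[T - 2 * T1, T - T1]%classic t -> `|b3 t| <= M.
  apply: cts_bounded; first exact: segment_compact.
  by have [_ _ c _ _] := ext3; exact: cts_subset c.
have m0 : 0 <= m by apply: le_trans m1.
have T02 : 0 <= (T0 ^+ 2)^-1 by rewrite invr_ge0 exprn_ge0 // ltW.
pose K := (T0 ^+ 2)^-1 + Ma + Mb + m * (m + 1).
have mm0 : 0 <= m * (m + 1) by rewrite mulr_ge0 // addr_ge0.
have mm1 : m <= m * (m + 1) by rewrite ler_peMr // lerDr.
have K1 : (T0 ^+ 2)^-1 <= K by rewrite /K; move: mm0 (ltW Ma0) (ltW Mb0); clear -hTheta TT T10 T14 m1 T00; lra.
have K2 : Ma <= K by rewrite /K; move: mm0 T02 (ltW Mb0); clear -hTheta TT T10 T14 m1 T00; lra.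
have K3 : Mb <= K by rewrite /K; move: mm0 T02 (ltW Ma0); clear -hTheta TT T10 T14 m1 T00; lra.
have K4 : m * (m + 1) <= K by rewrite /K; move: T02 (ltW Ma0) (ltW Mb0); clear -hTheta TT T10 T14 m1 T00; lra.
have K0 : 0 <= K by apply: le_trans K4.
exists K => // mu mu2.
have [a [b ext]] : exists a b, C2ext T (Theta mu) a b.
  by have [h _ _ _ _] := hTheta.1 mu mu2; exact: class_C2ext.
exists a, b; split => //.
set th := Theta mu.
pose good t := 0 <= K * th t ^+ 2 - a t /\ 0 <= K * (th t ^+ 3 + mu ^+ 2) - b t.
have th1 t : 0 < t < T -> 1 <= th t.
  by case/andP=> /ltW t0 tT; apply: theta_ge1 => //; rewrite t0.
have pw n t : 0 < t < T -> 1 <= th t ^+ n by move=> /th1 h; exact: exprn_ege1.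
have mu20 : 0 <= mu ^+ 2 by exact: sqr_ge0.
have easy t (A B : R) : 0 < t < T -> a t <= A -> A <= K -> b t <= B -> B <= K -> good t.
  move=> tT aA AK bB BK; split; rewrite subr_ge0.
    by apply: (le_trans aA); apply: (le_trans AK); rewrite ler_peMr // pw.
  apply: (le_trans bB); apply: (le_trans BK); rewrite ler_peMr //.
  by apply: (le_trans (pw 3%N t tT)); rewrite lerDl.
have lim (l t : R) : 0 <= l < t -> t < T -> (forall u, l < u < t -> good u) -> good t.
  have [c0 c1 c2 _ _] := ext.
  move=> lt tT h; split.
  - apply: (@cts_left_ge0 l t T (fun t => K * th t ^+ 2 - a t)) => //; last by move=> u /h[].
    apply: cts_add; last exact: cts_opp.
    by apply: cts_mul; [exact: cts_cst | apply: cts_exprn].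
  - apply: (@cts_left_ge0 l t T (fun t => K * (th t ^+ 3 + mu ^+ 2) - b t)) => //; last by move=> u /h[].
    apply: cts_add; last exact: cts_opp.
    apply: cts_mul; first exact: cts_cst.
    by apply: cts_add; [exact: cts_exprn | exact: cts_cst].
have i1 t : 0 < t < T0 -> good t.
  move=> tT0; have [_ ha hb] := theta_initial mu2 ext tT0; case/andP: (tT0) => t0 t1.
  have tT : 0 < t < T by rewrite t0; move: TT T10 t1; clear -hTheta TT T10 T14 m1 T00; lra.
  have p0 : 0 < 1 - t / T0 by rewrite subr_gt0 ltr_pdivrMr // mul1r.
  have p1 : 1 - t / T0 <= 1 by rewrite gerBl divr_ge0 // ltW.
  split; rewrite subr_ge0.
    apply: (@le_trans _ _ 0); last by rewrite mulr_ge0 // sqr_ge0.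
    rewrite ha mulNr oppr_le0 mulr_ge0 ?powR_ge0 // divr_ge0 ?(ltW T00) //.
    by apply: le_trans (ltW mu2).
  rewrite hb; apply: (@le_trans _ _ (K * mu ^+ 2)); last first.
    apply: ler_wpM2l => //; rewrite lerDr.
    by apply: le_trans (pw 3%N t tT).
  apply: (@le_trans _ _ ((T0 ^+ 2)^-1 * mu ^+ 2)); last by apply: ler_wpM2r.
  have -> : mu * (mu - 1) / T0 ^+ 2 * (1 - t / T0) `^ (mu - 2)
    = (T0 ^+ 2)^-1 * (mu * ((mu - 1) * (1 - t / T0) `^ (mu - 2))) by ring.
  apply: ler_wpM2l => //; rewrite expr2; apply: ler_wpM2l; first by move: mu2; clear -hTheta TT T10 T14 m1 T00; lra.
  have q1 : (1 - t / T0) `^ (mu - 2) <= 1.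
    rewrite -[leRHS](powRr0 (1 - t / T0)); apply: ger_powR; first by rewrite p0.
    by move: mu2; clear -hTheta TT T10 T14 m1 T00; lra.
  apply: (@le_trans _ _ ((mu - 1) * 1)); last by lra.
  by apply: ler_wpM2l => //; move: mu2; clear -hTheta TT T10 T14 m1 T00; lra.
have i2 t : T0 < t < T - 2 * T1 -> good t.
  move=> ht; have [_ ha hb] := theta_flat mu2 ext ht; apply: (@easy t 0 0); rewrite ?ha ?hb //.
  by case/andP: ht => x y; rewrite (lt_trans T00 x) /=; move: T10 y; clear -hTheta TT T10 T14 m1 T00; lra.
have i3 t : T - 2 * T1 < t < T - T1 -> good t.
  move=> ht; case/andP: (ht) => x y.
  have inT u : T - 2 * T1 < u < T - T1 -> 0 < u < T.
    by case/andP=> x' y'; apply/andP; split; [move: T00 TT x'|move: T10 y']; clear -hTheta TT T10 T14 m1 T00; lra.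
  have cl : `[T - 2 * T1, T - T1]%classic t by rewrite /= in_itv /= !ltW.
  have eth u : T - 2 * T1 < u < T - T1 -> th u = Theta 3 u.
    case/andP=> x' y'; apply: hTheta.2 => //; rewrite (ltW x') /=.
    by move: T10 y'; clear -hTheta TT T10 T14 m1 T00; lra.
  have [_ _ _ d1 d2] := ext; have [_ _ _ d13 d23] := ext3.
  have ea u : T - 2 * T1 < u < T - T1 -> a u = a3 u.
    by move=> hu; apply: (is_derive_agree hu eth); [apply: d1|apply: d13]; exact: inT.
  have eb : b t = b3 t.
    by apply: (is_derive_agree ht ea); [apply: d2|apply: d23]; exact: inT.
  apply: (@easy t Ma Mb) => //; first exact: inT.
  - by rewrite ea //; apply: le_trans (hMa t cl); exact: ler_norm.
  - by rewrite eb; apply: le_trans (hMb t cl); exact: ler_norm.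
have i4 t : T - T1 < t < T -> good t.
  move=> ht; have [hth ha hb] := theta_blowup mu2 ext ht; case/andP: (ht) => x y.
  have tT : 0 < t < T by rewrite y andbT; move: T00 T10 TT x; clear -hTheta TT T10 T14 m1 T00; lra.
  have s0 : 0 < T - t by rewrite subr_gt0.
  have s1 : T - t <= 1 by move: T14 x; clear -hTheta TT T10 T14 m1 T00; lra.
  have mono (r : R) : - (m * r) <= - m - (r - 1) ->
     (T - t) `^ (- m - (r - 1)) <= (T - t) `^ (- m * r).
    by move=> h; apply: ger_powR; [rewrite s0 | rewrite mulNr].
  have thn n : th t ^+ n = (T - t) `^ (- m * n%:R).
    by rewrite /th hth -powR_mulrn ?powR_ge0 // -powRrM.
  split; rewrite subr_ge0.
    rewrite ha thn; apply: ler_pM => //; rewrite ?powR_ge0 //.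
      exact: le_trans K4.
    have -> : - m - 1 = - m - (2 - 1) by ring.
    by apply: mono; move: m1; clear -hTheta TT T10 T14 m1 T00; lra.
  rewrite hb; apply: (@le_trans _ _ (K * th t ^+ 3)); last first.
    by apply: ler_wpM2l => //; rewrite lerDl.
  rewrite thn; apply: ler_pM => //; rewrite ?powR_ge0 //.
  have -> : - m - 2 = - m - (3 - 1) by ring.
  by apply: mono; move: m1; clear -hTheta TT T10 T14 m1 T00; lra.
have all t : 0 < t < T -> good t.
  case/andP=> t0 tT.
  have [x|x|->] := ltgtP t T0; first by apply: i1; rewrite t0.
    have [y|y|->] := ltgtP t (T - 2 * T1); first by apply: i2; rewrite x.
      have [w|w|->] := ltgtP t (T - T1); first by apply: i3; rewrite y.
        by apply: i4; rewrite w.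
      apply: (lim (T - 2 * T1)) i3; last by move: T10; clear -hTheta TT T10 T14 m1 T00; lra.
      by apply/andP; split; [move: T00 TT|move: T10]; clear -hTheta TT T10 T14 m1 T00; lra.
    apply: (lim T0) i2; last by move: T10; clear -hTheta TT T10 T14 m1 T00; lra.
    by apply/andP; split; [exact: ltW|move: TT; clear -hTheta TT T10 T14 m1 T00; lra].
  apply: (lim 0) i1; first by rewrite lexx.
  by move: T10 TT; clear -hTheta TT T10 T14 m1 T00; lra.
by move=> t /all; rewrite /good !subr_ge0.
Qed.

End ThetaFacts.

(** * Exhaustion, families of bounds and the terminal energy *)

Section MeasureTools.
Context d (X : measurableType d) (R : realType) (mu : {measure set X -> \bar R}).

(** Monotone convergence. *)
Lemma integral_exhaust (A : nat -> set X) (D : set X) (f : X -> R) (b : \bar R) :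
  measurable D -> (forall n, measurable (A n)) ->
  (forall n k, (n <= k)%N -> A n `<=` A k) -> (forall n, A n `<=` D) ->
  (forall x, D x -> exists n, A n x) -> measurable_fun D f -> (forall x, D x -> 0 <= f x) ->
  (forall n, (\int[mu]_(x in A n) (f x)%:E <= b)%E) ->
  (\int[mu]_(x in D) (f x)%:E <= b)%E.
Proof.
move=> mD mA ndA AD DA mf f0 hb.
pose g n : X -> \bar R := (EFin \o f) \_ (A n).
have mg n : measurable_fun D (g n).
  apply/measurable_restrict => //.
  by apply: (measurable_funS mD); [exact: subIsetl | exact/measurable_EFinP].
have g0 n x : D x -> (0 <= g n x)%E.
  by move=> Dx; rewrite /g /patch; case: ifP => // _; rewrite lee_fin f0.
have ndg x : D x -> {homo g^~ x : n k / (n <= k)%N >-> (n <= k)%E}.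
  move=> Dx n k nk; rewrite /g /patch; case: ifP => [|_].
    by rewrite inE => /(ndA n k nk) h; rewrite mem_set.
  by case: ifP => // _; rewrite lee_fin f0.
have hc := cvg_monotone_convergence (mu := mu) mD mg g0 ndg.
have <- : (\int[mu]_(x in D) limn (g^~ x) = \int[mu]_(x in D) (f x)%:E)%E.
  apply: eq_integral => x; rewrite inE => Dx; apply/cvg_lim => //.
  have [N AN] := DA x Dx; apply: cvg_near_cst; exists N => // n /= Nn.
  by rewrite /g /patch mem_set //; exact: (ndA N n).
rewrite -(cvg_lim _ hc) //; apply: lime_le; first exact: (cvgP _ hc).
apply: nearW => n; apply: le_trans (hb n).
rewrite /g -integral_mkcondr (_ : D `&` A n = A n) //.
by apply/seteqP; split => [x []//|x Ax]; split => //; exact: (AD n).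
Qed.

(** The integral of a nonnegative function is a supremum over simple functions below
it, so monotonicity holds without measurability. *)
Lemma integral_subset_bound (A B : set X) (f : X -> R) : (forall x, B x -> 0 <= f x) ->
  A `<=` B -> (\int[mu]_(x in A) (f x)%:E <= \int[mu]_(x in B) (f x)%:E)%E.
Proof.
move=> f0 AB; rewrite ge0_integralE; last by move=> x /AB /f0; rewrite lee_fin.
rewrite ge0_integralE; last by move=> x /f0; rewrite lee_fin.
apply: ereal_sup_le => y [h hA <-]; exists h => //= x; apply: le_trans (hA x) _.
rewrite /patch; case: ifPn => [xA|_]; first by rewrite (mem_set (AB _ (set_mem xA))).
by case: ifPn => // /set_mem /f0; rewrite lee_fin.
Qed.

Lemma ge0_integral_comb (D : set X) (f g : X -> R) (a b : R) : measurable D ->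
  measurable_fun D f -> measurable_fun D g -> (forall x, D x -> 0 <= f x) ->
  (forall x, D x -> 0 <= g x) -> 0 <= a -> 0 <= b ->
  (\int[mu]_(x in D) (a * f x + b * g x)%:E
   = a%:E * \int[mu]_(x in D) (f x)%:E + b%:E * \int[mu]_(x in D) (g x)%:E)%E.
Proof.
move=> mD mf mg f0 g0 a0 b0.
under eq_integral do rewrite EFinD !EFinM.
rewrite ge0_integralD //; first last.
- by apply: emeasurable_funM => //; exact/measurable_EFinP.
- by move=> x Dx; rewrite -EFinM lee_fin mulr_ge0 // g0.
- by apply: emeasurable_funM => //; exact/measurable_EFinP.
- by move=> x Dx; rewrite -EFinM lee_fin mulr_ge0 // f0.
by rewrite !ge0_integralZl_EFin //; exact/measurable_EFinP.
Qed.

End MeasureTools.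

Section SpaceTimeTools.
Context {R : realType}.
Let E := (R * (R * R))%type.
Variables (O : set (R * R)) (hO : bounded_domain O) (T : R) (T00 : 0 < T).

Lemma slab_closure : slab O T `<=` closure (cyl T O).
Proof.
move=> [t x] [/= tT Ox] B /nbhs_ballP[e /= e0 he].
have [y [Oy xy]] : exists y, O y /\ ball x e y.
  by have [y [? ?]] := Ox _ (nbhsx_ballx x e e0); exists y.
move: tT; rewrite in_itv /= => /andP[t0 tT].
pose d := Num.min e T; have d0 : 0 < d by rewrite lt_min e0.
have de : d <= e by rewrite ge_min lexx.
have dT : d <= T by rewrite ge_min lexx orbT.
have [u [u0 ut]] : exists u, 0 < u < T /\ `|t - u| < e.
  have [h|h] := leP t (T / 2).
    exists (t + d / 4); split; first by apply/andP; split; lra.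
    by rewrite ltr_norml; apply/andP; split; lra.
  exists (t - d / 4); split; first by apply/andP; split; lra.
  by rewrite ltr_norml; apply/andP; split; lra.
exists (u, y); split; first by split => //=; rewrite in_itv.
apply: he; move: xy; rewrite -!ball_normE /= => xy.
by change (Num.max `|t - u| `|x - y| < e); rewrite gt_max ut.
Qed.

Section TimeFunctions.
Variables (T' : R) (h : T' < T) (f f' : R -> R).

Lemma cts_time_comp (g : R -> R) : cts `[0, T[ g -> cts (slab O T') (fun p : E => g p.1).
Proof.
move=> cg p [p1 _]; apply/cts_eps => e e0.
have sub u : u \in `[0, T'] -> `[0, T[%classic u.
  by rewrite /= !in_itv /= => /andP[-> b] /=; exact: le_lt_trans h.
have /cts_eps /(_ _ e0)[d d0 hd] := cg p.1 (sub _ p1).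
exists d => // q [q1 _] qp; apply: hd; first exact: sub.
apply: le_lt_trans qp; change (`|q.1 - p.1| <= Num.max `|q.1 - p.1| `|q.2 - p.2|).
by rewrite le_max lexx.
Qed.

Lemma is_derive_time_space (p v : E) : v.1 = 0 -> is_derive p v (fun p : E => f p.1) 0.
Proof.
move=> v0; apply/is_derive_line0.
have -> : (fun k : R => f (p + k *: v).1) = cst (f p.1).
  by apply/funext => k; rewrite /= v0 scaler0 addr0.
exact: is_derive_cst.
Qed.

Lemma is_derive_time_et (df : forall t : R, 0 < t < T -> is_derive t 1 f (f' t)) (p : E) :
  cyl T' O p -> is_derive p et (fun p : E => f p.1) (f' p.1).
Proof.
move=> [+ _]; rewrite /= in_itv /= => /andP[p0 pT].
have := df p.1; rewrite p0 (lt_trans pT h) => /(_ isT) /is_derive_line0 hd.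
by apply/is_derive_line0; move: hd; congr (is_derive _ _ _ _).
Qed.

(** Functions of t that are only defined for t < T, seen on a shorter cylinder. *)
Definition C1time (cf : cts `[0, T[ f) (cf' : cts `[0, T[ f')
  (df : forall t : R, 0 < t < T -> is_derive t 1 f (f' t)) : C1fun O T' :=
  @MkC1 R O T' (fun p => f p.1) (fun p => f' p.1) (fun=> 0) (fun=> 0)
    (cts_time_comp cf) (cts_time_comp cf') (@cts_cst _ _ _ 0) (@cts_cst _ _ _ 0)
    (is_derive_time_et df) (fun p _ => @is_derive_time_space p ex erefl)
    (fun p _ => @is_derive_time_space p ey erefl).
End TimeFunctions.

(** One bound for finitely many continuous functions; the statement unfolds to a
conjunction for an explicit list. *)
Lemma bounded_family (fs : seq (E -> R)) :
  foldr (fun f P => cts (slab O T) f /\ P) True fs ->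
  exists2 M, 0 < M &
    foldr (fun f P => (forall p, slab O T p -> `|f p| <= M) /\ P) True fs.
Proof.
have mono (M N : R) (gs : seq (E -> R)) : M <= N ->
    foldr (fun f P => (forall p, slab O T p -> `|f p| <= M) /\ P) True gs ->
    foldr (fun f P => (forall p, slab O T p -> `|f p| <= N) /\ P) True gs.
  move=> MN; elim: gs => //= f gs IH [hf /IH ?]; split => // p /hf h.
  exact: le_trans MN.
elim: fs => [_|f fs IH /= [cf /IH[M M0 hM]]]; first by exists 1.
have [N N0 hN] := cts_bounded (compact_slab hO (T := T)) cf.
exists (Num.max M N); first by rewrite lt_max M0.
split; first by move=> p /hN h; rewrite le_max h orbT.
by apply: mono hM; rewrite le_max lexx.
Qed.

End SpaceTimeTools.

(** The energy carries the factor e^{-2 s phi}, and phi grows like theta, while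
its other factors grow at most quadratically in theta. *)
Lemma terminal_energy {R : realType} (O : set (R * R)) (hO : bounded_domain O) (T : R)
    (Psi z : C2fun O T) (sg chi : C1fun O T) (nu m lam s K : R) :
  1 <= m -> 1 <= lam -> 1 <= s -> 0 <= K -> (forall p, slab O T p -> 0 <= Psi p <= 1) ->
  exists2 C, 0 <= C & forall (T' : R) (h : T' <= T) (th tht : C1fun O T') (x : R * R),
  0 <= T' -> O x -> 1 <= th (T', x) -> 0 <= tht (T', x) <= K * th (T', x) ^+ 2 ->
  `|energy (C2restr h Psi) (C2restr h z) (C1restr h sg) (C1restr h chi) th tht nu m lam s
     (T', x)| <= C / th (T', x).
Proof.
move=> m1 lam1 s1 K0 psi01.
pose om : C1fun O T := ((s * lam)%:C * ewt Psi m lam)%C1.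
pose q0 : C1fun O T := (nu%:C * (sg * (cx z * cx z + cy z * cy z)))%C1.
pose q1 : C1fun O T := ((2 * nu)%:C * (sg * om * z * (cx Psi * cx z + cy Psi * cy z))
  + sg * sg * ct Psi * om * z * z + (2^-1 * lam)%:C * (sg * om * chi * z * z))%C1.
pose q2 : C1fun O T := (sg * sg * (s%:C * ((Lam m lam)%:C - ewt Psi m lam)) * z * z)%C1.
have [|M M0 /= [b0 [b1 [b2 _]]]] := bounded_family hO (T := T)
  (fs := [:: val q0; val q1; val q2]).
  by do !split; exact: cts_val.
exists (M * (2 + K) * 27); first by rewrite !mulr_ge0 ?addr_ge0 // ltW.
move=> T' h th tht x T'0 Ox th1 /andP[tht0 thtK].
set p := (T', x); have Sp : slab O T p.
  by split; [rewrite /= in_itv /= T'0 | exact: subset_closure].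
rewrite -/p in th1 tht0 thtK.
have eE : ewt (C2restr h Psi) m lam p = ewt Psi m lam p by rewrite /ewt -!lock.
set e := Ewt (C2restr h Psi) th m lam s p.
have key : energy (C2restr h Psi) (C2restr h z) (C1restr h sg) (C1restr h chi) th tht
    nu m lam s p = e ^+ 2 * (q0 p + th p * q1 p - tht p * q2 p).
  rewrite /energy /gw2 /eta /wx /wy /wv /V /gr2 /Phit -!lock !C1E -/e W_val eE.
  rewrite /q0 /q1 /q2 /om ?C1E.
  have -> : C2restr h z p = z p by [].
  have -> : cx (C2restr h z) p = cx z p by [].
  have -> : cy (C2restr h z) p = cy z p by [].
  have -> : cx (C2restr h Psi) p = cx Psi p by [].
  have -> : cy (C2restr h Psi) p = cy Psi p by [].
  have -> : ct (C2restr h Psi) p = ct Psi p by [].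
  have -> : C1restr h sg p = sg p by [].
  have -> : C1restr h chi p = chi p by [].
  by field.
have e2 : e ^+ 2 <= 27 / th p ^+ 3.
  have [le eL _ _] := weight_facts m1 lam1 s1 (psi01 p Sp).
  set w := expR (lam * (Psi p + _)) in le eL.
  have wE : ewt Psi m lam p = w by rewrite /ewt -lock.
  have l0 : 0 <= Lam m lam - w - 1.
    have : 1 * w <= lam * w by apply: ler_wpM2r => //; rewrite expR_ge0.
    by rewrite /Lam; move: eL le lam1; set L := lam * expR (6 * lam * _); clear; lra.
  have th0 : 0 < th p by apply: lt_le_trans th1.
  have h1 : th p <= s * (th p * (Lam m lam - w)).
    apply: (@le_trans _ _ (s * (th p * 1))); first by rewrite mulr1 ler_peMl // ltW.
    apply: ler_wpM2l; first by apply: le_trans s1.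
    by apply: ler_wpM2l; [exact: ltW | move: l0; clear; lra].
  have h2 : e <= expR (- th p) by rewrite /e /Ewt /Phi -!lock !C1E eE wE ler_expR lerN2.
  have h3 : (th p / 3) ^+ 3 <= expR (th p).
    have -> : expR (th p) = expR (th p / 3) ^+ 3.
      by rewrite -expRM_natl; congr expR; field.
    rewrite lerXn2r ?nnegrE ?expR_ge0 ?divr_ge0 ?(ltW th0) //.
    by apply: le_trans (expR_ge1Dx _); rewrite lerDr.
  have e1 : e <= 1.
    by apply: (le_trans h2); rewrite -[leRHS]expR0 ler_expR oppr_le0 ltW.
  have e0 : 0 <= e by rewrite /e /Ewt -lock; exact: expR_ge0.
  apply: (@le_trans _ _ e); first by rewrite expr2 ler_piMl.
  apply: (le_trans h2); rewrite expRN ler_pdivlMr ?exprn_gt0 //.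
  rewrite mulrC ler_pdivrMr ?expR_gt0 //.
  move: h3; have -> : (th p / 3) ^+ 3 = th p ^+ 3 / 27 by field.
  by rewrite ler_pdivrMr // mulrC.
apply: (@le_trans _ _ `|e ^+ 2 * (q0 p + th p * q1 p - tht p * q2 p)|).
  by rewrite -key.
rewrite normrM (ger0_norm (sqr_ge0 e)).
have th0 : 0 < th p by apply: lt_le_trans th1.
have t2 : 1 <= th p ^+ 2 by exact: exprn_ege1.
have bound : `|q0 p + th p * q1 p - tht p * q2 p| <= M * (2 + K) * th p ^+ 2.
  apply: (le_trans (ler_normB _ _)).
  have n1 : `|q0 p + th p * q1 p| <= M * 1 + M * th p ^+ 2.
    apply: (le_trans (ler_normD _ _)); apply: lerD; first by rewrite mulr1; exact: b0.
    rewrite normrM (gtr0_norm th0) mulrC; apply: ler_pM => //; [exact: ltW | exact: b1 |].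
    by rewrite expr2 ler_peMl // ltW.
  have n2 : `|tht p * q2 p| <= M * (K * th p ^+ 2).
    by rewrite normrM (ger0_norm tht0) mulrC; apply: ler_pM => //; exact: b2.
  have n3 : M * 1 <= M * th p ^+ 2 by rewrite ler_pM2l.
  have -> : M * (2 + K) * th p ^+ 2 = M * th p ^+ 2 + M * th p ^+ 2 + M * (K * th p ^+ 2) by ring.
  apply: lerD => //; apply: (le_trans n1); exact: lerD.
apply: (le_trans (ler_pM (sqr_ge0 e) (normr_ge0 _) e2 bound)).
rewrite le_eqVlt; apply/orP; left; apply/eqP; field.
by rewrite gt_eqF.
Qed.

(** * Geometry of the space weight *)

Lemma rel_openX {R : realType} (T : R) (O : set (R * R)) (A K : set (R * (R * R))) :
  open O -> rel_open (`[0, T] `*` O) A -> K `<=` A ->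
  exists V, [/\ open V, K `<=` V, (forall p, V p -> O p.2) &
    forall p, `[0, T]%classic p.1 -> V p -> A p].
Proof.
move=> oO [V0 oV0 AE] KA; exists (V0 `&` (snd @^-1` O)); split.
- by apply: openI => //; apply: open_comp => // p _; exact: cvg_snd.
- by move=> p /KA; rewrite AE => -[[_ Op] Vp]; split.
- by move=> p [].
- by move=> p pT [Vp Op]; rewrite AE.
Qed.

Section WeightGeometry.
Context {R : realType}.
Let E := (R * (R * R))%type.
Variables (O : set (R * R)) (hO : bounded_domain O) (T : R) (T00 : 0 < T).
Variables (tomega K : set E) (alpha : R) (Psi : C2fun O T).
Hypothesis htpsi : is_tpsi T O tomega alpha Psi.
Hypotheses (cK : compact K) (omK : tomega `<=` K).

Lemma tpsi_range p : slab O T p -> 0 <= Psi p <= 1.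
Proof. by have [_ h _ _ _] := htpsi; move=> /(slab_closure T00); exact: h. Qed.

Lemma tpsi_bdry (t : R) (y z : R * R) : 0 <= t <= T -> bdry O y -> bdry O z ->
  Psi (t, y) = Psi (t, z).
Proof. by have [_ _ _ h _] := htpsi; move=> /h[+ _]; exact. Qed.

Lemma tpsi_min (t : R) (x y : R * R) : 0 <= t <= T -> O x -> bdry O y ->
  Psi (t, y) <= Psi (t, x).
Proof.
move=> tT Ox By; have [_ _ _ h _] := htpsi.
have [_ /(_ y By) <-] := h t tT; apply: ge_inf; last by exists x.
exists 0 => _ [u Ou <-]; have /andP[//] : 0 <= Psi (t, u) <= 1.
by apply: tpsi_range; split; [rewrite /= in_itv | exact: subset_closure].
Qed.

(** At t = 0 the bound is obtained as a limit in t, the complement of K being open. *)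
Lemma tpsi_grad (p : E) : 0 <= p.1 < T -> O p.2 -> ~ K p ->
  alpha ^+ 2 <= cx Psi p ^+ 2 + cy Psi p ^+ 2.
Proof.
have [_ _ _ _ [a0 ainf]] := htpsi.
have pos q : cyl T O q -> ~ K q -> alpha ^+ 2 <= cx Psi q ^+ 2 + cy Psi q ^+ 2.
  move=> Uq nK; have : alpha <= Num.sqrt (grad2 Psi q).
    apply: le_trans ainf _; apply: ge_inf; first by exists 0 => _ [u _ <-]; exact: sqrtr_ge0.
    by exists q => //; split => // /omK.
  have -> : grad2 Psi q = cx Psi q ^+ 2 + cy Psi q ^+ 2.
    by rewrite /grad2 /dx1 /dx2 -dX_c0 -dY_c0; have [_ ->] := is_dX Psi Uq; have [_ ->] := is_dY Psi Uq.
  move=> h; rewrite -[leRHS]sqr_sqrtr ?addr_ge0 ?sqr_ge0 //.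
  by rewrite lerXn2r ?nnegrE ?sqrtr_ge0 // ltW.
case: p => t x /= /andP[]; rewrite le_eqVlt => /predU1P[<- _|t0 tT] Ox nK; last first.
  by apply: pos => //; split => //=; rewrite in_itv /= t0.
have cf : cts `[0, T] (fun u : R => (cx Psi (u, x) ^+ 2 + cy Psi (u, x) ^+ 2) - alpha ^+ 2).
  apply/ctsE.
  apply: (@cts_time R O T (fun p => (cx Psi p ^+ 2 + cy Psi p ^+ 2) - alpha ^+ 2) x Ox).
  by cts_rules.
rewrite -subr_ge0; apply: (cts_closure_ge0 cf) => [|e e0].
  by rewrite /= in_itv /= lexx ltW.
have : nbhs ((0, x) : E) (~` K).
  by apply: open_nbhs_nbhs; split => //; apply: closed_openC; apply: compact_closed => //;
    exact: norm_hausdorff.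
move=> /nbhs_ballP[r /= r0 hr].
pose d := Num.min (Num.min e r) T; have d0 : 0 < d by rewrite !lt_min e0 r0.
have [de dr dT] : [/\ d <= e, d <= r & d <= T].
  by rewrite /d; split; rewrite !ge_min lexx ?orbT.
exists (d / 2); split.
- by rewrite /= in_itv /=; apply/andP; split; lra.
- by rewrite subr0 ger0_norm; lra.
- rewrite subr_ge0; apply: pos.
    by split => //=; rewrite in_itv /=; apply/andP; split; lra.
  apply: hr; rewrite -ball_normE /=.
  change (Num.max `|0 - d / 2| `|x - x| < r).
  by rewrite subrr normr0 sub0r normrN gt_max r0 andbT ger0_norm; lra.
Qed.
End WeightGeometry.

Lemma mu_par_gt2 {R : realType} (m s lam : R) : 1 <= m -> 1 <= lam -> 1 <= s ->
  2 < mu_par m s lam.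
Proof.
move=> m1 lam1 s1.
have h : 3 <= expR (lam * (6 * m - 4)).
  apply: le_trans (expR_ge1Dx _).
  have : 1 * 2 <= lam * (6 * m - 4) by apply: ler_pM => //; lra.
  by lra.
apply: (@lt_le_trans _ _ 3); first by lra.
rewrite /mu_par; apply: (le_trans h); rewrite ler_peMl ?expR_ge0 //.
by rewrite -[1]mulr1; apply: ler_pM => //; exact: exprn_ege1.
Qed.

(** Compactness of the closed cylinder. The gradient is bounded below outside Kc only,
and chi takes over on Kc. *)
Lemma uniform_coefs {R : realType} (O : set (R * R)) (hO : bounded_domain O) (T : R)
  (Psi : C2fun O T) (sg chi : C1fun O T) (nu alpha sg0 K1 : R) (Kc : set (R * (R * R))) :
  0 < nu -> 0 < sg0 -> 0 < alpha -> (forall p, slab O T p -> sg0 <= sg p) ->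
  (forall p, slab O T p -> 0 <= Psi p <= 1) ->
  (forall p, 0 <= chi p) -> (forall p, Kc p -> 1 <= chi p) ->
  (forall p : R * (R * R), 0 <= p.1 < T -> O p.2 -> ~ Kc p ->
     alpha ^+ 2 <= cx Psi p ^+ 2 + cy Psi p ^+ 2) ->
  exists K k : R, [/\ 4 <= K, 0 < k, k <= 2^-1, k^-1 <= K & K1 <= K /\
    forall (p : R * (R * R)), 0 <= p.1 < T -> O p.2 -> coef_bounds Psi sg chi nu K k p].
Proof.
move=> nu0 sg00 a0 hsg psi01 chi0 chi1 hgrad.
have [|M M0] := bounded_family hO (T := T)
  (fs := [:: val (ct Psi); val (cx Psi); val (cy Psi); dX (cx Psi); dX (cy Psi); dY (cy Psi);
   dT (cx Psi); dT (cy Psi); dT (ct Psi); val sg; dT sg; dX sg; dY sg;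
   val chi; dT chi; dX chi; dY chi]).
  by do !split; cts_rules.
move=> /= [c1 [c2 [c3 [d1 [d2 [d3 [e1 [e2 [e3 [f1 [f2 [f3 [f4 [g1 [g2 [g3 [g4 _]]]]]]]]]]]]]]]]].
pose k := Num.min 2^-1 (Num.min nu (Num.min sg0 (alpha ^+ 2))).
have k0 : 0 < k by rewrite !lt_min invr_gt0 ltr0n nu0 sg00 exprn_gt0.
have k1 : k <= 2^-1 by rewrite ge_min lexx.
have k2 : k <= nu by rewrite !ge_min lexx ?orbT.
have k3 : k <= sg0 by rewrite !ge_min lexx ?orbT.
have k4 : k <= alpha ^+ 2 by rewrite !ge_min lexx ?orbT.
pose K := Num.max 4 (Num.max k^-1 (Num.max K1 (Num.max nu M))).
have h1 : 4 <= K by rewrite le_max lexx.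
have h2 : k^-1 <= K by rewrite !le_max lexx ?orbT.
have h3 : K1 <= K by rewrite !le_max lexx ?orbT.
have h4 : nu <= K by rewrite !le_max lexx ?orbT.
have h5 : M <= K by rewrite !le_max lexx ?orbT.
exists K, k; split => //; split => // p p1 Op.
have Sp : slab O T p.
  split; last exact: subset_closure.
  by case/andP: p1 => a /ltW b; rewrite /= in_itv /= a.
split.
- split => //; first by rewrite ger0_norm // ltW.
    by apply: le_trans (hsg p Sp).
  have [Kp|nK] := pselect (Kc p); first by right; exact: chi1.
  by left; apply: (le_trans k4); exact: hgrad.
- by split; [exact: psi01 | apply: le_trans (c1 _ Sp) h5 | apply: le_trans (c2 _ Sp) h5 |
    apply: le_trans (c3 _ Sp) h5].
- by split; [apply: le_trans (d1 _ Sp) h5 | apply: le_trans (d2 _ Sp) h5 | apply: le_trans (d3 _ Sp) h5].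
- by split; [apply: le_trans (e1 _ Sp) h5 | apply: le_trans (e2 _ Sp) h5 | apply: le_trans (e3 _ Sp) h5].
- split.
  + by split; [apply: le_trans (f1 _ Sp) h5 | apply: le_trans (f2 _ Sp) h5 |
      apply: le_trans (f3 _ Sp) h5 | apply: le_trans (f4 _ Sp) h5].
  + by split; [apply: le_trans (g1 _ Sp) h5 | apply: le_trans (g2 _ Sp) h5 |
      apply: le_trans (g3 _ Sp) h5 | apply: le_trans (g4 _ Sp) h5].
Qed.

(** * Passage to the final time *)

Section Limit.
Context {R : realType}.
Let E := (R * (R * R))%type.
Variables (O : set (R * R)) (hO : bounded_domain O) (T : R) (T00 : 0 < T).
Let oO : open O. Proof. by have [] := hO. Qed.
Local Notation mu2 := (leb2 R).
Local Notation mu3 := (leb3 R).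

(** theta blows up at T, so the weights are continuous on this half-open set only. *)
Definition hslab : set E := `[0, T[ `*` closure O.

Lemma slab_hslab T' : T' < T -> slab O T' `<=` hslab.
Proof.
move=> h [t x] [/= + Ox]; rewrite in_itv /= => /andP[t0 tT]; split => //=.
by rewrite in_itv /= t0 (le_lt_trans tT).
Qed.

Lemma cyl_hslab : cyl T O `<=` hslab.
Proof.
move=> [t x] [/= + Ox]; rewrite in_itv /= => /andP[t0 tT]; split => /=.
  by rewrite in_itv /= (ltW t0).
exact: subset_closure.
Qed.

Lemma hslab_slab : hslab `<=` slab O T.
Proof.
move=> [t x] [/= + Ox]; rewrite in_itv /= => /andP[t0 tT]; split => //=.
by rewrite in_itv /= t0 ltW.
Qed.

Lemma EFin_I3 T' (f : E -> R) : cts (slab O T') f ->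
  (\int[mu3]_(p in cyl T' O) (f p)%:E = (I3 T' O f)%:E)%E.
Proof. by move=> cf; rewrite /Rintegral fineK //; exact: (integrable_fin_num (measurable_cyl hO T') (cts_integrable hO cf)). Qed.

Lemma EFin_I2 T' (f : E -> R) t : 0 <= t <= T' -> cts (slab O T') f ->
  (\int[mu2]_(x in O) (f (t, x))%:E = (I2 O (fun x => f (t, x)))%:E)%E.
Proof.
move=> tT cf; rewrite /Rintegral fineK //.
exact: (integrable_fin_num (measurable_O hO) (slice_integrable hO tT cf)).
Qed.

Section TerminalSlice.
Variables (V : set E) (homega : set E) (oV : open V) (homegaE : homega = (`[0, T] `*` O) `&` V).
Variables (H HT : E -> R).
Hypotheses (cH : cts hslab H) (cHT : cts (slab O T) HT) (HHT : forall x, H (T, x) = HT (T, x)).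

(** At t = T the time weight has an arbitrary value, possibly negative; the slice is
removed before any positivity is used. *)
Definition before_T : set E := (`[0, T[ `*` O) `&` V.

Lemma measurable_before_T : measurable (before_T : set (measurableTypeR R * (measurableTypeR R * measurableTypeR R))).
Proof.
apply: measurableI; last exact: open_measurable3.
by apply: measurableX; [exact: measurable_itv | exact: measurable_O].
Qed.

Lemma integral_before_T :
  (\int[mu3]_(p in homega) (H p)%:E = \int[mu3]_(p in before_T) (H p)%:E)%E.
Proof.
pose N : set E := ([set T] `*` O) `&` V.
have mN : measurable (N : set (measurableTypeR R * (measurableTypeR R * measurableTypeR R))).
  apply: measurableI; last exact: open_measurable3.
  by apply: measurableX; [exact: measurable_set1 | exact: measurable_O].
have hU : homega = before_T `|` N.
  rewrite homegaE; apply/seteqP; split => [[t x] [[/= + Ox] Vp]|[t x] [[[/= + Ox] Vp]|[[/= -> Ox] Vp]]].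
  - rewrite in_itv /= => /andP[t0]; rewrite le_eqVlt => /predU1P[tT|tT].
      by right; split; [rewrite tT; split | exact: Vp].
    by left; split; [split; [rewrite /= in_itv /= t0 | exact: Ox] | exact: Vp].
  - rewrite in_itv /= => /andP[t0 tT].
    by split; [split; [rewrite /= in_itv /= t0 ltW | exact: Ox] | exact: Vp].
  - by split; [split; [rewrite /= in_itv /= lexx ltW | exact: Ox] | exact: Vp].
have sB : before_T `<=` hslab by move=> [t x] [[/= tT Ox] _]; split => //; exact: subset_closure.
have mB := measurable_before_T.
have f1 : measurable_fun (before_T : set (measurableTypeR R * (measurableTypeR R * measurableTypeR R))) H.
  by apply: cts_measurable3 => //; exact: cts_subset cH.
have f2 : measurable_fun (N : set (measurableTypeR R * (measurableTypeR R * measurableTypeR R))) H.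
  apply: (@eq_measurable_fun _ _ _ _ _ HT).
    by move=> [t x]; rewrite inE => -[[/= -> _] _].
  apply: cts_measurable3 => //; apply: cts_subset cHT => -[t x] [[/= -> Ox] _].
  by split => /=; [rewrite in_itv /= lexx ltW | exact: subset_closure].
have N0 : mu3 N = 0%E.
  have mX : measurable ([set T] `*` O : set (measurableTypeR R * (measurableTypeR R * measurableTypeR R))).
    by apply: measurableX; [exact: measurable_set1 | exact: measurable_O].
  have X0 : mu3 ([set T] `*` O) = 0%E.
    have mO := measurable_O hO; rewrite /leb3 product_measure1E //=.
    by rewrite lebesgue_measure_set1 mul0e.
  by apply: (subset_measure0 mN mX _ X0); exact: subIsetl.
rewrite hU integral_setU //.
- rewrite (null_set_integral mN) ?adde0 //; exact/measurable_EFinP.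
- by apply/measurable_EFinP; apply/measurable_funU.
- apply/disj_setPS => -[t x] [[[tT _] _] [[te _] _]]; move: tT te.
  by rewrite /= in_itv /= => /andP[_ tT] te; move: tT; rewrite te ltxx.
Qed.
End TerminalSlice.

(** Passage to the limit T' -> T: the bulk integrals increase, the terminal energy
tends to 0, and the cut-off weight is absorbed by the integral over the set that
carries it. *)
Lemma carleman_limit (Ta a3 A K C i : R) (B Rf H : E -> R) (chi : C1fun O T) (Q : set E) :
  0 <= Ta < T -> 0 <= a3 -> 0 <= A -> 0 <= K -> 0 <= C ->
  cts hslab B -> cts hslab Rf -> cts hslab H ->
  (forall p, cyl T O p -> 0 <= B p) -> (forall p, cyl T O p -> 0 <= Rf p) ->
  (forall p, cyl T O p -> 0 <= H p) -> (forall p, Q p -> 0 <= H p) ->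
  (forall p, cyl T O p -> 0 <= chi p <= K) -> (forall p, cyl T O p -> ~ Q p -> chi p = 0) ->
  measurable (Q : set (measurableTypeR R * (measurableTypeR R * measurableTypeR R))) ->
  (forall T', Ta < T' < T ->
    I3 T' O B + i <= I3 T' O (fun p => a3 * Rf p + A * chi p * H p) + C * (T - T')) ->
  (\int[mu3]_(p in cyl T O) (B p)%:E + i%:E <=
   a3%:E * \int[mu3]_(p in cyl T O) (Rf p)%:E
   + (A * K)%:E * \int[mu3]_(p in Q) (H p)%:E)%E.
Proof.
move=> /andP[Ta0 TaT] a30 A0 K0 C0 cB cR cH B0 R0 H0 HQ0 chi01 chiQ mQ main.
set b := (X in (_ <= X)%E).
have sub T' : T' < T -> cyl T' O `<=` cyl T O by move=> h; exact: (cyl_sub (ltW h)).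
have ctsS T' (f : E -> R) : T' < T -> cts hslab f -> cts (slab O T') f.
  by move=> h; apply: cts_subset; exact: slab_hslab.
have mC T' := measurable_cyl hO T'.
have mf T' (f : E -> R) : T' < T -> cts hslab f ->
    measurable_fun (cyl T' O : set (measurableTypeR R * (measurableTypeR R * measurableTypeR R))) f.
  move=> h cf; apply: cts_measurable3; first exact: mC.
  by apply: cts_subset (ctsS T' f h cf); exact: cyl_slab.
have step T' : Ta < T' < T ->
    (\int[mu3]_(p in cyl T' O) (B p)%:E + i%:E <= b + (C * (T - T'))%:E)%E.
  move=> h; have hT : T' < T by case/andP: h.
  have cS : cts (slab O T') (fun p => a3 * Rf p + A * chi p * H p).
    apply: cts_add; first by apply: cts_mul; [exact: cts_cst | exact: ctsS].
    apply: cts_mul; last exact: ctsS.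
    by apply: cts_mul; [exact: cts_cst | exact: (cts_val (C1restr (ltW hT) chi))].
  rewrite EFin_I3; last exact: ctsS.
  rewrite -EFinD; apply: (@le_trans _ _ (I3 T' O (fun p => a3 * Rf p + A * chi p * H p)
     + C * (T - T'))%:E); first by rewrite lee_fin; exact: main.
  rewrite EFinD leeD2r // -EFin_I3 //.
  pose HQ : E -> R := H \_ Q.
  have mHQ : measurable_fun (cyl T' O : set (measurableTypeR R * (measurableTypeR R * measurableTypeR R))) HQ.
    apply: (measurable_restrict H mQ (mC T')).1.
    by apply: (measurable_funS (mC T')); [exact: subIsetl | exact: mf].
  have HQ0' p : cyl T' O p -> 0 <= HQ p.
    by move=> Up; rewrite /HQ /patch; case: ifP => // /set_mem; exact: HQ0.
  apply: (@le_trans _ _ (\int[mu3]_(p in cyl T' O) (a3 * Rf p + A * K * HQ p)%:E)%E).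
    apply: ge0_le_integral => //.
    - move=> p /(sub _ hT) Up; rewrite lee_fin addr_ge0 // mulr_ge0 ?R0 ?H0 //.
      by rewrite mulr_ge0 //; case/andP: (chi01 p Up).
    - apply/measurable_EFinP; apply: cts_measurable3; first exact: mC.
      by apply: cts_subset cS; exact: cyl_slab.
    - apply/measurable_EFinP; apply: measurable_funD; apply: measurable_funM => //.
      by apply: mf.
    - move=> p /(sub _ hT) Up; rewrite lee_fin lerD2l /HQ /patch.
      case: ifPn => [_|/negP nQ].
        apply: ler_wpM2r; first exact: H0.
        by apply: ler_wpM2l => //; case/andP: (chi01 p Up).
      by rewrite chiQ ?mulr0 ?mul0r // => Qp; apply: nQ; exact: mem_set.
  have R0' p : cyl T' O p -> 0 <= Rf p by move=> /(sub _ hT); exact: R0.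
  rewrite ge0_integral_comb //; [|exact: mf|exact: mulr_ge0].
  rewrite /b; apply: leeD; apply: lee_wpmul2l; rewrite ?lee_fin ?mulr_ge0 //.
    by apply: integral_subset_bound => //; exact: sub.
  have -> : (\int[mu3]_(p in cyl T' O) (HQ p)%:E = \int[mu3]_(p in cyl T' O `&` Q) (H p)%:E)%E.
    rewrite [RHS]integral_mkcondr; apply: eq_integral => p _.
    by rewrite /HQ /patch; case: ifP.
  by apply: integral_subset_bound => //; exact: subIsetr.
have up T' : Ta < T' < T -> (\int[mu3]_(p in cyl T' O) (B p)%:E + i%:E <= b)%E.
  move=> /andP[h1 h2]; apply/lee_addgt0Pr => e e0.
  pose d := Num.min (T - T') (e / (C + 1)).
  have C1 : 0 < C + 1 by apply: ltr_wpDl.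
  have d0 : 0 < d by rewrite lt_min subr_gt0 h2 divr_gt0.
  have dT : d <= T - T' by rewrite ge_min lexx.
  have de : C * d <= e.
    have : d <= e / (C + 1) by rewrite ge_min lexx orbT.
    rewrite ler_pdivlMr // mulrDr mulr1 mulrC => h3.
    by apply: le_trans h3; rewrite lerDl ltW.
  have hT'' : Ta < T - d < T by apply/andP; split; move: h1 dT d0; clear; lra.
  have := step _ hT''; rewrite (_ : T - (T - d) = d); last by ring.
  move=> h3; apply: (@le_trans _ _ (b + (C * d)%:E)%E); last by rewrite leeD2l // lee_fin.
  apply: le_trans h3; rewrite leeD2r //; apply: integral_subset_bound.
    by move=> p /(sub _ (_ : T - d < T)) Up; apply: B0; apply: Up; case/andP: hT''.
  by apply: cyl_sub; move: dT; clear; lra.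
rewrite -leeBrDr //; pose Tn (n : nat) := T - (T - Ta) / n.+2%:R.
have TTa : 0 < T - Ta by rewrite subr_gt0.
have n2 (n : nat) : 0 < (n.+2%:R : R) by rewrite ltr0n.
have hTn n : Ta < Tn n < T.
  apply/andP; split; last by rewrite /Tn gtrBl divr_gt0.
  by rewrite /Tn ltrBrDr -ltrBrDl ltr_pdivrMr // ltr_pMr // ltr1n.
apply: (@integral_exhaust _ _ R mu3 (fun n => cyl (Tn n) O) (cyl T O) B) => //.
- move=> n k nk; apply: cyl_sub; rewrite /Tn lerD2l lerN2 ler_wpM2l ?(ltW TTa) //.
  by rewrite lef_pV2 ?posrE // ler_nat.
- by move=> n; apply: sub; case/andP: (hTn n).
- move=> [t x] [/=]; rewrite in_itv /= => /andP[t0 tT] Ox.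
  have Tt : 0 < T - t by rewrite subr_gt0.
  have [n hn] : exists n : nat, (T - Ta) / (T - t) <= n%:R.
    by exists (Num.truncn ((T - Ta) / (T - t))).+1; apply/ltW; exact: truncnS_gt.
  exists n; split => //=; rewrite in_itv /= t0 /= /Tn ltrBrDr -ltrBrDl ltr_pdivrMr //.
  rewrite ler_pdivrMr // mulrC in hn; apply: (le_lt_trans hn).
  by rewrite ltr_pM2l // ltr_nat ltnS leqnSn.
- apply: cts_measurable3; first exact: mC.
  by apply: cts_subset cB; exact: cyl_hslab.
- by move=> n; rewrite leeBrDr //; exact: up.
Qed.
End Limit.

(** * The weights of the statement *)

Section GlobalWeights.
Context {R : realType}.
Let E := (R * (R * R))%type.
Variables (O : set (R * R)) (T : R) (Psi z : C2fun O T) (sg chi : C1fun O T).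
Variables (nu K m lam s : R) (Theta : R -> R -> R).

Definition ew (p : E) : R := expR (- 2 * s * phi m s lam Theta Psi p).
Let Xi := xi m s lam Theta Psi.

Definition grad_term (p : E) : R := Xi p * (cx z p ^+ 2 + cy z p ^+ 2) * ew p.
Definition zero_term (p : E) : R := Xi p ^+ 3 * z p ^+ 2 * ew p.
Definition rhs_term (p : E) : R := (- sg p * ct z p - nu * lapz z p) ^+ 2 * ew p.

(** On the cylinders of height T' < T the weights of the statement are those of the
conjugation, with W = s lam xi. *)
Section Restriction.
Variables (T' : R) (h : T' <= T) (th : C1fun O T').
Hypothesis thE : forall p, th p = Theta (mu_par m s lam) p.1.

Lemma W_restr p : W (C2restr h Psi) th m lam s p = s * lam * Xi p.
Proof. by rewrite W_val /ewt -lock /Xi /xi /psi /= thE. Qed.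

Lemma Ewt_restr p : Ewt (C2restr h Psi) th m lam s p ^+ 2 = ew p.
Proof.
rewrite /Ewt /Phi /ewt -!lock /= -expRM_natl /ew /phi /psi /Lam thE; congr expR.
by ring.
Qed.

Lemma bulk_restr p : bulk (C2restr h Psi) (C2restr h z) th m lam s p =
  s * lam ^+ 2 * grad_term p + s ^+ 3 * lam ^+ 4 * zero_term p.
Proof. by rewrite /bulk W_restr Ewt_restr /grad_term /zero_term /=; ring. Qed.

Lemma initial_restr p : initial (C2restr h Psi) (C2restr h z) th m lam s p =
  (cx z p ^+ 2 + cy z p ^+ 2) * ew p
  + s ^+ 2 * lam ^+ 3 * expR (2 * lam * (6 * m + 1)) * (z p ^+ 2 * ew p).
Proof. by rewrite /initial Ewt_restr /=; ring. Qed.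

Lemma source_restr p : source (C2restr h Psi) (C2restr h z) (C1restr h sg) (C1restr h chi) th
    nu K m lam s p =
  3 * rhs_term p + K ^+ 5 * (s ^+ 3 * lam ^+ 4) * chi p * zero_term p.
Proof.
rewrite /source /rhs /wv -lock !C1E W_restr !exprMn !Ewt_restr /rhs_term /zero_term /lapz /Xi /xi /=.
by ring.
Qed.
End Restriction.

Hypothesis cTheta : cts `[0, T[ (Theta (mu_par m s lam)).

Lemma cts_Theta : cts (hslab O T) (fun p : E => Theta (mu_par m s lam) p.1).
Proof.
move=> p [p1 _]; apply/cts_eps => e e0.
have /cts_eps /(_ _ e0)[d d0 hd] := cTheta p1.
exists d => // q [q1 _] qp; apply: hd; first exact: q1.
apply: le_lt_trans qp; change (`|q.1 - p.1| <= Num.max `|q.1 - p.1| `|q.2 - p.2|).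
by rewrite le_max lexx.
Qed.

Lemma cts_exp_psi : cts (slab O T) (fun p : E => expR (lam * psi m Psi p)).
Proof.
apply: cts_comp; first exact: continuous_expR.
by rewrite /psi; cts_rules.
Qed.

Lemma cts_xi : cts (hslab O T) Xi.
Proof.
apply: cts_mul; first exact: cts_Theta.
by apply: cts_subset cts_exp_psi; exact: hslab_slab.
Qed.

Lemma cts_ew : cts (hslab O T) ew.
Proof.
apply: cts_comp; first exact: continuous_expR.
apply: cts_mul; first exact: cts_cst.
apply: cts_mul; first exact: cts_Theta.
apply: cts_add; first exact: cts_cst.
by apply: cts_opp; apply: cts_subset cts_exp_psi; exact: hslab_slab.
Qed.

Lemma cts_grad_term : cts (hslab O T) grad_term.
Proof.
apply: cts_mul; last exact: cts_ew.
apply: cts_mul; first exact: cts_xi.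
by apply: cts_subset (@hslab_slab _ O T) _; cts_rules.
Qed.

Lemma cts_zero_term : cts (hslab O T) zero_term.
Proof.
apply: cts_mul; last exact: cts_ew.
apply: cts_mul; first by apply: cts_exprn; exact: cts_xi.
by apply: cts_subset (@hslab_slab _ O T) _; cts_rules.
Qed.

Lemma cts_rhs_term : cts (hslab O T) rhs_term.
Proof.
apply: cts_mul; last exact: cts_ew.
by apply: cts_subset (@hslab_slab _ O T) _; rewrite /lapz; cts_rules.
Qed.

Lemma zero_term_ge0 p : 0 <= Theta (mu_par m s lam) p.1 -> 0 <= zero_term p.
Proof.
move=> t0; apply: mulr_ge0; last exact: expR_ge0.
apply: mulr_ge0; last exact: sqr_ge0.
by apply: exprn_ge0; apply: mulr_ge0 => //; exact: expR_ge0.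
Qed.

Lemma grad_term_ge0 p : 0 <= Theta (mu_par m s lam) p.1 -> 0 <= grad_term p.
Proof.
move=> t0; apply: mulr_ge0; last exact: expR_ge0.
apply: mulr_ge0; last by apply: addr_ge0; exact: sqr_ge0.
by apply: mulr_ge0 => //; exact: expR_ge0.
Qed.

Lemma rhs_term_ge0 p : 0 <= rhs_term p.
Proof. by apply: mulr_ge0; [exact: sqr_ge0 | exact: expR_ge0]. Qed.

(** The slice of zero_term at t = T, extended to all times by a constant theta = a. *)
Definition zero_term_at (a : R) (p : E) : R :=
  (a * expR (lam * psi m Psi p)) ^+ 3 * z p ^+ 2 *
  expR (- 2 * s * (a * (lam * expR (6 * lam * (m + 1)) - expR (lam * psi m Psi p)))).

Lemma cts_zero_term_at a : cts (slab O T) (zero_term_at a).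
Proof.
have ce := cts_exp_psi.
apply: cts_mul.
  apply: cts_mul; last by cts_rules.
  by apply: cts_exprn; apply: cts_mul => //; exact: cts_cst.
apply: cts_comp; first exact: continuous_expR.
apply: cts_mul; first exact: cts_cst.
apply: cts_mul; first exact: cts_cst.
by apply: cts_add; [exact: cts_cst | exact: cts_opp].
Qed.
End GlobalWeights.

Section Derivatives.
Context {R : realType}.
Variables (O : set (R * R)) (hO : bounded_domain O) (T : R) (z : C2fun O T).
Let oO : open O. Proof. by have [] := hO. Qed.

Lemma grad2_time (t : R) (x : R * R) : 0 <= t < T -> O x ->
  grad2 z (t, x) = cx z (t, x) ^+ 2 + cy z (t, x) ^+ 2.
Proof.
move=> tT Ox; have [[_ h1] [_ h2]] := is_dXY_time oO z tT Ox.
by rewrite /grad2 /dx1 /dx2 h1 h2 dX_c0 dY_c0.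
Qed.

Lemma dt_record p : cyl T O p -> dt z p = ct z p.
Proof. by move=> Up; have [_] := is_dT z Up; rewrite dT_c0. Qed.

Lemma lapl_record p : cyl T O p -> lapl z p = lapz z p.
Proof.
move=> Up; have N := open_nbhs_nbhs (conj (cyl_open (T:=T) oO) Up).
rewrite /lapl /lapz; congr (_ + _).
- have [_ <-] := is_dX (cx z) Up; apply: near_eq_derive.
  by apply: filterS N => q Uq; have [_] := is_dX z Uq; rewrite dX_c0.
- have [_ <-] := is_dY (cy z) Up; apply: near_eq_derive.
  by apply: filterS N => q Uq; have [_] := is_dY z Uq; rewrite dY_c0.
Qed.
End Derivatives.

(** * The Carleman estimate *)

Theorem theorem2p4 (R : realType)
  (Omega O : set (R * R))
  (hOmega : bounded_domain Omega) (hOmega2 : C2_boundary Omega)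
  (hO : bounded_domain O) (hO2 : C2_boundary O)
  (hOmegaO : Omega `<=` O)
  (T nu : R) (hT : 0 < T) (hnu : 0 < nu)
  (sigma : R * (R * R) -> R)
  (hsigma : class_C 2 (cyl T O) (`[0, T] `*` closure O) sigma)
  (hsigma_pos : 0 < inf [set sigma p | p in `[0, T] `*` closure O])
  (tomega homega : set (R * (R * R)))
  (htomega : rel_open (`[0, T] `*` (O `\` closure Omega)) tomega)
  (hhomega : rel_open (`[0, T] `*` O) homega)
  (homegas : compactly_contained tomega homega)
  (alpha : R) (tpsi : R * (R * R) -> R)
  (htpsi : is_tpsi T O tomega alpha tpsi)
  (T0 T1 : R) (hT0 : 0 < T0) (hT1 : 0 < T1) (hT1' : T1 <= 1 / 4)
  (hT01 : T0 + 2 * T1 < T)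
  (m : R) (hm : 1 <= m)
  (Theta : R -> R -> R) (hTheta : is_theta_family T T0 T1 m Theta) :
  exists C0 s0 lam0 : R, [/\ 0 < C0, 1 <= s0, 1 <= lam0 &
    forall z : R * (R * R) -> R,
      smooth (cyl T O) (closure (cyl T O)) z ->
      (forall t x, 0 < t < T -> bdry O x -> z (t, x) = 0) ->
    forall s lam : R, s0 <= s -> lam0 <= lam ->
      let phi := phi m s lam Theta tpsi in
      let xi := xi m s lam Theta tpsi in
      (\int[leb2 R]_(x in O)
           (grad2 z (0, x) * expR (- 2 * s * phi (0, x)))%:E
       + (s ^+ 2 * lam ^+ 3 * expR (2 * lam * (6 * m + 1)))%:E *
         \int[leb2 R]_(x in O)
           (z (0, x) ^+ 2 * expR (- 2 * s * phi (0, x)))%:E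
       + (s * lam ^+ 2)%:E *
         \int[leb3 R]_(p in cyl T O)
           (xi p * grad2 z p * expR (- 2 * s * phi p))%:E
       + (s ^+ 3 * lam ^+ 4)%:E *
         \int[leb3 R]_(p in cyl T O)
           (xi p ^+ 3 * z p ^+ 2 * expR (- 2 * s * phi p))%:E
       <=
       C0%:E *
         \int[leb3 R]_(p in cyl T O)
           ((- sigma p * dt z p - nu * lapl z p) ^+ 2
            * expR (- 2 * s * phi p))%:E
       + (C0 * s ^+ 3 * lam ^+ 4)%:E *
         \int[leb3 R]_(p in homega)
           (xi p ^+ 3 * z p ^+ 2 * expR (- 2 * s * phi p))%:E)%E].
Proof.
have oO : open O by case: hO.
have clT := slab_closure (O := O) hT.
have [Psi PsiE] : exists F : C2fun O T, val F = tpsi.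
  by have [h _ _ _ _] := htpsi; exact: (class_C2P oO clT h).
have [Sg SgE] : exists F : C2fun O T, val F = sigma.
  exact: (class_C2P oO (@subset_refl _ (slab O T)) hsigma).
subst tpsi sigma; pose sg := c0 Sg.
have a0 : 0 < alpha by have [_ _ _ _ []] := htpsi.
(* Kc separates the region where grad Psi may vanish from the complement of homega,
   and V is a neighbourhood of Kc that the cut-off chi may charge *)
have [V0 oV0 hE] := hhomega.
have [Kc [cK omK KH]] := homegas.
have [V [oV KV VO VH]] := rel_openX oO hhomega KH.
have Psi_grad := tpsi_grad hT htpsi cK omK.
have [D [chi [y0 [h0 [D0 Dpos [chi0 chi1] chiV lay]]]]] :=
  layer_function hO a0 (tpsi_bdry htpsi) (tpsi_min hT htpsi) cK oV KV VO Psi_grad.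
have [Kt Kt0 hKt] := theta_bounds hT0 hT1 hT1' hT01 hm hTheta.
have sgpos p : slab O T p -> inf [set Sg p | p in `[0, T] `*` closure O] <= sg p.
  move=> Sp; apply: ge_inf; last by exists p.
  have [M M0 hM] := cts_bounded (compact_slab hO (T := T)) (cts_val sg).
  exists (- M) => _ [q Sq <-]; have := hM q Sq; rewrite ler_norml; by case/andP.
have [K [k [K4 k0 k2 kK [KtK coef]]]] := uniform_coefs hO (2 * Kt) hnu hsigma_pos a0 sgpos
  (fun p Sp => tpsi_range hT htpsi Sp) chi0 chi1 Psi_grad.
have [c [l0 [cpos slab_est]]] := slab_estimate K4 k0 k2 kK hT0.
have K0 : 0 <= K by apply: le_trans K4.
have K60 : 0 <= K ^+ 6 by exact: exprn_ge0.
(* the source has the coefficient 3 / c, and the local term K ^+ 6 / c: K ^+ 5 is the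
   constant of the pointwise inequality, and the last factor K bounds chi *)
exists ((3 + K ^+ 6) / c), 1, (Num.max 1 l0); split => //.
- by rewrite divr_gt0 // ltr_wpDr.
- by rewrite le_max lexx.
move=> z hz z0 s lam s1; rewrite ge_max => /andP[lam1 laml0]; cbv zeta.
have [Z ZE] : exists F : C2fun O T, val F = z by exact: (class_C2P oO clT (hz 2%N)).
subst z.
have mu2 := mu_par_gt2 hm lam1 s1.
set mu := mu_par m s lam in mu2.
have [th1 [th2 [ext bnd]]] := hKt mu mu2.
have [ec0 ec1 ec2 ed1 ed2] := ext.
have s0 : 0 <= s by apply: le_trans s1.
have lam0 : 0 <= lam by apply: le_trans lam1.
have th_ge1 t (tT : 0 <= t < T) := theta_ge1 hT1 hT1' hT01 hm hTheta mu2 tT.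
have th_ge0 p : cyl T O p -> 0 <= Theta mu p.1.
  move=> [+ _]; rewrite /= in_itv /= => /andP[/ltW t0 tT].
  by apply: le_trans (th_ge1 p.1 _); rewrite ?t0.
have psi01 p (Sp : slab O T p) := tpsi_range hT htpsi Sp.
have [Ce Ce0 term] := terminal_energy hO Z sg chi nu hm lam1 s1 Kt0 psi01.
pose X := s ^+ 2 * lam ^+ 3 * expR (2 * lam * (6 * m + 1)).
pose ini p := (cx Z p ^+ 2 + cy Z p ^+ 2) * ew Psi m lam s Theta p
  + X * (Z p ^+ 2 * ew Psi m lam s Theta p).
pose gt := grad_term Psi Z m lam s Theta.
pose zt := zero_term Psi Z m lam s Theta.
pose rt := rhs_term Psi Z sg nu m lam s Theta.
pose bulkg p := s * lam ^+ 2 * gt p + s ^+ 3 * lam ^+ 4 * zt p.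
pose vol := fine (leb2 R O).
have vol0 : 0 <= vol by apply: fine_ge0; exact: measure_ge0.
(* on ]T - T1, T[ theta is increasing and at least 1 / (T - t), which makes the
   energy at time T' of order T - T' *)
have real_est T' : T - T1 < T' < T ->
    I3 T' O bulkg + I2 O (fun x => ini (0, x)) <=
    I3 T' O (fun p => 3 / c * rt p + K ^+ 5 * (s ^+ 3 * lam ^+ 4) / c * chi p * zt p)
    + Ce * vol / c * (T - T').
  move=> h; case/andP: (h) => h1 h2; have h2' := ltW h2.
  have T'0 : 0 < T' by move: h1 hT0 hT1 hT01; clear; lra.
  have sub t : 0 <= t < T' -> 0 <= t < T by case/andP=> -> /lt_trans ->.
  pose th := C1time O h2 ec0 ec1 ed1; pose tht := C1time O h2 ec1 ec2 ed2.
  have main : c * I3 T' O (bulk (C2restr h2' Psi) (C2restr h2' Z) th m lam s)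
    + c * I2 O (fun x => initial (C2restr h2' Psi) (C2restr h2' Z) th m lam s (0, x)) <=
    I3 T' O (source (C2restr h2' Psi) (C2restr h2' Z) (C1restr h2' sg) (C1restr h2' chi) th nu K m lam s)
    + I2 O (fun x => `|energy (C2restr h2' Psi) (C2restr h2' Z) (C1restr h2' sg)
        (C1restr h2' chi) th tht nu m lam s (T', x)|).
    apply: (slab_est O hO T' T'0 (C2restr h2' Psi) (C2restr h2' Z) (C1restr h2' sg)
      (C1restr h2' chi) th tht (C1restr h2' D) nu m lam s alpha y0) => //.
    - move=> p [+ Op]; rewrite /= in_itv /= => /andP[p0 pT'].
      have pT : 0 < p.1 < T by rewrite p0 (lt_trans pT').
      have pT0 : 0 <= p.1 < T by case/andP: pT => /ltW ->.
      have [bn1 bn2] := bnd p.1 pT; have tp := th_ge1 p.1 pT0.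
      have tn n : 0 <= Theta mu p.1 ^+ n by apply: exprn_ge0; apply: le_trans tp.
      split; [exact: coef | exact: tp | |].
      + apply: (@le_trans _ _ (2 * Kt * Theta mu p.1 ^+ 2)); last exact: ler_wpM2r.
        by rewrite -mulrA ler_pM2l.
      + apply: (@le_trans _ _ (2 * Kt * (Theta mu p.1 ^+ 3 + mu ^+ 2))).
          by rewrite -mulrA ler_pM2l.
        by apply: ler_wpM2r => //; apply: addr_ge0; [exact: tn | exact: sqr_ge0].
    - move=> x Ox; have pT0 : 0 <= (0 : R) < T by rewrite lexx.
      have [[_ _ b1 b2 _] [b3 b4 b5 b6] _ _ [[b7 _ _ _] _]] := coef (0, x) pT0 Ox.
      split; split => //; first exact: (theta_0 hT0 hTheta mu2).
      exact: (theta1_0 hT0 hT1 hT01 hTheta mu2 ext).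
    - by move=> t y /andP[t0 tT] By; apply: z0 => //; rewrite t0 (lt_trans tT).
    - move=> t y /andP[/ltW t0 /ltW tT] By; apply: (tpsi_bdry htpsi) => //.
      by rewrite t0 (le_trans tT).
    - move=> t x /andP[/ltW t0 /ltW tT] Ox; apply: (tpsi_min hT htpsi) => //.
      by rewrite t0 (le_trans tT).
    - by move=> t y /andP[t0 tT] By; apply: D0 => //; rewrite t0 (lt_trans tT).
    - by move=> t x /sub; exact: Dpos.
    - have [e e0 he] := lay T' T'0 h2; exists e => // p Up De; have st := he p Up De; split => //.
      have [pc _ _ _ _] := st; have [+ Op] := Up; rewrite /= in_itv /= => /andP[/ltW p0 pT'].
      apply: Psi_grad => //; first by apply: sub; rewrite p0.
      by move=> /chi1; rewrite pc ler10.
  have thE p : th p = Theta mu p.1 by [].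
  have eB : I3 T' O (bulk (C2restr h2' Psi) (C2restr h2' Z) th m lam s) = I3 T' O bulkg.
    by apply: eq_Rintegral => p _; rewrite (bulk_restr Psi Z h2' thE).
  have eI : I2 O (fun x => initial (C2restr h2' Psi) (C2restr h2' Z) th m lam s (0, x))
      = I2 O (fun x => ini (0, x)).
    by apply: eq_Rintegral => x _; rewrite (initial_restr Psi Z h2' thE).
  pose src p := 3 * rt p + K ^+ 5 * (s ^+ 3 * lam ^+ 4) * chi p * zt p.
  have eS : I3 T' O (source (C2restr h2' Psi) (C2restr h2' Z) (C1restr h2' sg)
      (C1restr h2' chi) th nu K m lam s) = I3 T' O src.
    by apply: eq_Rintegral => p _; rewrite (source_restr Psi Z sg chi nu K h2' thE).
  have csrc : cts (slab O T') src.
    have sub' := slab_hslab (O := O) h2.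
    apply: cts_add.
      apply: cts_mul; first exact: cts_cst.
      by apply: cts_subset sub' _; exact: cts_rhs_term.
    apply: cts_mul; last by apply: cts_subset sub' _; exact: cts_zero_term.
    by apply: cts_mul; [exact: cts_cst | exact: (cts_val (C1restr h2' chi))].
  have eR : I3 T' O (fun p => 3 / c * rt p + K ^+ 5 * (s ^+ 3 * lam ^+ 4) / c * chi p * zt p)
      = c^-1 * I3 T' O src.
    rewrite -(I3Z hO _ csrc); apply: eq_Rintegral => p _.
    by rewrite /src; field; rewrite gt_eqF.
  have eN : I2 O (fun x => `|energy (C2restr h2' Psi) (C2restr h2' Z) (C1restr h2' sg)
        (C1restr h2' chi) th tht nu m lam s (T', x)|) <= Ce * vol * (T - T').
    have T'T' : 0 <= T' <= T' by rewrite lexx ltW.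
    apply: (@le_trans _ _ (I2 O (fun=> Ce * (T - T')))).
      apply: (I2_le hO (T := T') (f := fun p => `|energy (C2restr h2' Psi) (C2restr h2' Z)
        (C1restr h2' sg) (C1restr h2' chi) th tht nu m lam s p|)
        (g := fun=> Ce * (T - T')) (s := T') (t := T')) => //.
      - by apply: cts_comp; [exact: norm_continuous | exact: cts_val].
      - exact: cts_cst.
      - move=> x Ox; have hT' : T - T1 <= T' < T by rewrite (ltW h1).
        have tl := theta_tail hT1' hm hTheta mu2 hT'.
        have T'T : 0 < T' < T by rewrite T'0.
        have t1 : 1 <= th (T', x) by apply: th_ge1; rewrite ltW.
        apply: le_trans (term T' h2' th tht x (ltW T'0) Ox t1 _) _.
          have [bn1 _] := bnd T' T'T; apply/andP; split; last exact: bn1.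
          exact: (theta1_tail_ge0 hT0 hT1 hT01 hm hTheta mu2 ext h).
        apply: ler_wpM2l => //; rewrite -[T - T']invrK lef_pV2 ?posrE //.
          by apply: lt_le_trans t1.
        by rewrite invr_gt0 subr_gt0.
    rewrite (Rintegral_cst _ (measurable_O hO)) -/vol.
    by rewrite le_eqVlt; apply/orP; left; apply/eqP; ring.
  rewrite eB eI eS in main; rewrite eR.
  have := ler_wpM2l (ltW (_ : 0 < c^-1)) (le_trans main (lerD (lexx _) eN)).
  rewrite invr_gt0 => /(_ cpos).
  have -> : c^-1 * (c * I3 T' O bulkg + c * I2 O (fun x => ini (0, x))) =
    I3 T' O bulkg + I2 O (fun x => ini (0, x)) by field; rewrite gt_eqF.
  by move/le_trans; apply; rewrite le_eqVlt; apply/orP; left; apply/eqP; ring.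
have Ta : 0 <= T - T1 < T.
  by apply/andP; split; move: hT0 hT1 hT01; clear; lra.
have ch0K p : cyl T O p -> 0 <= chi p <= K.
  move=> [+ Op]; rewrite /= in_itv /= => /andP[/ltW p0 pT]; rewrite chi0 /=.
  have pT0 : 0 <= p.1 < T by rewrite p0.
  have [_ _ _ _ [_ [h _ _ _]]] := coef p pT0 Op.
  by apply: le_trans h; exact: ler_norm.
have cgt : cts (hslab O T) gt by exact: cts_grad_term.
have czt : cts (hslab O T) zt by exact: cts_zero_term.
have crt : cts (hslab O T) rt by exact: cts_rhs_term.
have cbulk : cts (hslab O T) bulkg.
  by apply: cts_add; apply: cts_mul => //; exact: cts_cst.
have gt0 p : cyl T O p -> 0 <= gt p by move=> /th_ge0; exact: grad_term_ge0.
have zt0 p : cyl T O p -> 0 <= zt p by move=> /th_ge0; exact: zero_term_ge0.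
have rt0 p : 0 <= rt p by exact: rhs_term_ge0.
have sl2 : 0 <= s * lam ^+ 2 by apply: mulr_ge0 => //; exact: exprn_ge0.
have sl4 : 0 <= s ^+ 3 * lam ^+ 4 by apply: mulr_ge0; exact: exprn_ge0.
pose Q := before_T O T V0.
have mQ : measurable (Q : set (measurableTypeR R * (measurableTypeR R * measurableTypeR R))).
  exact: measurable_before_T.
have chiQ p : cyl T O p -> ~ Q p -> chi p = 0.
  move=> [+ Op] nQ; rewrite /= in_itv /= => /andP[/ltW p0 pT]; apply: chiV => Vp; apply: nQ.
  have : homega p by apply: VH => //; rewrite /= in_itv /= p0 ltW.
  by rewrite hE => -[_ V0p]; split; [split; [rewrite /= in_itv /= p0 | exact: Op] | exact: V0p].
have Q0 p : Q p -> 0 <= zt p.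
  move=> [[+ _] _]; rewrite /= in_itv /= => tT; apply: zero_term_ge0.
  by apply: le_trans (th_ge1 _ tT).
have K5 : 0 <= K ^+ 5 by exact: exprn_ge0.
have A0 : 0 <= K ^+ 5 * (s ^+ 3 * lam ^+ 4) / c by apply: divr_ge0; [exact: mulr_ge0 | exact: ltW].
have c30 : 0 <= 3 / c by rewrite divr_ge0 // ltW.
have Cv0 : 0 <= Ce * vol / c by apply: divr_ge0; [exact: mulr_ge0 | exact: ltW].
have bulk0 p : cyl T O p -> 0 <= bulkg p.
  by move=> Up; apply: addr_ge0; apply: mulr_ge0 => //; [exact: gt0 | exact: zt0].
have lim := carleman_limit hO Ta c30 A0 K0 Cv0 cbulk crt czt bulk0 (fun p _ => rt0 p) zt0 Q0
  ch0K chiQ mQ real_est.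
have mcyl := measurable_cyl hO T.
have mfc (f : R * (R * R) -> R) : cts (hslab O T) f ->
    measurable_fun (cyl T O : set (measurableTypeR R * (measurableTypeR R * measurableTypeR R))) f.
  by move=> cf; apply: cts_measurable3 => //; apply: cts_subset cf; exact: cyl_hslab.
have T0T : T0 < T by move: hT1 hT01; clear; lra.
have z0T0 : 0 <= (0 : R) <= T0 by rewrite lexx ltW.
have slT0 (f : R * (R * R) -> R) : cts (hslab O T) f -> cts (slab O T0) f.
  by apply: cts_subset; exact: slab_hslab.
have mfO (f : R * (R * R) -> R) : cts (hslab O T) f ->
    measurable_fun (O : set (measurableTypeR R * measurableTypeR R)) (fun x => f (0, x)).
  move=> /slT0 cf; apply: cts_measurable2; first exact: measurable_O.
  by apply: cts_subset (cts_slice z0T0 cf); exact: subset_closure.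
pose g0 p := (cx Z p ^+ 2 + cy Z p ^+ 2) * ew Psi m lam s Theta p.
pose f0 p := Z p ^+ 2 * ew Psi m lam s Theta p.
have cew := @cts_ew R O T Psi m lam s Theta ec0.
have cg0 : cts (hslab O T) g0.
  by apply: cts_mul => //; apply: cts_subset (@hslab_slab _ O T) _; cts_rules.
have cf0 : cts (hslab O T) f0.
  by apply: cts_mul => //; apply: cts_subset (@hslab_slab _ O T) _; cts_rules.
have g00 p : 0 <= g0 p.
  by apply: mulr_ge0; [apply: addr_ge0; exact: sqr_ge0 | exact: expR_ge0].
have f00 p : 0 <= f0 p by apply: mulr_ge0; [exact: sqr_ge0 | exact: expR_ge0].
have X0 : 0 <= X.
  apply: mulr_ge0; last exact: expR_ge0.
  by apply: mulr_ge0; exact: exprn_ge0.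
have cini : cts (hslab O T) ini.
  by apply: cts_add => //; apply: cts_mul => //; exact: cts_cst.
have eI : (\int[leb2 R]_(x in O) (grad2 Z (0%R, x) * expR (- 2 * s * phi m s lam Theta Psi (0%R, x)))%:E
   + X%:E * \int[leb2 R]_(x in O) (Z (0%R, x) ^+ 2 * expR (- 2 * s * phi m s lam Theta Psi (0%R, x)))%:E
   = (I2 O (fun x => ini (0%R, x)))%:E)%E.
  rewrite -(EFin_I2 hO z0T0 (slT0 _ cini)).
  transitivity (\int[leb2 R]_(x in O) (1 * g0 (0%R, x) + X * f0 (0%R, x))%:E)%E; last first.
    by apply: eq_integral => x _; rewrite mul1r.
  rewrite (ge0_integral_comb (leb2 R) (f := fun x => g0 (0, x)) (g := fun x => f0 (0, x))) //.
  - rewrite mul1e; congr (_ + _)%E; apply: eq_integral => x; rewrite inE => Ox.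
    by rewrite /g0 (grad2_time hO) // lexx.
  - exact: measurable_O.
  - exact: mfO.
  - exact: mfO.
have eB : (\int[leb3 R]_(p in cyl T O) (bulkg p)%:E =
   (s * lam ^+ 2)%:E * \int[leb3 R]_(p in cyl T O)
      (xi m s lam Theta Psi p * grad2 Z p * expR (- 2 * s * phi m s lam Theta Psi p))%:E
   + (s ^+ 3 * lam ^+ 4)%:E * \int[leb3 R]_(p in cyl T O)
      (xi m s lam Theta Psi p ^+ 3 * Z p ^+ 2 * expR (- 2 * s * phi m s lam Theta Psi p))%:E)%E.
  rewrite (ge0_integral_comb (leb3 R) (f := gt) (g := zt)) //; try exact: mfc.
  congr (_ * _ + _)%E; apply: eq_integral => -[t x]; rewrite inE => -[/=].
  rewrite in_itv /= => /andP[/ltW t0 tT] Ox.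
  by rewrite /gt /grad_term (grad2_time hO) // t0.
have eR : (\int[leb3 R]_(p in cyl T O) ((- Sg p * dt Z p - nu * lapl Z p) ^+ 2
     * expR (- 2 * s * phi m s lam Theta Psi p))%:E = \int[leb3 R]_(p in cyl T O) (rt p)%:E)%E.
  by apply: eq_integral => p; rewrite inE => Up; rewrite dt_record // (lapl_record hO).
have eH : (\int[leb3 R]_(p in homega) (xi m s lam Theta Psi p ^+ 3 * Z p ^+ 2
     * expR (- 2 * s * phi m s lam Theta Psi p))%:E = \int[leb3 R]_(p in Q) (zt p)%:E)%E.
  have cat := @cts_zero_term_at R O T Psi Z m lam s (Theta mu T).
  by rewrite -(integral_before_T hO hT oV0 hE czt cat).
rewrite -/X eI -addeA -eB eR eH addeC; apply: (le_trans lim).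
have IR0 : (0 <= \int[leb3 R]_(p in cyl T O) (rt p)%:E)%E.
  by apply: integral_ge0 => p _; rewrite lee_fin.
have IH0 : (0 <= \int[leb3 R]_(p in Q) (zt p)%:E)%E.
  by apply: integral_ge0 => p Qp; rewrite lee_fin Q0.
apply: leeD; apply: lee_wpmul2r => //; rewrite lee_fin.
  by rewrite ler_pM2r ?invr_gt0 // lerDl.
have -> : K ^+ 5 * (s ^+ 3 * lam ^+ 4) / c * K = K ^+ 6 / c * (s ^+ 3 * lam ^+ 4) by ring.
rewrite -[leRHS]mulrA; apply: ler_wpM2r => //.
by rewrite ler_pM2r ?invr_gt0 // lerDr.
Qed.
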